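(* For every $(U,V) \in H^1_{0,\bullet}(0,T;H_0^1(\Omega)) \times H^1_{0,\bullet}(0,T;L^2(\Omega))$ with $(U,V)\neq(0,0)$ there exists $(\lambda,\chi) \in L^2(0,T;H_0^1(\Omega)) \times L^2(Q_T)$, $(\lambda,\chi)\ne(0,0)$, such that $$\frac{\mathcal{A}((U,V),(\lambda,\chi))}{\| (U,V) \|_{\mathcal{V}_e(Q_T)}\,\| (\lambda,\chi) \|_{\mathcal{W}_e(Q_T)}} \ge \frac{1}{2\sqrt{C_\Omega^2/c_0^2+4T^2}}.$$
   Context: Setting: $\Omega\subset\mathbb{R}^d$ ($d\in\{1,2,3\}$) is a bounded Lipschitz polytopal domain, $T>0$, $Q_T=\Omega\times(0,T)$; $c\in L^\infty(\Omega)$ with $c(x)\ge c_0>0$ for a.e. $x\in\Omega$. $\nabla$ is the gradient in space. $C_\Omega>0$ is a constant in the Poincaré inequality $\|v\|_{L^2(\Omega)}\le C_\Omega\|\nabla v\|_{L^2(\Omega)}$ for all $v\in H^1_0(\Omega)$. For a Hilbert space $X$, $H^1_{0,\bullet}(0,T;X)=\{u\in H^1(0,T;X): u(0)=0\}$. Weighted product: $(\chi,\lambda)_{L^2_e(Q_T)}=\int_0^T(\chi(\cdot,s),\lambda(\cdot,s))_{L^2(\Omega)}e^{-s/T}\,ds$, with norm $\|\cdot\|_{L^2_e(Q_T)}$. Weighted duality: for $\chi\in L^2(0,T;[H^1_0(\Omega)]')$, $\lambda\in L^2(0,T;H^1_0(\Omega))$, $\langle\chi,\lambda\rangle_e=\int_0^T\langle\chi(\cdot,s),\lambda(\cdot,s)\rangle_{H^1_0(\Omega)}e^{-s/T}\,ds$,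 where $\langle\cdot,\cdot\rangle_{H^1_0(\Omega)}$ is the duality between $[H^1_0(\Omega)]'$ and $H^1_0(\Omega)$ (extending the $L^2(\Omega)$ product). Bilinear form: $\mathcal{A}((U,V),(\lambda,\chi))=\langle\partial_tV,\lambda\rangle_e+(c^2\nabla U,\nabla\lambda)_{L^2_e(Q_T)}-(\partial_tU,\chi)_{L^2_e(Q_T)}+(V,\chi)_{L^2_e(Q_T)}$. Newton potential: $\mathcal{N}^\Omega:[H^1_0(\Omega)]'\to H^1_0(\Omega)$ is defined by $(c^2\nabla\mathcal{N}^\Omega u,\nabla v)_{L^2(\Omega)}=\langle u,v\rangle_{H^1_0(\Omega)}$ for all $v\in H^1_0(\Omega)$; it is applied pointwise in time to functions in $L^2(0,T;[H^1_0(\Omega)]')$, and $\|U\|_{\mathcal{N}^\Omega_e}=\|c\nabla\mathcal{N}^\Omega U\|_{L^2_e(Q_T)}$. Norms: $\|(U,V)\|^2_{\mathcal{V}_e(Q_T)}=\|\partial_tU\|^2_{L^2_e(Q_T)}+\|\partial_tV\|^2_{\mathcal{N}^\Omega_e}+\|c\nabla U\|^2_{L^2_e(Q_T)}+\|V\|^2_{L^2_e(Q_T)}$ and $\|(\lambda,\chi)\|^2_{\mathcal{W}_e(Q_T)}=\|\lambda\|^2_{L^2_e(Q_T)}+\|\chi\|^2_{\mathcal{N}^\Omega_e}$. *)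

(* Defs.v *)
From HB Require Import structures.
From mathcomp Require Import all_boot all_order all_algebra.
From mathcomp Require Import all_classical all_reals all_analysis.
Set Implicit Arguments.
Unset Strict Implicit.
Unset Printing Implicit Defensive.
Import Order.TTheory GRing.Theory Num.Theory.
Import numFieldNormedType.Exports.
Local Open Scope classical_set_scope.
Local Open Scope ring_scope.

Fact rV_display : measure_display. Proof. exact: default_measure_display. Qed.

Section measurable_rV.
Variables (R : realType) (n : nat).

Let coord : 'I_n -> 'rV[R]_n -> measurableTypeR R := fun i x => x ord0 i.

Let rV_set0 : g_sigma_preimage coord set0.
Proof. exact: sigma_algebra0. Qed.

Let rV_setC A : g_sigma_preimage coord A -> g_sigma_preimage coord (~` A).
Proof. exact: sigma_algebraC. Qed.

Let rV_bigcup (F : (set 'rV[R]_n)^nat) :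
  (forall i, g_sigma_preimage coord (F i)) ->
  g_sigma_preimage coord (\bigcup_i (F i)).
Proof. exact: sigma_algebra_bigcup. Qed.

(* 'rV[R]_n carries the product of the Borel sigma-algebras of the
   coordinates, i.e. its own Borel sigma-algebra. *)
HB.instance Definition _ := @isMeasurable.Build rV_display
  'rV[R]_n (g_sigma_preimage coord) rV_set0 rV_setC rV_bigcup.

End measurable_rV.

Section lebesgue_rV.
Variable R : realType.

Definition rV_cons n (p : 'rV[R]_n * measurableTypeR R) : 'rV[R]_n.+1 :=
  row_mx (p.2)%:M p.1 : 'rV[R]_(1 + n).

Lemma measurable_coord n (i : 'I_n) :
  measurable_fun setT (fun x : 'rV[R]_n => x ord0 i : measurableTypeR R).
Proof.
move=> _ Y mY; rewrite setTI; apply: sub_sigma_algebra => /=.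
rewrite -bigcup_seq/=; exists i => /=; first by rewrite mem_index_enum.
by exists Y => //; rewrite setTI.
Qed.

Lemma measurable_rV_cons n : measurable_fun setT (@rV_cons n).
Proof.
move=> _ Y mY; rewrite setTI.
suff : forall B, g_sigma_preimage
    (fun (i : 'I_n.+1) (x : 'rV[R]_n.+1) => x ord0 i : measurableTypeR R) B ->
  measurable (@rV_cons n @^-1` B) by exact.
apply: smallest_sub; first split.
- by rewrite /= preimage_set0.
- by move=> A mA; rewrite /= setTD -preimage_setC; exact: measurableC.
- by move=> F mF; rewrite /= preimage_bigcup; exact: bigcup_measurable.
rewrite -bigcup_seq/= => A [i _ [B mB <-]].
rewrite setTI -comp_preimage.
suff mi : measurable_fun setT
    ((fun x : 'rV[R]_n.+1 => x ord0 i : measurableTypeR R) \o @rV_cons n).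
  by rewrite -[X in measurable X]setTI; exact: mi.
have [j -> | ->] := unliftP ord0 i; last first.
  rewrite (_ : _ \o _ = snd); first exact: measurable_snd.
  apply/funext => -[x t]; rewrite /= /rV_cons mxE.
  by case: splitP => //= k _; rewrite mxE !ord1 eqxx mulr1n.
rewrite (_ : _ \o _ = (fun x : 'rV[R]_n => x ord0 j : measurableTypeR R) \o fst).
  by apply: measurableT_comp; [exact: measurable_coord|exact: measurable_fst].
apply/funext => -[x t]; rewrite /= /rV_cons mxE.
case: splitP => /= [k | k /eqP]; first by rewrite /bump ord1.
by rewrite eqSS => /eqP jk; congr (x _ _); exact/val_inj.
Qed.

Definition lebesgue_step n (m : {measure set 'rV[R]_n -> \bar R}) :
    set 'rV[R]_n.+1 -> \bar R :=
  pushforward (m \x @lebesgue_measure R)%E (@rV_cons n).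

HB.instance Definition _ n m := Measure.copy (@lebesgue_step n m)
  (measure_function_pushforward__canonical__measure_function_Measure
    (m \x @lebesgue_measure R)%E (@measurable_rV_cons n)).

(* The Dirac mass is the Lebesgue measure of the one-point space R^0. *)
Fixpoint lebesgue_rV n : {measure set 'rV[R]_n -> \bar R} :=
  if n is k.+1 then lebesgue_step (lebesgue_rV k) else \d_(0 : 'rV[R]_0).

End lebesgue_rV.

Section domains.
Variables (R : realType) (d : nat).
Implicit Types (Omega : set 'rV[R]_d) (x y e : 'rV[R]_d).

Definition rV_dot x y : R := \sum_i x ord0 i * y ord0 i.

Definition convex_hull m (p : 'I_m -> 'rV[R]_d) : set 'rV[R]_d :=
  [set y | exists w : 'I_m -> R, [/\ forall i, 0 <= w i, \sum_i w i = 1 &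
                                     y = \sum_i w i *: p i]].

Definition polytopal Omega := exists k (m : 'I_k -> nat)
    (p : forall j, 'I_(m j) -> 'rV[R]_d),
  closure Omega = [set x | exists j, convex_hull (p j) x].

(* Near every boundary point, Omega is the strict epigraph, in the direction
   of a unit vector e, of a Lipschitz function of the component orthogonal to
   e (g is only evaluated on the hyperplane orthogonal to e). *)
Definition lipschitz_boundary Omega :=
  forall x, closure Omega x -> ~ Omega x ->
    exists (e : 'rV[R]_d) (r : R) (g : 'rV[R]_d -> R),
      [/\ rV_dot e e = 1, 0 < r, lipschitz g &
          forall y, ball x r y ->
            Omega y <-> g (y - rV_dot y e *: e) < rV_dot y e].

Definition lipschitz_polytopal_domain Omega :=
  [/\ open Omega, connected Omega, Omega !=set0 & bounded_set Omega] /\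
  polytopal Omega /\ lipschitz_boundary Omega.

End domains.

Section test_functions.
Variables (R : realType) (V : normedModType R).

Fixpoint Ck (k : nat) (f : V -> R) : Prop :=
  if k is k'.+1 then
    continuous f /\
    forall v, (forall x, derivable f x v) /\ Ck k' ('D_v f)
  else continuous f.

Definition test_function (D : set V) : set (V -> R) :=
  [set phi | [/\ forall k, Ck k phi,
                 compact (closure [set x | phi x != 0]) &
                 closure [set x | phi x != 0] `<=` D]].

End test_functions.

Definition L2 d (T : measurableType d) (R : realType)
    (mu : {measure set T -> \bar R}) (D : set T) : set (T -> R) :=
  [set f | f \_ D \in Lfun mu 2%:E].

(* The carrier and the inner product of a Hilbert space.  Elements of L^2 and
   H^1_0 are represented by functions rather than by classes modulo a.e.
   equality, so hnorm below is only a seminorm and equality in the Hilbert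
   space is hnorm X (u - v) = 0. *)
Record hilbert_data (R : realType) (E : lmodType R) := HilbertData {
  hset : set E ;
  hdot : E -> E -> R }.

Definition hnorm (R : realType) (E : lmodType R) (X : hilbert_data E)
    (u : E) : R :=
  Num.sqrt (hdot X u u).

Section sobolev_space.
Variables (R : realType) (d : nat) (Omega : set 'rV[R]_d).
Implicit Types (u v w f : 'rV[R]_d -> R) (G : 'I_d -> 'rV[R]_d -> R).
Let mu := @lebesgue_rV R d.

Definition pderiv (i : 'I_d) f : 'rV[R]_d -> R := 'D_(delta_mx ord0 i) f.

Definition dotL2 f g : R := \int[mu]_(x in Omega) (f x * g x).

Definition L2_space : hilbert_data ('rV[R]_d -> R) :=
  HilbertData (L2 mu Omega) dotL2.

Definition weak_gradient u G :=
  forall i phi, test_function Omega phi ->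
    dotL2 u (pderiv i phi) = - dotL2 (G i) phi.

Definition cvgL2 (f_ : ('rV[R]_d -> R)^nat) f :=
  (\int[mu]_(x in Omega) ((f_ n x - f x) ^+ 2)%:E)%E @[n --> \oo] --> 0%E.

(* u lies in the closure of the test functions for the H^1 norm, and G is its
   weak gradient. *)
Definition H10_gradient u G :=
  [/\ forall i, L2 mu Omega (G i),
      weak_gradient u G &
      exists phi_ : ('rV[R]_d -> R)^nat,
        [/\ forall n, test_function Omega (phi_ n),
            cvgL2 phi_ u &
            forall i, cvgL2 (fun n => pderiv i (phi_ n)) (G i)]].

Definition H10 : set ('rV[R]_d -> R) :=
  [set u | L2 mu Omega u /\ exists G, H10_gradient u G].

(* The weak gradient, for u in H10; it is unique up to null sets. *)
Definition grad u : 'I_d -> 'rV[R]_d -> R :=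
  xget (fun _ _ => 0) [set G | H10_gradient u G].

Definition dotgrad u v (x : 'rV[R]_d) : R := \sum_i grad u i x * grad v i x.

Definition H10_space : hilbert_data ('rV[R]_d -> R) := HilbertData H10
  (fun u v => dotL2 u v + \int[mu]_(x in Omega) dotgrad u v x).

Definition poincare_constant (C : R) :=
  forall v, H10 v ->
    Num.sqrt (dotL2 v v)
      <= C * Num.sqrt (\int[mu]_(x in Omega) dotgrad v v x).

End sobolev_space.

Section bochner.
Variables (R : realType) (E : lmodType R) (X : hilbert_data E) (D : set R).
Implicit Types (u : R -> E).
Let leb := @lebesgue_measure R.

Record simple_data := SimpleData {
  simple_size : nat ;
  simple_set : 'I_simple_size -> set (measurableTypeR R) ;
  simple_val : 'I_simple_size -> E ;
  simple_measurable : forall i, measurable (simple_set i) ;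
  simple_in : forall i, hset X (simple_val i) }.

Definition simple_fun (s : simple_data) (t : R) : E :=
  \sum_(i < simple_size s) \1_(simple_set i) t *: simple_val i.

Definition simple_integral (s : simple_data) : E :=
  \sum_(i < simple_size s) fine (leb (simple_set i `&` D)) *: simple_val i.

Definition strongly_measurable u := exists s : nat -> simple_data,
  forall t, D t -> hnorm X (u t - simple_fun (s n) t) @[n --> \oo] --> (0 : R).

Definition L2B : set (R -> E) :=
  [set u | [/\ forall t, D t -> hset X (u t),
               strongly_measurable u &
               (\int[leb]_(t in D) ((hnorm X (u t)) ^+ 2)%:E < +oo)%E]].

Definition is_bochner_integral u (I : E) :=
  [/\ hset X I, strongly_measurable u &
      exists s : nat -> simple_data,
        (\int[leb]_(t in D) (hnorm X (u t - simple_fun (s n) t))%:E)%E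
          @[n --> \oo] --> 0%E /\
        hnorm X (I - simple_integral (s n)) @[n --> \oo] --> (0 : R)].

(* The integral of phi' u exists and equals that of - phi u'. *)
Definition weak_time_derivative u u' :=
  forall phi : R -> R, test_function D phi ->
    exists I, is_bochner_integral (fun t => derive1 phi t *: u t) I /\
              is_bochner_integral (fun t => - (phi t *: u' t)) I.

Definition H1B_derivative u : set (R -> E) :=
  [set u' | L2B u' /\ weak_time_derivative u u'].

Definition H1B : set (R -> E) :=
  [set u | L2B u /\ H1B_derivative u !=set0].

(* The weak time derivative, for u in H1B; it is unique up to null sets. *)
Definition dt u : R -> E := xget (fun=> 0) (H1B_derivative u).

End bochner.

(* u(0) = 0 refers to the representative of u that is continuous on [0, T]. *)
Definition H1_0dot (R : realType) (E : lmodType R) (X : hilbert_data E) (T : R) :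
    set (R -> E) :=
  [set u | H1B X `]0, T[ u /\
    exists u0 : R -> E,
      [/\ forall t, 0 <= t <= T -> hset X (u0 t),
          forall t, 0 <= t <= T ->
            hnorm X (u0 s - u0 t) @[s --> within `[0, T]%classic (nbhs t)] --> (0 : R),
          {ae @lebesgue_measure R, forall t,
             0 < t < T -> hnorm X (u0 t - u t) = 0} &
          hnorm X (u0 0) = 0]].

Section forms.
Variables (R : realType) (d : nat) (Omega : set 'rV[R]_d) (T : R).
Variable c : 'rV[R]_d -> R.
Local Notation fn := ('rV[R]_d -> R).
Implicit Types (u v : fn) (l : fn -> R) (U V lambda chi : R -> fn).
Let mu := @lebesgue_rV R d.

Definition Linfty : set fn := [set f | f \_ Omega \in Lfun mu +oo%E].

Definition QT : set ('rV[R]_d * measurableTypeR R) := Omega `*` `]0, T[%classic.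

Definition L2_QT : set ('rV[R]_d * measurableTypeR R -> R) :=
  L2 (mu \x @lebesgue_measure R)%E QT.

Definition slice (f : 'rV[R]_d * measurableTypeR R -> R) : R -> fn :=
  fun t x => f (x, t).

Definition weighted_integral (h : R -> R) : R :=
  \int[@lebesgue_measure R]_(s in `]0, T[) (h s * expR (- (s / T))).

Definition dotL2e U V : R :=
  weighted_integral (fun s => dotL2 Omega (U s) (V s)).

Definition normL2e U : R := Num.sqrt (dotL2e U U).

(* Elements of the dual of H^1_0 are functionals on functions, of which only
   the restriction to H10 matters. *)
Definition dualitye (L : R -> fn -> R) lambda : R :=
  weighted_integral (fun s => L s (lambda s)).

Definition L2_to_dual u : fn -> R := fun v => dotL2 Omega u v.

Definition c2grad u v : R :=
  \int[mu]_(x in Omega) (c x ^+ 2 * dotgrad Omega u v x).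

Definition c2grade U V : R :=
  weighted_integral (fun s => c2grad (U s) (V s)).

Definition normcgrade U : R := Num.sqrt (weighted_integral (fun s =>
  \int[mu]_(x in Omega) \sum_i (c x * grad Omega (U s) i x) ^+ 2)).

Definition newton l : fn :=
  xget (fun=> 0) [set w | H10 Omega w /\ forall v, H10 Omega v -> c2grad w v = l v].

Definition normNe (L : R -> fn -> R) : R := normcgrade (fun s => newton (L s)).

Definition dtH10 U : R -> fn := dt (H10_space Omega) `]0, T[ U.
Definition dtL2 V : R -> fn := dt (L2_space Omega) `]0, T[ V.

Definition formA U V lambda chi : R :=
  dualitye (fun s => L2_to_dual (dtL2 V s)) lambda + c2grade U lambda
  - dotL2e (dtH10 U) chi + dotL2e V chi.

Definition normVe U V : R :=
  Num.sqrt (normL2e (dtH10 U) ^+ 2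
            + normNe (fun s => L2_to_dual (dtL2 V s)) ^+ 2
            + normcgrade U ^+ 2 + normL2e V ^+ 2).

Definition normWe lambda chi : R :=
  Num.sqrt (normL2e lambda ^+ 2 + normNe (fun s => L2_to_dual (chi s)) ^+ 2).

Definition ae_zero U :=
  {ae @lebesgue_measure R, forall t, 0 < t < T ->
    {ae mu, forall x, Omega x -> U t x = 0}}.

Definition ae_zero_QT (f : 'rV[R]_d * measurableTypeR R -> R) :=
  {ae (mu \x @lebesgue_measure R)%E, forall z, QT z -> f z = 0}.

End forms.

(* Main.v *)
Require Import Defs.
From HB Require Import structures.
From mathcomp Require Import all_boot all_order all_algebra.
From mathcomp Require Import all_classical all_reals all_analysis.
From mathcomp Require Import measurable_realfun ess_sup_inf.
From mathcomp Require Import ring lra.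
Import Order.TTheory GRing.Theory Num.Theory.
Import numFieldNormedType.Exports.
Local Open Scope classical_set_scope.
Local Open Scope ring_scope.
Set Implicit Arguments.
Unset Strict Implicit.
Unset Printing Implicit Defensive.

(** The test pair is explicit. Write [N] for the Newton potential, [a] for the
form (c^2 grad u, grad v), with [a (N w) v = (w, v)], and U', V' for the time
derivatives. Take

    lambda = N V' + 2T U',    chi = - U' + 2T V'.

At almost every time the density of the bilinear form at this pair is
|U'|^2 + |V'|_N^2, plus 2T (a(U, U') + (V, V')), plus two terms which Young's
inequality absorbs into one half of |U'|^2 + |V'|_N^2 + a(U, U) + |V|^2
([form_density_ge]). In the density of the squared norm of the pair the cross
terms cancel, and the inequality of Poincare bounds the rest by
(C^2/c0^2 + 4T^2) (|U'|^2 + |V'|_N^2) ([norm_density_le]).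

The weight exp(-t/T) is decreasing at the rate 1/T and the functions U and V
vanish at the initial time; integrating by parts in time, the weighted integral of
2T (a(U, U') + (V, V')) is therefore at least that of a(U, U) + |V|^2
([energy_inequality]). So the bilinear form is at least half the squared norm of
(U, V), while the norm of the test pair is at most sqrt(C^2/c0^2 + 4T^2) times the
part of the norm of (U, V) that involves the time derivatives. This is the estimate,
with a strict inequality because the other part of the norm is positive.

The strictness is used for measurability. The function chi above is a strongly
measurable function of time with values in L^2, and has to be replaced by a jointly
measurable function of space and time. Simple functions of time are jointly
measurable, they approximate chi in a dominated way ([dominated_simple]), and the two
sides of the estimate converge along them ([eventually_inf_sup]).

Three facts about the spaces carry these steps. The potential exists by minimisation
of the energy ([riesz_representation]), as H^1_0 is complete ([H10_complete]). The
test functions are dense in L^2 ([fundamental_lemma]), so that a function of L^2 with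
zero dual norm is zero. Weak derivatives in time obey a fundamental theorem of
calculus ([weak_ftc_interior]) after pairing with a fixed vector; the energy
inequality follows from it by convexity of the energy, on intervals so short that the
paired vector is almost constant. *)

(** * Positive semidefinite forms *)

Section forms.
Variables (R : realType) (E : lmodType R).
Implicit Types (S : set E) (b : E -> E -> R).

Definition subspace S := S 0 /\ forall a u v, S u -> S v -> S (a *: u + v).

(** Functions represent classes modulo null sets, so an inner product is only
semidefinite on the set [S] of the functions that represent a space. *)
Record psd_form S b : Prop := PsdForm {
  psd_linear : forall a u v w, S u -> S v -> S w ->
    b (a *: u + v) w = a * b u w + b v w ;
  psd_sym : forall u v, S u -> S v -> b u v = b v u ;
  psd_ge0 : forall u, S u -> 0 <= b u u }.

Variables (S : set E) (b : E -> E -> R).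
Hypotheses (hS : subspace S) (hb : psd_form S b).

Lemma subspace0 : S 0. Proof. exact: hS.1. Qed.

Lemma subspaceZ a u : S u -> S (a *: u).
Proof. by move=> Su; rewrite -[_ *: _]addr0; apply: hS.2 => //; exact: hS.1. Qed.

Lemma subspaceD u v : S u -> S v -> S (u + v).
Proof. by move=> Su Sv; rewrite -[u]scale1r; exact: hS.2. Qed.

Lemma subspaceB u v : S u -> S v -> S (u - v).
Proof. by move=> Su Sv; rewrite addrC -scaleN1r; exact: hS.2. Qed.

Lemma subspace_sum (I : finType) (f : I -> E) :
  (forall i, S (f i)) -> S (\sum_i f i).
Proof.
move=> Sf; elim/big_ind: _ => //; first exact: subspace0.
exact: subspaceD.
Qed.

Lemma psdDl u v w : S u -> S v -> S w -> b (u + v) w = b u w + b v w.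
Proof. by move=> *; rewrite -[u]scale1r (psd_linear hb)// mul1r scale1r. Qed.

Lemma psd0l w : S w -> b 0 w = 0.
Proof.
move=> Sw; have S0 := subspace0.
by have := psdDl S0 S0 Sw; rewrite addr0 => /eqP; rewrite -subr_eq subrr => /eqP.
Qed.

Lemma psdZl a u w : S u -> S w -> b (a *: u) w = a * b u w.
Proof.
move=> Su Sw; have S0 := subspace0.
by rewrite -[a *: u]addr0 (psd_linear hb)// psd0l// addr0.
Qed.

Lemma psdBl u v w : S u -> S v -> S w -> b (u - v) w = b u w - b v w.
Proof.
by move=> *; rewrite addrC -scaleN1r (psd_linear hb)// mulN1r addrC.
Qed.

Lemma psdDr u v w : S u -> S v -> S w -> b w (u + v) = b w u + b w v.
Proof.
move=> Su Sv Sw; have Suv := subspaceD Su Sv.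
by rewrite (psd_sym hb Sw Suv) psdDl// !(psd_sym hb _ Sw).
Qed.

Lemma psdBr u v w : S u -> S v -> S w -> b w (u - v) = b w u - b w v.
Proof.
move=> Su Sv Sw; have Suv := subspaceB Su Sv.
by rewrite (psd_sym hb Sw Suv) psdBl// !(psd_sym hb _ Sw).
Qed.

Lemma psdZr a u w : S u -> S w -> b w (a *: u) = a * b w u.
Proof.
move=> Su Sw; have Sau := subspaceZ a Su.
by rewrite (psd_sym hb Sw Sau) psdZl// (psd_sym hb Sw Su).
Qed.

Lemma psd_suml (I : finType) (f : I -> E) w : (forall i, S (f i)) -> S w ->
  b (\sum_i f i) w = \sum_i b (f i) w.
Proof.
move=> Sf Sw.
suff : forall r : seq I, S (\sum_(i <- r) f i) /\
    b (\sum_(i <- r) f i) w = \sum_(i <- r) b (f i) w.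
  by move=> /(_ (index_enum I))[].
elim=> [|i r [IH1 IH2]]; first by rewrite !big_nil psd0l//; split=> //; exact: subspace0.
by rewrite !big_cons psdDl// IH2; split=> //; exact: subspaceD.
Qed.

Lemma psd_sumr (I : finType) (f : I -> E) w : (forall i, S (f i)) -> S w ->
  b w (\sum_i f i) = \sum_i b w (f i).
Proof.
move=> Sf Sw; rewrite (psd_sym hb)//; last exact: subspace_sum.
by rewrite psd_suml//; apply: eq_bigr => i _; rewrite (psd_sym hb).
Qed.

(** The polynomial [a |-> b (a *: u + v) (a *: u + v)] is nonnegative. *)
Lemma psd_cauchy_schwarz u v : S u -> S v -> b u v ^+ 2 <= b u u * b v v.
Proof.
move=> Su Sv.
have key a : 0 <= a ^+ 2 * b u u + a * 2 * b u v + b v v.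
  have Sau := subspaceZ a Su.
  have := psd_ge0 hb (subspaceD Sau Sv).
  rewrite psdDl ?psdDr ?psdZl ?psdZr//; last exact: subspaceD.
  by rewrite (psd_sym hb Sv Su) => h; apply: (le_trans h); rewrite le_eqVlt; apply/orP; left; apply/eqP; ring.
have u0 := psd_ge0 hb Su; have v0 := psd_ge0 hb Sv.
have [u00|unz] := eqVneq (b u u) 0.
  rewrite u00 mul0r.
  have [->|bnz] := eqVneq (b u v) 0; first by rewrite expr0n.
  have := key (- (b v v + 1) / (2 * b u v)).
  rewrite u00 mulr0 add0r.
  have -> : - (b v v + 1) / (2 * b u v) * 2 * b u v = - (b v v + 1) by field.
  by lra.
have up : 0 < b u u by rewrite lt_neqAle eq_sym unz.
have := key (- (b u v) / b u u).
have -> : (- (b u v) / b u u) ^+ 2 * b u u + - (b u v) / b u u * 2 * b u v + b v v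
   = (b u u * b v v - b u v ^+ 2) / b u u by field.
by rewrite pmulr_lge0 ?invr_gt0// subr_ge0.
Qed.

Lemma psd_cauchy_schwarz_sqrt u v : S u -> S v ->
  `|b u v| <= Num.sqrt (b u u) * Num.sqrt (b v v).
Proof.
move=> Su Sv; rewrite -sqrtrM ?(psd_ge0 hb)//.
by rewrite -sqrtr_sqr ler_wsqrtr// psd_cauchy_schwarz.
Qed.

Lemma psd_null u v : S u -> S v -> b u u = 0 -> b u v = 0.
Proof.
move=> Su Sv u0; have := psd_cauchy_schwarz Su Sv; rewrite u0 mul0r => h.
by apply/eqP; rewrite -sqrf_eq0 eq_le h sqr_ge0.
Qed.

Lemma psd_triangle u v : S u -> S v ->
  Num.sqrt (b (u + v) (u + v)) <= Num.sqrt (b u u) + Num.sqrt (b v v).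
Proof.
move=> Su Sv; have Suv := subspaceD Su Sv.
rewrite -[leRHS]ger0_norm ?addr_ge0 ?sqrtr_ge0// -sqrtr_sqr ler_wsqrtr//.
rewrite psdDl ?psdDr// (psd_sym hb Sv Su) sqrrD !sqr_sqrtr ?(psd_ge0 hb)//.
by have := psd_cauchy_schwarz_sqrt Su Sv; have := ler_norm (b u v); lra.
Qed.

End forms.

Section psd_constructions.
Variables (R : realType) (E : lmodType R) (S S' : set E) (b b' : E -> E -> R).

Lemma psd_form_sub : S `<=` S' -> psd_form S' b -> psd_form S b.
Proof.
move=> SS [l s p]; split.
- by move=> a u v w /SS Su /SS Sv /SS Sw; exact: l.
- by move=> u v /SS Su /SS Sv; exact: s.
- by move=> u /SS Su; exact: p.
Qed.

Lemma psd_form_add : psd_form S b -> psd_form S b' ->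
  psd_form S (fun u v => b u v + b' u v).
Proof.
move=> [l s p] [l' s' p']; split.
- by move=> a u v w Su Sv Sw; rewrite l// l'// mulrDr addrACA.
- by move=> u v Su Sv; rewrite s// s'.
- by move=> u Su; rewrite addr_ge0 ?p ?p'.
Qed.

End psd_constructions.

(** * Real-valued integrals and square-integrable functions *)

Section almost_everywhere_tools.
Context d (X : measurableType d) (R : realType) (mu : {measure set X -> \bar R}).

Lemma ae_imply (P Q : X -> Prop) : (forall x, P x -> Q x) ->
  {ae mu, forall x, P x} -> {ae mu, forall x, Q x}.
Proof. by move=> PQ; apply: filterS. Qed.

End almost_everywhere_tools.

Section real_integrals.
Context d (X : measurableType d) (R : realType).
Variables (mu : {measure set X -> \bar R}) (D : set X).
Hypothesis mD : measurable D.
Implicit Types f g : X -> R.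

(** A real-valued integral is the image under [fine] of an extended real one,
and says something about [f] only if [f] is integrable. *)
Definition rint f := mu.-integrable D (EFin \o f).

Lemma rint_measurable f : rint f -> measurable_fun D f.
Proof. by move=> /integrableP[/measurable_EFinP]. Qed.

Lemma rintD f g : rint f -> rint g -> rint (fun x => f x + g x).
Proof.
move=> fi gi; rewrite /rint.
by rewrite (_ : _ \o _ = (EFin \o f) \+ (EFin \o g))%E//; exact: integrableD.
Qed.

Lemma rintZ k f : rint f -> rint (fun x => k * f x).
Proof.
move=> fi; rewrite /rint.
rewrite (_ : _ \o _ = (fun x => k%:E * (EFin \o f) x))%E//.
exact: integrableZl.
Qed.

Lemma rintB f g : rint f -> rint g -> rint (fun x => f x - g x).
Proof.
move=> fi gi; rewrite /rint.
by rewrite (_ : _ \o _ = (EFin \o f) \- (EFin \o g))%E//; exact: integrableB.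
Qed.

Lemma rint_le f g : measurable_fun D f -> rint g ->
  (forall x, D x -> `|f x| <= g x) -> rint f.
Proof.
move=> mf gi fg; apply: le_integrable gi => //; first exact/measurable_EFinP.
by move=> x Dx; rewrite /= lee_fin (le_trans (fg x Dx))// ler_norm.
Qed.

Lemma rint_sum (I : finType) (f : I -> X -> R) :
  (forall i, rint (f i)) -> rint (fun x => \sum_i f i x).
Proof.
move=> fi; rewrite /rint.
rewrite (_ : _ \o _ = (fun x => \sum_i (EFin \o f i) x)%E).
  by apply: integrable_sum => // i _; exact: fi.
by apply/funext => x; rewrite /= -sumEFin.
Qed.

Lemma rint_ext f g : (forall x, D x -> f x = g x) -> rint f -> rint g.
Proof.
move=> fg; apply: eq_integrable => // x /set_mem Dx.
by rewrite /= fg.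
Qed.

Lemma EFin_Rintegral f : rint f ->
  (\int[mu]_(x in D) f x)%:E = (\int[mu]_(x in D) (f x)%:E)%E.
Proof. by move=> fi; rewrite fineK//; exact: integrable_fin_num. Qed.

Lemma rint_lty f : measurable_fun D f -> (forall x, D x -> 0 <= f x) ->
  (\int[mu]_(x in D) (f x)%:E < +oo)%E -> rint f.
Proof.
move=> mf f0 foo; apply/integrableP; split; first exact/measurable_EFinP.
rewrite (le_lt_trans _ foo)// le_eqVlt; apply/orP; left; apply/eqP.
by apply: eq_integral => x /set_mem Dx; rewrite /= ger0_norm// f0.
Qed.

Lemma rint_dominated_cvg (f_ : nat -> X -> R) f g :
  (forall n, measurable_fun D (f_ n)) ->
  (forall x, D x -> f_ n x @[n --> \oo] --> f x) ->
  rint g -> (forall n x, D x -> `|f_ n x| <= g x) ->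
  rint f /\ \int[mu]_(x in D) f_ n x @[n --> \oo] --> \int[mu]_(x in D) f x.
Proof.
move=> mf ff gi fg.
have mf' : measurable_fun D f by exact: (measurable_fun_cvg mf ff).
have [||||fi _ cv] := @dominated_convergence _ _ _ mu D mD
  (fun n => EFin \o f_ n) (EFin \o f) (EFin \o g) _ _ _ gi.
- by move=> n; exact/measurable_EFinP.
- exact/measurable_EFinP.
- by apply: aeW => x Dx; apply: cvg_EFin; [exact: nearW|exact: ff].
- by apply: aeW => x n Dx; rewrite /= lee_fin fg.
split => //; apply: fine_cvg; rewrite EFin_Rintegral//.
Qed.

Lemma Rintegral_sum (I : finType) (f : I -> X -> R) : (forall i, rint (f i)) ->
  \int[mu]_(x in D) (\sum_i f i x) = \sum_i \int[mu]_(x in D) f i x.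
Proof.
move=> fi; apply: EFin_inj; rewrite EFin_Rintegral; last exact: rint_sum.
rewrite -sumEFin (eq_bigr (fun i => \int[mu]_(x in D) (f i x)%:E)%E); last first.
  by move=> i _; rewrite EFin_Rintegral.
rewrite -integral_sum//; apply: eq_integral => x _.
by rewrite sumEFin.
Qed.

Lemma Rintegral_eq0 f : rint f -> (forall x, D x -> 0 <= f x) ->
  \int[mu]_(x in D) f x = 0 -> {ae mu, forall x, D x -> f x = 0}.
Proof.
move=> fi f0 f00.
have : (\int[mu]_(x in D) `|(f x)%:E| = 0)%E.
  rewrite -[RHS](_ : (\int[mu]_(x in D) f x)%:E = _); last by rewrite f00.
  rewrite EFin_Rintegral//; apply: eq_integral => x /set_mem Dx.
  by rewrite /= ger0_norm// f0.
have mf := rint_measurable fi.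
move=> /(ae_eq_integral_abs _ mD).
have /measurable_EFinP mf' := mf.
move=> /(_ mf') h.
by apply: filterS h => x /= h Dx; have [] := h Dx.
Qed.

Lemma ae_eq_Rintegral f g : measurable_fun D f -> measurable_fun D g ->
  {ae mu, forall x, D x -> f x = g x} ->
  \int[mu]_(x in D) f x = \int[mu]_(x in D) g x.
Proof.
move=> mf mg fg; congr fine; apply: ae_eq_integral => //; try exact/measurable_EFinP.
by apply: filterS fg => x h Dx; rewrite h.
Qed.

Lemma ae_rint f g : measurable_fun D f -> measurable_fun D g ->
  {ae mu, forall x, D x -> f x = g x} -> rint f -> rint g.
Proof.
move=> mf mg fg /integrableP[_ fi]; apply/integrableP; split.
  exact/measurable_EFinP.
rewrite (le_lt_trans _ fi)// le_eqVlt; apply/orP; left; apply/eqP.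
apply: ae_eq_integral => //; try by apply: measurableT_comp => //; exact/measurable_EFinP.
by apply: filterS fg => x h Dx; rewrite /= h.
Qed.

(** Replacing [g] by the maximum of [f] and [g] changes it on a null set and
makes the inequality hold everywhere. *)
Lemma ae_le_Rintegral f g : rint f -> rint g ->
  {ae mu, forall x, D x -> f x <= g x} ->
  \int[mu]_(x in D) f x <= \int[mu]_(x in D) g x.
Proof.
move=> fi gi fg; have mf := rint_measurable fi; have mg := rint_measurable gi.
rewrite (@ae_eq_Rintegral g (fun x => Num.max (f x) (g x)))//; last 2 first.
  exact: measurable_maxr.
  by apply: filterS fg => x h Dx; rewrite max_r// h.
apply: le_Rintegral => //; last by move=> x Dx; rewrite le_max lexx.
apply: ae_rint gi => //; first exact: measurable_maxr.
by apply: filterS fg => x h Dx; rewrite max_r// h.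
Qed.

End real_integrals.

Section square_integrable.
Context d (X : measurableType d) (R : realType).
Variables (mu : {measure set X -> \bar R}) (D : set X).
Hypothesis mD : measurable D.
Implicit Types f g : X -> R.

Lemma L2P f : L2 mu D f <->
  measurable_fun D f /\ rint mu D (fun x => f x ^+ 2).
Proof.
rewrite /L2 /=; split.
- move=> h; have := Lfun2_integrable_sqr h.
  move: h; rewrite inE => /andP[/[!inE]/= mf _] fi.
  have mf' : measurable_fun D f by apply/(measurable_restrictT f mD).
  split => //; rewrite /rint; apply/integrable_mkcond => //.
  apply: eq_integrable fi => // x _ /=.
  by rewrite !patchE; case: ifPn => //; rewrite expr0n.
- move=> [mf fi]; rewrite inE; apply/andP; split; rewrite inE/=.
    exact/(measurable_restrictT f mD).
  move/integrable_mkcond : fi => /(_ mD) /integrableP[_ foo].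
  rewrite /finite_norm unlock /Lnorm poweR_lty//.
  apply: le_lt_trans foo; rewrite le_eqVlt; apply/orP; left; apply/eqP.
  apply: eq_integral => x _; rewrite /= !patchE.
  case: ifPn => _ /=; rewrite powR_mulrn ?normr_ge0// ?real_normK ?num_real//=.
    by rewrite ger0_norm ?sqr_ge0.
  by rewrite expr0n normr0.
Qed.

Lemma L2_measurable f : L2 mu D f -> measurable_fun D f.
Proof. by move=> /L2P[]. Qed.

Lemma L2_rint_sqr f : L2 mu D f -> rint mu D (fun x => f x ^+ 2).
Proof. by move=> /L2P[]. Qed.

Lemma L2_rint_mul f g : L2 mu D f -> L2 mu D g -> rint mu D (fun x => f x * g x).
Proof.
move=> /L2P[mf fi] /L2P[mg gi].
apply: (rint_le mD (g := fun x => f x ^+ 2 + g x ^+ 2)).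
- exact: measurable_funM.
- exact: rintD.
- move=> x Dx; rewrite ler_norml.
  have p := sqr_ge0 (f x + g x); have m := sqr_ge0 (f x - g x).
  have pf := sqr_ge0 (f x); have pg := sqr_ge0 (g x).
  by apply/andP; split; nra.
Qed.

Lemma L2_subspace : subspace (L2 mu D).
Proof.
have two : (1 <= 2%:E :> \bar R)%E by rewrite lee_fin; lra.
split; rewrite /L2 /=.
  rewrite (_ : _ \_ _ = 0); last by apply/funext => x; rewrite patchE; case: ifP.
  by have [] := Lfun_submod_closed mu two.
move=> a u v Lu Lv; rewrite (_ : _ \_ _ = a *: (u \_ D) + (v \_ D)).
  by have [_ /(_ a _ _ Lu Lv)] := Lfun_submod_closed mu two.
apply/funext => x; rewrite /= !patchE /= !fctE !patchE; case: ifP => // _.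
by rewrite scaler0 addr0.
Qed.

Lemma L2_form : psd_form (L2 mu D) (fun f g => \int[mu]_(x in D) (f x * g x)).
Proof.
split.
- move=> a u v w Lu Lv Lw; rewrite -RintegralZl//; last exact: L2_rint_mul.
  rewrite -RintegralD//; last 2 first.
    by apply: rintZ => //; exact: L2_rint_mul.
    exact: L2_rint_mul.
  by apply: eq_Rintegral => x _; rewrite /= !fctE mulrDl mulrA.
- by move=> u v _ _; apply: eq_Rintegral => x _; rewrite mulrC.
- by move=> u _; apply: Rintegral_ge0 => x _; exact: sqr_ge0.
Qed.

End square_integrable.

(** * Completeness of L^2 *)

Section riesz_fischer.
Context d (X : measurableType d) (R : realType).
Variables (mu : {measure set X -> \bar R}) (D : set X).
Hypothesis mD : measurable D.

Let norm2 (f : X -> R) := \int[mu]_(x in D) (f x * f x).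

(** The increments are dominated by a geometric sequence of ratio 1/2. *)
Lemma square_geometric_cvg (h : nat -> R) (M : R) :
  (forall k, 4 ^+ k * (h k.+1 - h k) ^+ 2 <= M) -> cvgn h.
Proof.
move=> hM.
have M0 : 0 <= M by apply: le_trans (hM 0%N); rewrite mulr_ge0// sqr_ge0.
have step k : `|h k.+1 - h k| <= geometric (Num.sqrt M) 2^-1 k.
  have p2 : 0 < (2 : R) ^+ k by exact: exprn_gt0.
  rewrite /= exprVn ler_pdivlMr// -sqrtr_sqr mulrC.
  rewrite -[X in X * _](ger0_norm (ltW p2)) -sqrtr_sqr -sqrtrM ?sqr_ge0//.
  rewrite ler_wsqrtr//; apply: le_trans (hM k).
  by rewrite -exprM mulnC exprM (_ : 2 ^+ 2 = 4)//; ring.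
have cs : cvgn (series (fun k => h k.+1 - h k)).
  apply: normed_cvg; apply: series_le_cvg step _ => //.
    by move=> k; rewrite mulr_ge0 ?sqrtr_ge0// exprn_ge0// invr_ge0.
  by apply: is_cvg_geometric_series; rewrite ger0_norm ?invr_ge0//; lra.
have -> : h = (fun n => series (fun k => h k.+1 - h k) n + h 0%N).
  apply/funext => n; have := telescopeK h.
  rewrite /telescope => /(congr1 (fun F : nat -> R => F n)).
  by rewrite /= => ->; rewrite subrK.
by apply: is_cvgD => //; exact: is_cvg_cst.
Qed.

(** A subsequence whose increments have squared norm at most [8^-k] converges
almost everywhere, because the sum of the squared increments weighted by [4^k]
has a finite integral. By Fatou's lemma its limit is also the limit in norm, of
the whole sequence. *)
Lemma riesz_fischer (f_ : nat -> X -> R) :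
  (forall n, L2 mu D (f_ n)) ->
  (forall e, 0 < e -> exists N, forall n m, (N <= n)%N -> (N <= m)%N ->
     norm2 (f_ n - f_ m) <= e) ->
  exists f, L2 mu D f /\ forall e, 0 < e -> exists N, forall n, (N <= n)%N ->
     norm2 (f_ n - f) <= e.
Proof.
move=> Lf cf.
have sub := L2_subspace mu D.
have LB n m : L2 mu D (f_ n - f_ m) by exact: subspaceB.
have /choice[N hN] : forall k, exists N, forall n m, (N <= n)%N -> (N <= m)%N ->
    norm2 (f_ n - f_ m) <= 8^-1 ^+ k.
  by move=> k; apply: cf; rewrite exprn_gt0// invr_gt0.
(* Adding up the thresholds makes the indices increase. *)
pose p k := (k + \sum_(i < k.+1) N i)%N.
have pN k : (N k <= p k)%N.
  by rewrite /p big_ord_recr/= addnA leq_addl.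
have pS k : (p k <= p k.+1)%N.
  by rewrite /p [X in (_ <= _ + X)%N]big_ord_recr/= leq_add// leq_addr.
have pk k : (k <= p k)%N by rewrite leq_addr.
pose h k := f_ (p k).
pose g k x : R := 4 ^+ k * (h k.+1 x - h k x) ^+ 2.
have Lh k : L2 mu D (h k.+1 - h k) by exact: LB.
have gi k : rint mu D (g k) by apply: rintZ => //; exact: (L2_rint_sqr mD (Lh k)).
have g0 k x : 0 <= g k x by rewrite mulr_ge0// ?sqr_ge0.
have mg k : measurable_fun D (EFin \o g k).
  by apply/measurable_EFinP; exact: rint_measurable (gi k).
pose S x := (\sum_(k <oo) (g k x)%:E)%E.
have S0 x : (0 <= S x)%E by apply: nneseries_ge0 => k _ _; rewrite lee_fin.
have intS : (\int[mu]_(x in D) S x < +oo)%E.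
  rewrite integral_nneseries//; last by move=> k x _; rewrite lee_fin.
  apply: (@le_lt_trans _ _ (\sum_(k <oo) (geometric 1 2^-1 k)%:E)%E).
    apply: lee_nneseries => [k _ _|k _].
      by apply: integral_ge0 => x _; rewrite lee_fin.
    rewrite -EFin_Rintegral// lee_fin RintegralZl//; last exact: (L2_rint_sqr mD (Lh k)).
    have := hN k (p k.+1) (p k) (leq_trans (pN k) (pS k)) (pN k).
    rewrite /norm2 => h1.
    apply: (@le_trans _ _ (4 ^+ k * 8^-1 ^+ k)).
      by rewrite ler_wpM2l// exprn_ge0.
    rewrite -exprMn /= mul1r (_ : 4 / 8 = 2^-1)//.
    by field.
  have := @cvg_geometric_series R 1 2^-1.
  rewrite ger0_norm ?invr_ge0// => /(_ _)/wrap[]; first by lra.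
  move=> cg; rewrite (_ : limn _ = ((1 * (1 - 2^-1)^-1)%:E : \bar R)) ?ltry//.
  apply/cvg_lim => //; have -> : (fun n => \sum_(0 <= k < n) (geometric 1 2^-1 k)%:E)%E =
      EFin \o series (geometric (1 : R) 2^-1).
    by apply/funext => n /=; rewrite sumEFin.
  by apply: cvg_EFin => //; exact: nearW.
have mS : measurable_fun D S.
  have g0' k x : D x -> xpredT k -> (0 <= (g k x)%:E)%E by rewrite lee_fin.
  exact: (ge0_emeasurable_sum g0' (fun k _ => mg k)).
pose G := D `&` [set x | S x < +oo]%E.
have mG : measurable G.
  rewrite /G [X in measurable (_ `&` X)](_ : _ = S @^-1` [set` `]-oo, (+oo%E)[]).
    by apply: mS => //; exact: emeasurable_itv.
  by apply/seteqP; split=> x /=; rewrite in_itv.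
have aeG : {ae mu, forall x, D x -> G x}.
  have Si : mu.-integrable D S.
    apply/integrableP; split => //; apply: le_lt_trans intS.
    by rewrite le_eqVlt; apply/orP; left; apply/eqP; apply: eq_integral => x _; rewrite gee0_abs.
  have := integrable_ae mD Si; apply: filterS => x /= Hx Dx; split => //=.
  by rewrite ltey_eq (Hx Dx).
have cvG x : G x -> cvgn (fun k => h k x).
  move=> [Dx Sx]; apply: (@square_geometric_cvg _ (fine (S x))) => k.
  rewrite -lee_fin fineK; last by rewrite ge0_fin_numE.
  apply: le_trans (nneseries_lim_ge k.+1 _); last by move=> i _ _; rewrite lee_fin.
  rewrite big_mkord sumEFin lee_fin big_ord_recr/= ler_wpDl//.
  by apply: sumr_ge0.
(* Set to zero off [G], a set of full measure, the subsequence converges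
everywhere and its limit is measurable. *)
pose h' k x : R := \1_G x * h k x.
pose f x := lim (h'^~ x @ \oo).
have cvf x : D x -> h' k x @[k --> \oo] --> f x.
  move=> Dx; rewrite /f; have [/set_mem Gx|nG] := boolP (x \in G).
    have -> : h' ^~ x = fun k => h k x.
      by apply/funext => k; rewrite /h' indicE mem_set// mul1r.
    exact: cvG.
  have -> : h' ^~ x = fun k => 0.
    by apply/funext => k; rewrite /h' indicE (negbTE nG) mul0r.
  exact: is_cvg_cst.
have mh n : measurable_fun D (f_ n) by exact: L2_measurable.
have mh' k : measurable_fun D (h' k).
  by apply: measurable_funM; [exact: measurable_indic|exact: mh].
have mf : measurable_fun D f by exact: (measurable_fun_cvg mh').
have bound e m N0 : (forall n, (N0 <= n)%N -> norm2 (f_ m - f_ n) <= e) ->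
    (\int[mu]_(x in D) ((f_ m x - f x) ^+ 2)%:E <= e%:E)%E.
  move=> hm.
  pose F k x : \bar R := ((f_ m x - h' (k + N0)%N x) ^+ 2)%:E.
  have mF k : measurable_fun D (F k).
    by apply/measurable_EFinP; apply: measurable_funX; exact: measurable_funB.
  have F0 k x : D x -> (0 <= F k x)%E by move=> _; rewrite lee_fin sqr_ge0.
  have /(le_trans _) := fatou mu mD mF F0.
  move=> /(_ (\int[mu]_(x in D) ((f_ m x - f x) ^+ 2)%:E)%E).
  have -> : (\int[mu]_(x in D) limn_einf (F ^~ x) =
      \int[mu]_(x in D) ((f_ m x - f x) ^+ 2)%:E)%E.
    apply: eq_integral => x /set_mem Dx.
    have cF : F k x @[k --> \oo] --> ((f_ m x - f x) ^+ 2)%:E.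
      apply: cvg_EFin; first exact: nearW.
      have c1 : f_ m x - h' (k + N0)%N x @[k --> \oo] --> f_ m x - f x.
        apply: cvgB; first exact: cvg_cst.
        by have := cvf x Dx; rewrite -(cvg_shiftn N0).
      rewrite expr2 (_ : fine \o _ = fun k => (f_ m x - h' (k + N0)%N x) * (f_ m x - h' (k + N0)%N x)).
        exact: cvgM.
      by apply/funext => k; rewrite /= expr2.
    by have [-> _] := cvg_limn_einf_sup cF.
  move=> /(_ (lexx _)) /le_trans; apply.
  rewrite limn_einf_lim; apply: lime_le; first exact: is_cvg_einfs.
  apply: nearW => k; apply: (@le_trans _ _ (\int[mu]_(x in D) F k x)%E).
    by apply: ereal_inf_lbound; exists k => /=.
  rewrite (@ae_eq_integral _ _ _ mu D (fun x => ((f_ m x - f_ (p (k + N0)%N) x) ^+ 2)%:E)%E)//.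
  - rewrite -EFin_Rintegral ?lee_fin; last exact: (L2_rint_sqr mD (LB m (p (k + N0)%N))).
    apply: le_trans (hm (p (k + N0)%N) _); last by rewrite (leq_trans _ (pk _))// leq_addl.
    by rewrite le_eqVlt; apply/orP; left; apply/eqP; apply: eq_Rintegral => x _; rewrite expr2.
  - exact: mD.
  - by apply/measurable_EFinP; apply: measurable_funX; exact: measurable_funB.
  - apply: filterS aeG => x /= Gx Dx; rewrite /F /h' indicE mem_set ?mul1r//.
    exact: Gx.
have Lfm m : (exists e N0, forall n, (N0 <= n)%N -> norm2 (f_ m - f_ n) <= e) -> L2 mu D (f_ m - f).
  move=> [e [N0 hm]]; apply/L2P => //; split; first exact: measurable_funB.
  apply: rint_lty => //; first by apply: measurable_funX; exact: measurable_funB.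
    by move=> x _; exact: sqr_ge0.
  by apply: le_lt_trans (bound _ _ _ hm) _; rewrite ltry.
exists f; split.
  have [N0 hN0] := cf 1 ltr01.
  have -> : f = f_ N0 - (f_ N0 - f) by rewrite opprB addrC subrK.
  apply: subspaceB => //; apply: Lfm; exists 1, N0 => n Nn; exact: hN0.
move=> e e0; have [N0 hN0] := cf e e0; exists N0 => n Nn.
have hm : forall k, (N0 <= k)%N -> norm2 (f_ n - f_ k) <= e by move=> k Nk; exact: hN0.
rewrite -lee_fin; apply: le_trans (bound _ _ _ hm).
have Ln : L2 mu D (f_ n - f) by apply: Lfm; exists e, N0.
rewrite /norm2 EFin_Rintegral; last exact: L2_rint_mul.
  by under eq_integral do rewrite -expr2.
by [].
Qed.

End riesz_fischer.

(** * Smooth functions *)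

Section smooth_functions.
Variables (R : realType) (V : normedModType R).
Implicit Types (f g : V -> R) (k : nat).

Lemma Ck_continuous k f : Ck k f -> continuous f.
Proof. by case: k => //= k []. Qed.

Lemma CkS k f : Ck k.+1 f -> Ck k f.
Proof.
elim: k f => [|k IH] f /=; first by case.
by move=> [cf Df]; split=> // v; have [df /= ?] := Df v; split => //; exact: IH.
Qed.

Lemma Ck_cst k (a : R) : Ck k (fun _ : V => a).
Proof.
elim: k a => [|k IH] a /=; first exact: cst_continuous.
split; first exact: cst_continuous.
move=> v; split => [x|]; first exact: derivable_cst.
rewrite (_ : 'D_v _ = fun _ : V => 0); first exact: IH.
by apply/funext => x; exact: derive_cst.
Qed.

Lemma CkD k f g : Ck k f -> Ck k g -> Ck k (fun x => f x + g x).
Proof.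
elim: k f g => [|k IH] f g /=.
  by move=> cf cg x; apply: cvgD; [exact: cf|exact: cg].
move=> [cf Df] [cg Dg]; split; first by move=> x; apply: cvgD; [exact: cf|exact: cg].
move=> v; have [df Cf] := Df v; have [dg Cg] := Dg v; split=> [x|].
  exact: derivableD.
rewrite (_ : 'D_v _ = fun x => 'D_v f x + 'D_v g x); first exact: IH.
by apply/funext => x; exact: deriveD.
Qed.

Lemma CkM k f g : Ck k f -> Ck k g -> Ck k (fun x => f x * g x).
Proof.
elim: k f g => [|k IH] f g /=.
  by move=> cf cg x; apply: cvgM; [exact: cf|exact: cg].
move=> [cf Df] [cg Dg]; split; first by move=> x; apply: cvgM; [exact: cf|exact: cg].
move=> v; have [df Cf] := Df v; have [dg Cg] := Dg v; split=> [x|].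
  exact: derivableM.
rewrite (_ : 'D_v _ = fun x => f x * 'D_v g x + g x * 'D_v f x).
  apply: CkD; apply: IH => //; apply: CkS; split=> //.
by apply/funext => x; exact: deriveM.
Qed.

Lemma CkZ k a f : Ck k f -> Ck k (fun x => a * f x).
Proof. by move=> Cf; apply: CkM => //; exact: Ck_cst. Qed.

Lemma Ck_prod k (I : finType) (F : I -> V -> R) :
  (forall i, Ck k (F i)) -> Ck k (fun x => \prod_i F i x).
Proof.
move=> CF; suff : forall r : seq I, Ck k (fun x => \prod_(i <- r) F i x) by exact.
elim=> [|i r IH].
  rewrite (_ : (fun x => _) = fun=> 1); first exact: Ck_cst.
  by apply/funext => x; rewrite big_nil.
rewrite (_ : (fun x => _) = fun x => F i x * \prod_(j <- r) F j x); first exact: CkM.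
by apply/funext => x; rewrite big_cons.
Qed.

(** Only the affine structure of [l] enters the difference quotients, so the
directional derivatives of [f \o l] are those of [f]. *)
Lemma Ck_comp_affine (W : normedModType R) k (l : V -> W) (L : V -> W) (f : W -> R) :
  continuous l -> (forall h v x, l (h *: v + x) = h *: L v + l x) ->
  Ck k f -> Ck k (f \o l).
Proof.
move=> cl ll; elim: k f => [|k IH] f /=.
  by move=> cf x; apply: continuous_comp; [exact: cl|exact: cf].
move=> [cf Df]; split; first by move=> x; apply: continuous_comp; [exact: cl|exact: cf].
have quot x v : (fun h => h^-1 *: (((f \o l) \o shift x) (h *: v) - (f \o l) x)) =
    (fun h => h^-1 *: ((f \o shift (l x)) (h *: L v) - f (l x))).
  by apply/funext => h; rewrite /= /shift ll.
move=> v; have [df Cf] := Df (L v); split=> [x|].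
  by rewrite /derivable quot; exact: df.
rewrite (_ : 'D_v _ = 'D_(L v) f \o l); first exact: IH.
by apply/funext => x; rewrite /derive quot.
Qed.

End smooth_functions.

Section smooth_functions_of_one_variable.
Variable R : realType.
Implicit Types (f : R -> R).

Lemma is_derive1_continuous f f' :
  (forall x : R, is_derive x 1 f (f' x)) -> continuous f.
Proof.
move=> df x; apply: differentiable_continuous.
by apply/derivable1_diffP; case: (df x).
Qed.

Lemma Ck_primitive k f f' :
  (forall x : R, is_derive x 1 f (f' x)) -> Ck k f' -> Ck k.+1 f.
Proof.
move=> df Cf' /=; split; first exact: is_derive1_continuous df.
move=> v; have dif x : differentiable f x by apply/derivable1_diffP; case: (df x).
split=> [x|]; first exact: diff_derivable.
rewrite (_ : 'D_v f = fun x => v * f' x); first exact: CkZ.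
apply/funext => x; rewrite deriveE//.
have -> : 'd f x v = 'd f x (v *: (1 : R)) by rewrite /GRing.scale/= mulr1.
by rewrite linearZ/= -deriveE//; have [_ ->] := df x.
Qed.

(** Smoothness is proved for a function together with all its derivatives,
which is what the induction on [k] needs. *)
Lemma Ck_family (I : Type) (F : I -> R -> R) (next : I -> I) :
  (forall i (x : R), is_derive x 1 (F i) (F (next i) x)) ->
  forall k i, Ck k (F i).
Proof.
move=> dF k; elim: k => [|k IH] i; first exact: is_derive1_continuous (dF i).
exact: Ck_primitive (dF i) (IH _).
Qed.

Lemma Ck_expR k : Ck k (@expR R).
Proof.
exact: (@Ck_family unit (fun _ => expR) id (fun _ x => is_derive_expR x) k tt).
Qed.

Lemma exprn_le_expR (n : nat) : exists C : R, 0 <= C /\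
  forall y : R, 0 <= y -> y ^+ n <= C * expR y.
Proof.
exists (n`!%:R + 1); split; first by rewrite addr_ge0.
move=> y y0; case: n => [|n].
  rewrite expr0 fact0 (le_trans (_ : 1 <= expR y))//.
    by rewrite (le_trans _ (expR_ge1Dx y))// lerDl.
  by rewrite ler_peMl ?expR_ge0// lerDl.
have fp : 0 < (n.+1)`!%:R :> R by rewrite ltr0n fact_gt0.
have := expR_ge1Dxn n y0; have := expR_ge0 y.
move=> e0 h; rewrite -[y ^+ _](divfK (lt0r_neq0 fp)) mulrC ler_pM//.
- by rewrite divr_ge0// exprn_ge0.
- by rewrite lerDl.
- by apply: le_trans h; rewrite lerDr.
Qed.

Lemma horner_le_expR (p : {poly R}) : exists C : R, 0 <= C /\
  forall y, 0 <= y -> `|p.[y]| <= C * expR y.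
Proof.
have /choice[C hC] := exprn_le_expR.
exists (\sum_(i < size p) `|p`_i| * C i); split.
  by apply: sumr_ge0 => i _; rewrite mulr_ge0//; have [] := hC i.
move=> y y0; rewrite horner_coef (le_trans (ler_norm_sum _ _ _))// mulr_suml.
apply: ler_sum => i _; rewrite normrM -mulrA ler_wpM2l//.
by rewrite ger0_norm ?exprn_ge0//; have [_] := hC i; exact.
Qed.

(** The functions [p(1/x) exp(-1/x)] for [x > 0], extended by zero: they form
a family stable under differentiation that contains the classical smooth
function that is zero for [x <= 0] and positive for [x > 0]. *)
Definition expinv (p : {poly R}) (x : R) : R :=
  if 0 < x then p.[x^-1] * expR (- x^-1) else 0.

(** The derivative of [p(1/x) exp(-1/x)] is [x^-2 (p(1/x) - p'(1/x)) exp(-1/x)]. *)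
Definition expinv_next (p : {poly R}) : {poly R} := 'X^2 * (p - p^`()).

(** In the variable [y = 1/x] the exponential outgrows the polynomial [y p(y)],
so that the function is bounded by a multiple of [x]. *)
Lemma expinv_cvg0 p : {for 0, continuous (expinv p)}.
Proof.
have [C [C0 hC]] := horner_le_expR (p * 'X).
have e0 : expinv p 0 = 0 by rewrite /expinv ltxx.
suff : expinv p z @[z --> (0 : R)] --> (0 : R) by rewrite -[X in _ --> X]e0.
apply/cvgr0Pnorm_le => e ep.
near=> z; have zle : `|z| <= e / (C + 1).
  by near: z; apply: (@nbhs0_le R R); rewrite divr_gt0//; lra.
apply: (@le_trans _ _ (C * `|z|)); last first.
  rewrite (@le_trans _ _ ((C + 1) * (e / (C + 1))))//.
    by rewrite ler_pM//; lra.
  by rewrite mulrC divfK//; lra.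
rewrite /expinv; case: ifPn => z0; last by rewrite normr0 mulr_ge0.
have zi : 0 <= z^-1 by rewrite invr_ge0 ltW.
have := hC _ zi; rewrite hornerMX normrM (ger0_norm zi) => h.
rewrite normrM (ger0_norm (expR_ge0 _)) expRN (gtr0_norm z0).
rewrite ler_pdivrMr ?expR_gt0// -mulrA [z * _]mulrC mulrA.
by rewrite -ler_pdivrMr//.
Unshelve. all: by end_near. Qed.

(** At the origin the difference quotient is the member of the family for the
polynomial [X p], which is continuous there. *)
Lemma is_derive_expinv p (x : R) :
  is_derive x 1 (expinv p) (expinv (expinv_next p) x).
Proof.
have [x0|x0|->] := ltgtP x 0.
- rewrite {2}/expinv ltNge (ltW x0)/=.
  apply: (@near_eq_is_derive _ _ _ (cst 0)).
  near=> y; rewrite /expinv ltNge (_ : y <= 0)//.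
  by apply: ltW; near: y; exact: lt_nbhsl.
- rewrite {2}/expinv x0.
  apply: (@near_eq_is_derive _ _ _ (fun y : R => p.[y^-1] * expR (- y^-1))).
    near=> y; rewrite /expinv (_ : 0 < y)//.
    by near: y; exact: lt_nbhsr.
  have xn0 : x != 0 by rewrite gt_eqF.
  have dV : is_derive x 1 (fun y : R => y^-1) (- x ^- 2).
    apply: DeriveDef; first exact: derivableV.
    by rewrite deriveV// derive_id /GRing.scale/= mulr1.
  have dp : is_derive x 1 (horner p \o (fun y : R => y^-1)) (p^`().[x^-1] * - x ^- 2).
    exact: is_derive1_comp.
  have dN : is_derive x 1 (fun y : R => - y^-1) (- - x ^- 2) by exact: is_deriveN.
  have de : is_derive x 1 (expR \o (fun y : R => - y^-1)) (expR (- x^-1) * - - x ^- 2).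
    exact: is_derive1_comp.
  have h : is_derive x 1 (fun y : R => p.[y^-1] * expR (- y^-1)) _ := is_deriveM dp de.
  apply: is_derive_eq.
  rewrite /expinv_next !hornerE/= /GRing.scale/=.
  rewrite exprVn; ring.
- rewrite {2}/expinv ltxx; apply/is_derive1_caratheodory.
  exists (expinv (p * 'X)); split; last by rewrite /expinv ltxx.
    move=> z; rewrite /expinv ltxx !subr0; case: ifPn => [z0|_]; last by rewrite mul0r.
    have zn0 : z != 0 by rewrite gt_eqF.
    by rewrite hornerMX -!mulrA [expR _ * z]mulrC mulKf.
  exact: expinv_cvg0.
Unshelve. all: by end_near. Qed.

Lemma Ck_expinv k p : Ck k (expinv p).
Proof. exact: Ck_family is_derive_expinv k p. Qed.

End smooth_functions_of_one_variable.

(** * Boxes and Lebesgue measure in R^n *)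

Section boxes.
Variables (R : realType) (n : nat).
Implicit Types (a b : 'I_n -> R) (x y : 'rV[R]_n) (A : set 'rV[R]_n).

Definition box a b : set 'rV[R]_n := [set x | forall i, a i < x ord0 i < b i].

Definition cbox a b : set 'rV[R]_n := [set x | forall i, a i <= x ord0 i <= b i].

Lemma rV_ballE x e y : ball x e y <-> 0 < e /\ forall i, `|x ord0 i - y ord0 i| < e.
Proof.
split=> [[e0 h]|[e0 h]]; split=> // i; first exact: h.
by move=> j; rewrite ord1; exact: h.
Qed.

Lemma le_coord_norm x i : `|x ord0 i| <= `|x|.
Proof.
rewrite [leRHS]/Num.Def.normr/= mx_normrE.
exact: (le_bigmax _ (fun ij : 'I_1 * 'I_n => `|x ij.1 ij.2|) (ord0, i)).
Qed.

Lemma measurable_box a b : measurable (box a b).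
Proof.
rewrite (_ : box a b = \bigcap_(i in [set: 'I_n])
    ((fun x : 'rV[R]_n => x ord0 i : measurableTypeR R) @^-1` `]a i, b i[%classic)).
  apply: fin_bigcap_measurable => // i _.
  rewrite -[X in measurable X]setTI.
  exact: (measurable_coord i measurableT (measurable_itv `]a i, b i[)).
apply/seteqP; split => [x h i _|x h i]; first by rewrite /= in_itv/=; exact: h.
by have := h i I; rewrite /= in_itv.
Qed.

Lemma cbox_compact a b : compact (cbox a b).
Proof.
have -> : cbox a b = [set v : 'rV[R]_n | forall i, `[a i, b i]%classic (v ord0 i)].
  by apply/seteqP; split=> x h i; have := h i; rewrite /= in_itv.
by apply: (rV_compact (A := fun i => `[a i, b i]%classic)) => i; exact: segment_compact.
Qed.

Lemma cbox_closed a b : closed (cbox a b).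
Proof. by apply: compact_closed; [exact: norm_hausdorff|exact: cbox_compact]. Qed.

(** Boxes with rational end points form a countable family. *)
Lemma open_bigcup_box A : open A -> exists a b : nat -> 'I_n -> R,
  (forall k i, a k i < b k i) /\
  exists P : set nat, A = \bigcup_(k in P) box (a k) (b k) /\
    forall k, P k -> cbox (a k) (b k) `<=` A.
Proof.
move=> oA.
pose c k : ('rV[rat]_n * nat)%type := odflt (0, 0%N) (unpickle k).
pose a k i : R := ratr ((c k).1 ord0 i) - (c k).2.+1%:R^-1.
pose b k i : R := ratr ((c k).1 ord0 i) + (c k).2.+1%:R^-1.
exists a, b; split.
  move=> k i; rewrite /a /b ltrD2l.
  by rewrite (@lt_trans _ _ 0)// ?invr_gt0 ?oppr_lt0 ?invr_gt0.
exists [set k | cbox (a k) (b k) `<=` A]; split => //.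
apply/seteqP; split; last first.
  move=> x [k /= kA xk]; apply: kA => i; have /andP[h1 h2] := xk i.
  by rewrite !ltW.
move=> x Ax; have /nbhs_ballP[e /= e0 xeA] : nbhs x A by exact: open_nbhs_nbhs.
have [m me] : exists m : nat, (2 * m.+1%:R^-1 : R) < e.
  have [m] := ltr_add_invr (y := 0) (x := e / 2) ltac:(by rewrite divr_gt0).
  by rewrite add0r => h; exists m; rewrite mulrC -ltr_pdivlMr.
have /choice[q hq] : forall i, exists r : rat, `|ratr r - x ord0 i| < m.+1%:R^-1.
  move=> i; have [r] := rat_in_itvoo
    (x := x ord0 i - m.+1%:R^-1) (y := x ord0 i + m.+1%:R^-1) ltac:(by
      rewrite ltrD2l (@lt_trans _ _ 0)// ?invr_gt0 ?oppr_lt0 ?invr_gt0).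
  by rewrite in_itv/= => h; exists r; rewrite ltr_distl.
pose k := pickle (\row_i q i, m).
have ck : c k = (\row_i q i, m) by rewrite /c pickleK.
exists k => /=.
  move=> y hy; apply: xeA; apply/rV_ballE; split => // i.
  have := hy i; rewrite /a /b ck/= mxE => /andP[y1 y2].
  have := hq i; rewrite ltr_distl => /andP[q1 q2].
  move: (_^-1) me y1 y2 q1 q2 => s me y1 y2 q1 q2.
  by rewrite ltr_distl; apply/andP; split; lra.
move=> i; rewrite /a /b ck/= mxE.
have := hq i; rewrite ltr_distl => /andP[]; move: (_^-1) => s h1 h2.
by apply/andP; split; lra.
Qed.

Lemma open_measurable_rV A : open A -> measurable A.
Proof.
move=> /open_bigcup_box[a [b [_ [P [-> _]]]]].
by apply: bigcup_measurable => k _; exact: measurable_box.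
Qed.

Lemma closed_measurable_rV A : closed A -> measurable A.
Proof.
move=> cA; rewrite -[A]setCK; apply: measurableC.
by apply: open_measurable_rV; exact: closed_openC.
Qed.

Lemma continuous_measurable_rV (f : 'rV[R]_n -> R) :
  continuous f -> measurable_fun setT f.
Proof.
move=> /continuousP cf; apply: (measurability _ (RGenOpens.measurableE R)).
move=> _ [_ [a [b ->] <-]]; rewrite setTI.
by apply: open_measurable_rV; apply: cf; exact: interval_open.
Qed.

End boxes.

Section lebesgue_boxes.
Variable R : realType.

Lemma rV_cons0 n (x : 'rV[R]_n) t : rV_cons (x, t) ord0 ord0 = t.
Proof.
rewrite /rV_cons mxE; case: splitP => //= k _.
by rewrite mxE !ord1 eqxx mulr1n.
Qed.

Lemma rV_consS n (x : 'rV[R]_n) t i : rV_cons (x, t) ord0 (lift ord0 i) = x ord0 i.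
Proof.
rewrite /rV_cons mxE; case: splitP => /= [k | k /eqP].
  by rewrite /bump ord1.
by rewrite eqSS => /eqP ik; congr (x _ _); exact/val_inj.
Qed.

Lemma rV_cons_box n (a b : 'I_n.+1 -> R) :
  @rV_cons R n @^-1` box a b =
  box (a \o lift ord0) (b \o lift ord0) `*` `]a ord0, b ord0[%classic.
Proof.
apply/seteqP; split => -[x t].
  move=> h; split => [i|]; first by have := h (lift ord0 i); rewrite rV_consS.
  by have := h ord0; rewrite rV_cons0 /= in_itv.
move=> [/= hx ht] i; have [j ->|->] := unliftP ord0 i.
  by rewrite rV_consS; exact: hx.
by rewrite rV_cons0; move: ht; rewrite /= in_itv.
Qed.

(** By induction on the dimension: the measure is built as a product. *)
Lemma lebesgue_box_lty n (a b : 'I_n -> R) : (lebesgue_rV R n (box a b) < +oo)%E.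
Proof.
elim: n a b => [|n IH] a b.
  by rewrite /= diracE ltry.
rewrite /= /lebesgue_step /pushforward rV_cons_box product_measure1E//.
- rewrite lte_mul_pinfty//; first by rewrite ge0_fin_numE//; exact: IH.
  suff : (@lebesgue_measure R `]a ord0, b ord0[%classic < +oo)%E by [].
  by rewrite lebesgue_measure_itv/=; case: ifP => _; rewrite ?ltry.
- exact: measurable_box.
Qed.

Lemma lebesgue_bounded_lty n (A : set 'rV[R]_n) :
  measurable A -> bounded_set A -> (lebesgue_rV R n A < +oo)%E.
Proof.
move=> mA [M [_ /(_ (M + 1))]]; rewrite ltrDl ltr01 => /(_ isT) h.
apply: le_lt_trans (lebesgue_box_lty (fun _ : 'I_n => - (M + 2)) (fun=> M + 2)).
apply: le_measure; rewrite ?inE//; first exact: measurable_box.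
move=> x Ax i; have xM := h x Ax.
have : `|x ord0 i| <= M + 1.
  by apply: le_trans xM; exact: le_coord_norm.
rewrite ler_norml => /andP[h1 h2]; apply/andP; split; lra.
Qed.

Lemma lebesgue_rV_sigma_finite n : sigma_finite setT (lebesgue_rV R n).
Proof.
exists (fun k : nat => box (fun _ : 'I_n => - (k%:R)) (fun=> k%:R)).
  apply/seteqP; split => // x _.
  have [k hk] : exists k : nat, `|x| < k%:R.
    exists (Num.bound `|x|); rewrite archi_boundP//.
  exists k => // i.
  have : `|x ord0 i| < k%:R.
    apply: le_lt_trans hk; exact: le_coord_norm.
  by rewrite ltr_norml.
move=> k; split; [exact: measurable_box|exact: lebesgue_box_lty].
Qed.

End lebesgue_boxes.

(** * Integrals of partial derivatives *)

Section fubini_rV.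
Variable R : realType.

(** The measure packed with its sigma-finiteness, as the theorems of Fubini and
Tonelli require it. *)
Definition lebesgue_rV_sf n : {sigma_finite_measure set 'rV[R]_n -> \bar R} :=
  HB.pack_for {sigma_finite_measure set 'rV[R]_n -> \bar R}
    (lebesgue_rV R n : set 'rV[R]_n -> \bar R) (Measure.class (lebesgue_rV R n))
    (@isSFinite.Build _ _ _ (lebesgue_rV R n)
      (sfinite_measure_sigma_finite (@lebesgue_rV_sigma_finite R n)))
    (@isSigmaFinite.Build _ _ _ (lebesgue_rV R n) (@lebesgue_rV_sigma_finite R n)).

Lemma integral_rV_cons n (g : 'rV[R]_n.+1 -> R) :
  (lebesgue_rV R n.+1).-integrable setT (EFin \o g) ->
  (\int[lebesgue_rV R n.+1]_y (g y)%:E =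
     \int[lebesgue_rV R n]_x \int[lebesgue_measure]_t (g (rV_cons (x, t)))%:E)%E /\
  (\int[lebesgue_rV R n.+1]_y (g y)%:E =
     \int[lebesgue_measure]_t \int[lebesgue_rV R n]_x (g (rV_cons (x, t)))%:E)%E.
Proof.
move=> gi; have mg := measurable_int _ gi.
have gi' : (lebesgue_rV_sf n \x (@lebesgue_measure R))%E.-integrable setT
    (EFin \o g \o @rV_cons R n).
  apply/integrableP; split.
    by apply: measurableT_comp mg _; exact: measurable_rV_cons.
  move/integrableP : gi => [_]; apply: le_lt_trans.
  rewrite [leRHS](_ : _ = \int[pushforward (lebesgue_rV_sf n \x @lebesgue_measure R)%E (@rV_cons R n)]_y `|(EFin \o g) y|)%E//.
  rewrite ge0_integral_pushforward//; first exact: measurable_rV_cons.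
  exact: measurableT_comp.
have -> : (\int[lebesgue_rV R n.+1]_y (g y)%:E =
  \int[(lebesgue_rV_sf n \x @lebesgue_measure R)]_z (EFin \o g \o @rV_cons R n) z)%E.
  rewrite [LHS](_ : _ = \int[pushforward (lebesgue_rV_sf n \x @lebesgue_measure R)%E (@rV_cons R n)]_y ((EFin \o g) y))%E//.
  rewrite integral_pushforward//; exact: measurable_rV_cons.
split.
  by rewrite -integral12_prod_meas1.
by rewrite -integral21_prod_meas1.
Qed.

End fubini_rV.

Section integration_by_parts.
Variable R : realType.

Lemma rV_cons_affine n (u x : 'rV[R]_n) (h s t : R) :
  rV_cons (h *: u + x, h * s + t) = h *: rV_cons (u, s) + rV_cons (x, t).
Proof.
have E m (A B : 'rV[R]_m) i : (h *: A + B) ord0 i = h * A ord0 i + B ord0 i.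
  by rewrite !mxE.
apply/rowP => i; rewrite E; have [j ->|->] := unliftP ord0 i.
  by rewrite !rV_consS E.
by rewrite !rV_cons0.
Qed.

Lemma rV_cons_delta0 n : rV_cons (0 : 'rV[R]_n, 1) = delta_mx ord0 ord0.
Proof.
apply/rowP => i; have [j ->|->] := unliftP ord0 i.
  by rewrite rV_consS !mxE.
by rewrite rV_cons0 !mxE.
Qed.

Lemma rV_cons_deltaS n (j : 'I_n) :
  rV_cons (delta_mx ord0 j : 'rV[R]_n, 0) = delta_mx ord0 (lift ord0 j).
Proof.
apply/rowP => i; have [k ->|->] := unliftP ord0 i.
  by rewrite rV_consS !mxE (inj_eq lift_inj).
by rewrite rV_cons0 !mxE.
Qed.

Lemma rV_cons_continuousr n (x : 'rV[R]_n) : continuous (fun t : R => rV_cons (x, t)).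
Proof.
move=> t; apply/cvg_ballP => e e0.
near=> s; apply/rV_ballE; split => // i; have [j ->|->] := unliftP ord0 i.
  by rewrite !rV_consS subrr normr0.
by rewrite !rV_cons0; near: s; exact: cvgr_dist_lt.
Unshelve. all: by end_near. Qed.

Lemma rV_cons_continuousl n (t : R) : continuous (fun x : 'rV[R]_n => rV_cons (x, t)).
Proof.
move=> x A /nbhs_ballP[e /= e0 eA]; apply/nbhs_ballP; exists e => //= y /rV_ballE[_ h].
apply: eA; apply/rV_ballE; split => // i; have [j ->|->] := unliftP ord0 i.
  by rewrite !rV_consS.
by rewrite !rV_cons0 subrr normr0.
Qed.

Lemma rint_bounded_support n (g : 'rV[R]_n -> R) (M : R) :
  continuous g -> (forall x, g x != 0 -> forall j, `|x ord0 j| <= M) ->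
  rint (lebesgue_rV R n) setT g.
Proof.
move=> cg supp; set K := cbox (fun _ : 'I_n => - M) (fun=> M).
have mK : measurable K by apply: closed_measurable_rV; exact: cbox_closed.
have Koo : (lebesgue_rV R n K < +oo)%E.
  apply: le_lt_trans (lebesgue_box_lty (fun _ : 'I_n => - (M + 1)) (fun=> M + 1)).
  apply: le_measure; rewrite ?inE//; first exact: measurable_box.
  move=> x xK i; have /andP[h1 h2] := xK i; apply/andP; split; lra.
have gK : g = g \_ K.
  apply/funext => x; rewrite patchE; case: ifPn => // xK.
  apply/eqP; apply: contraNT xK => gx; apply/mem_set => i.
  by rewrite -ler_norml; exact: supp.
have : rint (lebesgue_rV R n) K g.
  apply: measurable_bounded_integrable => //.
    by apply: measurable_funTS; exact: continuous_measurable_rV.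
  have cgK : {within K, continuous g} by exact: continuous_subspaceT.
  have := continuous_compact cgK (@cbox_compact _ _ _ _).
  move=> /compact_bounded[N [_ hN]].
  by exists N; split; rewrite ?num_real// => ? ? ? ?; exact: hN.
rewrite /rint => /(integrable_mkcond _ mK).
rewrite [in X in _ -> X]gK; apply: eq_integrable => // x _ /=.
by rewrite !patchE; case: ifP.
Qed.

Lemma integral_derive0 (phi psi : R -> R) (M : R) :
  (forall t : R, is_derive t 1 phi (psi t)) -> continuous psi ->
  (forall t, phi t != 0 -> `|t| <= M) ->
  (forall t, psi t != 0 -> `|t| <= M) ->
  (\int[lebesgue_measure]_t (psi t)%:E = 0)%E.
Proof.
move=> dphi cpsi sphi spsi.
pose N := Num.max M 0 + 1; have MN : M < N by rewrite /N ltr_pwDr// le_max lexx.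
have N0 : 0 < N by rewrite /N ltr_pwDr// le_max lexx orbT.
have -> : (\int[lebesgue_measure]_t (psi t)%:E =
    \int[lebesgue_measure]_(t in `[(- N)%R, N]) (psi t)%:E)%E.
  rewrite [RHS]integral_mkcond; apply: eq_integral => t _.
  rewrite patchE; case: ifPn => // tN; congr EFin; apply/eqP.
  apply: contraNT tN => /spsi tM; apply/mem_set.
  by rewrite /= in_itv/= -ler_norml (le_trans tM)// ltW.
have cphi := is_derive1_continuous dphi.
rewrite (continuous_FTC2 (F := phi)).
- have z (t : R) : M < `|t| -> phi t = 0.
    by move=> Mt; apply/eqP; apply: contraTT Mt => /sphi; rewrite -leNgt.
  by rewrite (z N) ?(z (- N)) ?normrN ?(gtr0_norm N0)// subee.
- by rewrite (@lt_trans _ _ 0)// oppr_lt0.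
- exact: continuous_subspaceT.
- split.
  + by move=> t _; case: (dphi t).
  + exact/cvg_at_right_filter/cphi.
  + exact/cvg_at_left_filter/cphi.
- by move=> t _; rewrite derive1E; case: (dphi t).
Qed.

(** Induction on the dimension: in the last coordinate added this is the
fundamental theorem of calculus, in the others the induction hypothesis, both
inside an iterated integral. *)
Lemma integral_pderiv0 n (f : 'rV[R]_n -> R) (i : 'I_n) (M : R) :
  (forall x, derivable f x (delta_mx ord0 i)) -> continuous (pderiv i f) ->
  (forall x, f x != 0 -> forall j, `|x ord0 j| <= M) ->
  (\int[lebesgue_rV R n]_x (pderiv i f x)%:E = 0)%E.
Proof.
elim: n f i => [f []//|n IH] f i df cg sf.
have sg x : pderiv i f x != 0 -> forall j, `|x ord0 j| <= M.
  move=> gx; apply: contrapT => nx; move: gx => /eqP; apply.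
  rewrite /pderiv (_ : 0 = 'D_(delta_mx ord0 i) (cst 0) x); last by rewrite derive_cst.
  apply: near_eq_derive.
  have : nbhs x (~` cbox (fun _ : 'I_n.+1 => - M) (fun=> M)).
    apply: open_nbhs_nbhs; split; first exact/closed_openC/cbox_closed.
    by move=> xc; apply: nx => j; rewrite ler_norml; exact: xc.
  apply: filterS => y yc; apply/eqP; apply: contrapT => /negP fy.
  by apply: yc => j; rewrite -ler_norml; exact: sf.
have gi := rint_bounded_support cg sg.
have [E1 E2] := integral_rV_cons gi.
have [j ij|i0] := unliftP ord0 i.
  rewrite E2; apply: integral0_eq => t _.
  have quot x : (fun h => h^-1 *: (((fun y => f (rV_cons (y, t))) \o shift x)
        (h *: delta_mx ord0 j) - f (rV_cons (x, t)))) =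
      (fun h => h^-1 *: ((f \o shift (rV_cons (x, t))) (h *: delta_mx ord0 i)
        - f (rV_cons (x, t)))).
    apply/funext => h; rewrite /= /shift ij -rV_cons_deltaS.
    by rewrite -rV_cons_affine mulr0 add0r.
  have pd : pderiv j (fun y => f (rV_cons (y, t))) = (fun x => pderiv i f (rV_cons (x, t))).
    by apply/funext => x; rewrite /pderiv /derive quot.
  rewrite -(IH (fun x => f (rV_cons (x, t))) j).
  - by apply: eq_integral => x _; rewrite pd.
  - by move=> x; rewrite /derivable quot; exact: df.
  - rewrite pd => x; apply: continuous_comp; [exact: rV_cons_continuousl|exact: cg].
  - by move=> x fx k; have := sf _ fx (lift ord0 k); rewrite rV_consS.
rewrite E1; apply: integral0_eq => x _.
have quot t : (fun h => h^-1 *: (((fun s => f (rV_cons (x, s))) \o shift t)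
      (h *: (1 : R)) - f (rV_cons (x, t)))) =
    (fun h => h^-1 *: ((f \o shift (rV_cons (x, t))) (h *: delta_mx ord0 i)
      - f (rV_cons (x, t)))).
  apply/funext => h; rewrite /= /shift i0 -rV_cons_delta0.
  by rewrite -rV_cons_affine scaler0 add0r.
apply: (@integral_derive0 (fun t => f (rV_cons (x, t))) _ M).
- by move=> t; apply: DeriveDef; rewrite /derivable /derive quot//; exact: df.
- by move=> t; apply: continuous_comp; [exact: rV_cons_continuousr|exact: cg].
- by move=> t ft; have := sf _ ft ord0; rewrite rV_cons0.
- by move=> t ft; have := sg _ ft ord0; rewrite rV_cons0.
Qed.

End integration_by_parts.

(** * Bump functions on boxes *)

Section box_bumps.
Variables (R : realType).

(** A smooth function that vanishes on the negative half line and increases to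
[1] on the positive one as [m] grows. *)
Definition smooth_step (m : nat) (y : R) : R := expinv 1 (m.+1%:R * y).

Lemma smooth_stepE m y : 0 < y -> smooth_step m y = expR (- (m.+1%:R * y)^-1).
Proof.
by move=> y0; rewrite /smooth_step /expinv mulr_gt0// hornerE mul1r.
Qed.

Lemma smooth_step0 m y : y <= 0 -> smooth_step m y = 0.
Proof.
by move=> y0; rewrite /smooth_step /expinv ltNge pmulr_rle0// y0.
Qed.

Lemma smooth_step_ge0 m y : 0 <= smooth_step m y.
Proof.
have [y0|y0] := leP y 0; first by rewrite smooth_step0.
by rewrite smooth_stepE// expR_ge0.
Qed.

Lemma smooth_step_le1 m y : smooth_step m y <= 1.
Proof.
have [y0|y0] := leP y 0; first by rewrite smooth_step0.
by rewrite smooth_stepE// expR_le1 oppr_le0 invr_ge0 mulr_ge0// ltW.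
Qed.

Lemma smooth_step_cvg y : 0 < y -> smooth_step m y @[m --> \oo] --> (1 : R).
Proof.
move=> y0; have -> : (fun m => smooth_step m y) = (fun m => expR (- (m.+1%:R * y)^-1)).
  by apply/funext => m; rewrite smooth_stepE.
suff : expR (- (m.+1%:R * y)^-1) @[m --> \oo] --> expR (0 : R) by rewrite expR0.
apply: continuous_cvg; first exact: continuous_expR.
have -> : (fun m : nat => - (m.+1%:R * y)^-1) = (fun m : nat => - y^-1 * harmonic m).
  by apply/funext => m; rewrite /harmonic/= invfM mulNr mulrC.
by rewrite -(mulr0 (- y^-1)); apply: cvgM; [exact: cvg_cst|exact: cvg_harmonic].
Qed.

Lemma Ck_smooth_step k m : Ck k (smooth_step m).
Proof.
apply: (@Ck_comp_affine _ _ _ _ (fun y : R => m.+1%:R * y) (fun y : R => m.+1%:R * y)).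
- by move=> x; apply: cvgM; [exact: cvg_cst|exact: cvg_id].
- by move=> h v x; rewrite /GRing.scale/= mulrDr mulrCA.
- exact: Ck_expinv.
Qed.

Variables (n : nat) (a b : 'I_n -> R).

Definition box_bump (m : nat) (x : 'rV[R]_n) : R :=
  \prod_i (smooth_step m (x ord0 i - a i) * smooth_step m (b i - x ord0 i)).

Lemma Ck_box_bump k m : Ck k (box_bump m).
Proof.
apply: Ck_prod => i; have coord_cts : continuous (fun x : 'rV[R]_n => x ord0 i).
  exact: coord_continuous.
apply: CkM.
  apply: (@Ck_comp_affine _ _ _ _ (fun x : 'rV[R]_n => x ord0 i - a i)
     (fun x : 'rV[R]_n => x ord0 i)); last exact: Ck_smooth_step.
    by move=> x; apply: continuousB; [exact: coord_cts|exact: cst_continuous].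
  by move=> h v x; rewrite !mxE addrA.
apply: (@Ck_comp_affine _ _ _ _ (fun x : 'rV[R]_n => b i - x ord0 i)
     (fun x : 'rV[R]_n => - x ord0 i)); last exact: Ck_smooth_step.
  by move=> x; apply: continuousB; [exact: cst_continuous|exact: coord_cts].
by move=> h v x; rewrite !mxE opprD /GRing.scale/= mulrN addrCA.
Qed.

Lemma box_bump_ge0 m x : 0 <= box_bump m x.
Proof. by apply: prodr_ge0 => i _; rewrite mulr_ge0 ?smooth_step_ge0. Qed.

Lemma box_bump_le1 m x : box_bump m x <= 1.
Proof.
suff : 0 <= box_bump m x <= 1 by move=> /andP[].
rewrite /box_bump; elim/big_ind : _ => [|u v /andP[u0 u1] /andP[v0 v1]|i _].
- by rewrite ler01 lexx.
- by rewrite mulr_ge0// mulr_ile1.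
- by rewrite mulr_ge0 ?mulr_ile1 ?smooth_step_ge0 ?smooth_step_le1.
Qed.

Lemma box_bump_notin m x : ~ box a b x -> box_bump m x = 0.
Proof.
move=> xB; have [i hi] : exists i, ~ (a i < x ord0 i < b i).
  by apply/existsNP => h; apply: xB.
rewrite /box_bump (bigD1 i)//= [X in X * _](_ : _ = 0) ?mul0r//.
move/negP : hi; rewrite negb_and -!leNgt => /orP[h|h].
  by rewrite [X in X * _]smooth_step0 ?mul0r// subr_le0.
by rewrite [X in _ * X]smooth_step0 ?mulr0// subr_le0.
Qed.

Lemma box_bump_cvg x : box_bump m x @[m --> \oo] --> (\1_(box a b) x : R).
Proof.
rewrite indicE; have [/set_mem xB|/negP xB] := boolP (x \in box a b); last first.
  rewrite (_ : (fun m => _) = fun=> 0); first exact: cvg_cst.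
  by apply/funext => m; rewrite box_bump_notin// => h; apply: xB; exact: mem_set.
rewrite /= /box_bump.
suff : forall r : seq 'I_n, \prod_(i <- r) (smooth_step m (x ord0 i - a i) *
    smooth_step m (b i - x ord0 i)) @[m --> \oo] --> (1 : R) by exact.
elim=> [|i r IH].
  rewrite (_ : (fun m => _) = fun=> 1); first exact: cvg_cst.
  by apply/funext => m; rewrite big_nil.
have /andP[ai bi] := xB i.
rewrite (_ : (fun m => _) = fun m => smooth_step m (x ord0 i - a i) *
    smooth_step m (b i - x ord0 i) * \prod_(i <- r) (smooth_step m (x ord0 i - a i) *
    smooth_step m (b i - x ord0 i))); last by apply/funext => m; rewrite big_cons.
have c1 := @smooth_step_cvg (x ord0 i - a i); rewrite subr_gt0 in c1.
have c2 := @smooth_step_cvg (b i - x ord0 i); rewrite subr_gt0 in c2.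
have -> : nbhs (1 : R) = nbhs (1 * 1 * 1 : R) by rewrite !mulr1.
by apply: cvgM IH; apply: cvgM; [exact: c1|exact: c2].
Qed.

Lemma box_bump_support m : closure [set x | box_bump m x != 0] `<=` cbox a b.
Proof.
rewrite [X in _ `<=` X](_ : _ = closure (cbox a b)); last first.
  by rewrite -closure_id//; exact: cbox_closed.
apply: closure_subset => x /= fx; have xB : box a b x.
  by apply: contrapT => xB; rewrite box_bump_notin// eqxx in fx.
by move=> i; have /andP[h1 h2] := xB i; rewrite !ltW.
Qed.

Lemma box_bump_test m (Omega : set 'rV[R]_n) :
  cbox a b `<=` Omega -> test_function Omega (box_bump m).
Proof.
move=> abO; have supp := @box_bump_support m; split.
- by move=> k; exact: Ck_box_bump.
- by apply: subclosed_compact supp; [exact: closed_closure|exact: cbox_compact].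
- exact: subset_trans supp abO.
Qed.

End box_bumps.

(** * Functions with zero integral over boxes *)

Section fundamental_lemma.
Variables (R : realType) (n : nat).

Definition boxes : set (set 'rV[R]_n) := [set B | exists a b, B = box a b].

Lemma boxI (a b a' b' : 'I_n -> R) : box a b `&` box a' b' =
  box (fun i => Num.max (a i) (a' i)) (fun i => Num.min (b i) (b' i)).
Proof.
apply/seteqP; split => [x [h h'] i|x h].
  have /andP[h1 h2] := h i; have /andP[h3 h4] := h' i.
  by rewrite gt_max lt_min h1 h2 h3 h4.
split=> i; have := h i; rewrite gt_max lt_min => /andP[/andP[h1 h2] /andP[h3 h4]].
  by rewrite h1 h3.
by rewrite h2 h4.
Qed.

(** The preimage of an interval under a coordinate is the increasing union of
boxes that are larger and larger in the other coordinates. *)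
Lemma measurable_sub_boxes (A : set 'rV[R]_n) : measurable A -> <<s boxes >> A.
Proof.
move: A; apply: smallest_sub; first exact: smallest_sigma_algebra.
rewrite -bigcup_seq => A [i _ [B mB <-]]; rewrite setTI.
suff mi : measurable_fun setT
    (fun x : g_sigma_algebraType boxes => (x : 'rV[R]_n) ord0 i : measurableTypeR R).
  by have := mi measurableT B mB; rewrite setTI.
apply: (measurability _ (RGenOpens.measurableE R)).
move=> _ [_ [a [b ->] <-]]; rewrite setTI.
rewrite (_ : _ @^-1` _ = \bigcup_(k : nat)
  box (fun j => if j == i then a else - k%:R) (fun j => if j == i then b else k%:R)).
  apply: bigcup_measurable => k _; apply: sub_sigma_algebra.
  by eexists; eexists.
apply/seteqP; split => x.
  rewrite /= in_itv/= => xi; exists (Num.bound `|x|) => // j.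
  case: ifPn => [/eqP-> //|_]; rewrite -ltr_norml (le_lt_trans (le_coord_norm _ _))//.
  exact: archi_boundP.
by move=> [k _ /(_ i)]; rewrite eqxx /= in_itv.
Qed.

(** The sets [A] over which [g] integrates to zero form a lambda system, so that
it is enough to look at boxes. *)
Lemma boxes_integral0 (g : 'rV[R]_n -> R) :
  rint (lebesgue_rV R n) setT g ->
  (forall a b, \int[lebesgue_rV R n]_x (\1_(box a b) x * g x) = 0) ->
  \int[lebesgue_rV R n]_x g x = 0 ->
  {ae lebesgue_rV R n, forall x, g x = 0}.
Proof.
move=> gi g0 gT; have mg := rint_measurable gi.
have rA A : measurable A -> rint (lebesgue_rV R n) setT (fun x => \1_A x * g x).
  move=> mA; apply: (rint_le _ (g := fun x => `|g x|)) => //.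
  - by apply: measurable_funM => //; exact: measurable_indic.
  - exact: integrable_norm.
  - move=> x _; rewrite normrM indicE; case: (x \in A); rewrite ?normr1 ?mul1r//.
    by rewrite normr0 mul0r.
have key A : measurable A -> \int[lebesgue_rV R n]_x (\1_A x * g x) = 0.
  move=> mA; suff : <<s boxes >> `<=`
      [set A | measurable A /\ \int[lebesgue_rV R n]_x (\1_A x * g x) = 0].
    by move=> /(_ A (measurable_sub_boxes mA))[].
  apply: lambda_system_subset => //.
  - move=> _ _ [a [b ->]] [a' [b' ->]]; rewrite boxI.
    by eexists; eexists.
  - split => //.
    + split => //; rewrite -[RHS]gT; apply: eq_Rintegral => x _.
      by rewrite indicT mul1r.
    + move=> A' B BA [mA' A0] [mB B0]; split; first exact: measurableD.
      rewrite -[RHS]subr0 -{1}A0 -B0 -RintegralB//; [|exact: rA..].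
      apply: eq_Rintegral => x _; rewrite -mulrBl; congr (_ * _).
      rewrite !indicE in_setD; case: (boolP (x \in B)) => [xB|xB].
        by rewrite (mem_set (BA _ (set_mem xB))) subrr.
      by rewrite andbT subr0.
    + move=> F ndF F0.
      have mF k : measurable (F k) by have [] := F0 k.
      have mU : measurable (\bigcup_i F i) by exact: bigcup_measurable.
      split => //.
      have [|x _|||_ cv] := rint_dominated_cvg measurableT
        (f_ := fun k x => \1_(F k) x * g x) (f := fun x => \1_(\bigcup_i F i) x * g x)
        (g := fun x => `|g x|) (mu := lebesgue_rV R n).
      * by move=> k; exact: rint_measurable (rA _ (mF k)).
      * apply: cvgM; last exact: cvg_cst.
        rewrite !indicE; have [/set_mem[N _ FN]|nU] := boolP (x \in \bigcup_i F i).
          apply: cvg_near_cst; exists N => // m /= Nm; rewrite indicE mem_set//.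
          by have /subsetPset := ndF _ _ Nm; apply.
        rewrite (_ : (fun k => _) = fun=> 0); first exact: cvg_cst.
        apply/funext => k; rewrite indicE memNset// => Fk.
        by move/negP : nU; apply; apply: mem_set; exists k.
      * exact: integrable_norm.
      * move=> k x _; rewrite normrM indicE; case: (x \in _); rewrite ?normr1 ?mul1r//.
        by rewrite normr0 mul0r.
      * apply: (cvg_unique _ cv) => //.
        rewrite (_ : (fun k => _) = fun=> 0); first exact: cvg_cst.
        by apply/funext => k; have [] := F0 k.
  - by move=> _ [a [b ->]]; split; [exact: measurable_box|exact: g0].
(* A function with zero integral over the set where it is positive is
nonpositive; this is then used for [g] and [- g]. *)
have half (h : 'rV[R]_n -> R) : rint (lebesgue_rV R n) setT h ->
    (forall A, measurable A -> \int[lebesgue_rV R n]_x (\1_A x * h x) = 0) ->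
    {ae lebesgue_rV R n, forall x, h x <= 0}.
  move=> hi h0; have mh := rint_measurable hi.
  pose A := [set x | 0 < h x].
  have mA : measurable A.
    rewrite (_ : A = setT `&` h @^-1` `]0, +oo[%classic).
      by apply: mh => //; exact: measurable_itv.
    by apply/seteqP; split=> [x Ax|x [_]]; rewrite /= in_itv/= ?andbT//; split => //; rewrite /= in_itv/= andbT.
  have Ai : rint (lebesgue_rV R n) setT (fun x => \1_A x * h x).
    apply: (rint_le _ (g := fun x => `|h x|)) => //.
    - by apply: measurable_funM => //; exact: measurable_indic.
    - exact: integrable_norm.
    - move=> x _; rewrite normrM indicE; case: (x \in _); rewrite ?normr1 ?mul1r//.
      by rewrite normr0 mul0r.
  have := Rintegral_eq0 measurableT Ai _ (h0 A mA).
  move=> /(_ _)/wrap[].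
    move=> x _; rewrite indicE; case: (boolP (x \in A)) => [/set_mem xA|_].
      by rewrite mul1r ltW.
    by rewrite mul0r.
  apply: filterS => x /(_ I); rewrite indicE.
  case: (boolP (x \in A)) => [_|/negP xA _]; first by rewrite mul1r => ->.
  by rewrite leNgt; apply/negP => hx; apply: xA; exact: mem_set.
have h1 := half g gi key.
have h2 : {ae lebesgue_rV R n, forall x, - g x <= 0}.
  have ngi : rint (lebesgue_rV R n) setT (fun x => - g x).
    apply: (rint_ext _ (f := fun x => -1 * g x)) => //.
      by move=> x _; rewrite mulN1r.
    exact: rintZ.
  apply: half => // A mA; rewrite -[RHS](mulr0 (-1)) -(key A mA) -RintegralZl//.
    by apply: eq_Rintegral => x _; rewrite mulN1r mulrN.
  exact: rA.
apply: filterS2 h1 h2 => x x1 x2; apply/eqP; rewrite eq_le x1/=.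
by rewrite oppr_le0 in x2.
Qed.

End fundamental_lemma.

(** * Riesz representation *)

Section riesz_representation.
Variables (R : realType) (E : lmodType R) (S : set E) (b : E -> E -> R).
Hypotheses (hS : subspace S) (hb : psd_form S b).
Variables (l : E -> R) (C : R).
Hypothesis l_linear : forall a u v, S u -> S v -> l (a *: u + v) = a * l u + l v.
Hypothesis l_bounded : forall v, S v -> `|l v| <= C * Num.sqrt (b v v).
Hypothesis complete : forall v : nat -> E, (forall n, S (v n)) ->
  (forall e, 0 < e -> exists N, forall n m, (N <= n)%N -> (N <= m)%N ->
     b (v n - v m) (v n - v m) <= e) ->
  exists u, S u /\ forall e, 0 < e -> exists N, forall n, (N <= n)%N ->
     b (v n - u) (v n - u) <= e.

Let J v := b v v - 2 * l v.

Let J_expand t u v : S u -> S v ->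
  J (t *: v + u) = J u + 2 * t * (b u v - l v) + t ^+ 2 * b v v.
Proof.
move=> Su Sv; have Stv := subspaceZ hS t Sv.
have Sw := subspaceD hS Stv Su.
rewrite /J l_linear// (psdDl hb)// !(psdDr hS hb)// !(psdZl hS hb)// !(psdZr hS hb)//.
by rewrite (psd_sym hb Sv Su); ring.
Qed.

(** A minimising sequence of the energy [b v v - 2 * l v] is Cauchy by the
parallelogram identity; the first variation of the energy vanishes at its
limit. *)
Lemma riesz_representation : exists2 u, S u & forall v, S v -> b u v = l v.
Proof.
have S0 := subspace0 hS.
have Jlb v : S v -> - C ^+ 2 <= J v.
  move=> Sv; have := l_bounded Sv; rewrite ler_norml => /andP[_ h].
  have := sqr_sqrtr (psd_ge0 hb Sv); rewrite /J.
  move: (Num.sqrt _) h => q h <-.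
  by have := sqr_ge0 (q - C); nra.
pose A := [set J v | v in S].
have hA : has_inf A.
  split; first by exists (J 0), 0.
  by exists (- C ^+ 2) => _ [v Sv <-]; exact: Jlb.
pose m := inf A.
have mJ v : S v -> m <= J v by move=> Sv; apply: ge_inf; [case: hA|exists v].
have /choice[v hv] : forall n : nat, exists v, S v /\ J v <= m + n.+1%:R^-1.
  move=> n; have n0 : 0 < n.+1%:R^-1 :> R by rewrite invr_gt0.
  have [_ [v Sv <-] Jv] := inf_adherent n0 hA.
  by exists v; split => //; exact: ltW.
have Sv n : S (v n) by have [] := hv n.
have Jv n : J (v n) <= m + n.+1%:R^-1 by have [] := hv n.
(* The midpoint of [v n] and [v k] has energy at least [m]. *)
have par n k : b (v n - v k) (v n - v k) <= 2 * n.+1%:R^-1 + 2 * k.+1%:R^-1.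
  have Sd := subspaceB hS (Sv n) (Sv k).
  have mid : S (2^-1 *: (v n - v k) + v k).
    by apply: subspaceD => //; exact: subspaceZ.
  have := mJ _ mid; rewrite J_expand//.
  have Jn := Jv n; have Jk := Jv k.
  have : J (v n) = J (1 *: (v n - v k) + v k) by rewrite scale1r subrK.
  rewrite J_expand//; move: (n.+1%:R^-1) (k.+1%:R^-1) Jn Jk => p q Jn Jk e1 e2.
  by move: (b (v n - v k) _) (b (v k) _ - _) e1 e2 => x y; nra.
have small (e : R) : 0 < e -> exists N : nat, forall n, (N <= n)%N -> n.+1%:R^-1 <= e.
  move=> e0; have [N] := ltr_add_invr (y := 0) e0; rewrite add0r => hN.
  exists N => n Nn; apply: le_trans (ltW hN).
  by rewrite lef_pV2 ?posrE// ler_nat.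
have [u [Su vu]] : exists u, S u /\ forall e, 0 < e -> exists N, forall n, (N <= n)%N ->
     b (v n - u) (v n - u) <= e.
  apply: complete => // e e0.
  have [N hN] := small (e / 4) ltac:(by rewrite divr_gt0).
  exists N => n k Nn Nk; apply: le_trans (par n k) _.
  have := hN n Nn; have := hN k Nk.
  by move: (n.+1%:R^-1) (k.+1%:R^-1) => p q; lra.
exists u => // w Sw.
have var t e : 0 < e -> - e <= 2 * t * (b u w - l w) + t ^+ 2 * b w w.
  move=> e0.
  have w0 := psd_ge0 hb Sw.
  pose e1 := (e / 2 / (2 * `|t| * Num.sqrt (b w w) + 1)) ^+ 2.
  have den : 0 < 2 * `|t| * Num.sqrt (b w w) + 1.
    by rewrite ltr_wpDl// mulr_ge0 ?sqrtr_ge0// mulr_ge0.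
  have e10 : 0 < e1 by rewrite exprn_gt0// !divr_gt0.
  have [N1 hN1] := vu e1 e10.
  have [N2 hN2] := small (e / 2) ltac:(by rewrite divr_gt0).
  pose n := maxn N1 N2.
  have Sd := subspaceB hS (Sv n) Su.
  have h1 : b (v n - u) (v n - u) <= e1 by apply: hN1; exact: leq_maxl.
  have h2 : n.+1%:R^-1 <= e / 2 by apply: hN2; exact: leq_maxr.
  have mid : S (t *: w + v n) by apply: subspaceD => //; exact: subspaceZ.
  have := mJ _ mid; rewrite J_expand// => h3.
  have h4 := Jv n.
  have h5 : `|2 * t * (b (v n) w - b u w)| <= e / 2.
    rewrite -(psdBl hb)// !normrM ger0_norm//.
    have := psd_cauchy_schwarz_sqrt hS hb Sd Sw => cs.
    have sq : Num.sqrt (b (v n - u) (v n - u)) <= e / 2 / (2 * `|t| * Num.sqrt (b w w) + 1).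
      have D0 : 0 <= e / 2 / (2 * `|t| * Num.sqrt (b w w) + 1) by rewrite !divr_ge0// ltW.
      by rewrite -[leRHS](ger0_norm D0) -[leRHS]sqrtr_sqr ler_wsqrtr.
    apply: (@le_trans _ _ (2 * `|t| * (e / 2 / (2 * `|t| * Num.sqrt (b w w) + 1) * Num.sqrt (b w w)))).
      rewrite ler_wpM2l ?mulr_ge0//; apply: le_trans cs _.
      by rewrite ler_wpM2r ?sqrtr_ge0.
    rewrite [leLHS](_ : _ = (2 * `|t| * Num.sqrt (b w w)) * (e / 2) / (2 * `|t| * Num.sqrt (b w w) + 1)); last by ring.
    rewrite ler_pdivrMr// [leRHS]mulrC ler_wpM2r ?divr_ge0 ?ltW//.
    by rewrite ltrDl.
  move: h5; rewrite ler_norml => /andP[_ h5].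
  by move: (n.+1%:R^-1) h2 h4 => p h2 h4; lra.
apply/eqP; rewrite -subr_eq0; apply/negP => /negP nz.
set d := b u w - l w in var nz.
have w0 := psd_ge0 hb Sw.
(* This [t] nearly minimises the quadratic polynomial of [var]; the summand [1]
keeps the denominator positive when [b w w = 0]. *)
have := var (- d / (b w w + 1)) (d ^+ 2 / (2 * (b w w + 1))).
have p1 : 0 < b w w + 1 by lra.
have d2 : 0 < d ^+ 2 by rewrite exprn_even_gt0.
have e0 : 0 < d ^+ 2 / (2 * (b w w + 1)) by rewrite divr_gt0// mulr_gt0.
move=> /(_ e0).
have -> : 2 * (- d / (b w w + 1)) * d + (- d / (b w w + 1)) ^+ 2 * b w w =
   d ^+ 2 / (b w w + 1) * (- 2 + b w w / (b w w + 1)).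
  by field; rewrite gt_eqF.
have -> : d ^+ 2 / (2 * (b w w + 1)) = d ^+ 2 / (b w w + 1) / 2.
  by field; rewrite gt_eqF.
have q0 : 0 < d ^+ 2 / (b w w + 1) by rewrite divr_gt0.
have q1 : b w w / (b w w + 1) < 1 by rewrite ltr_pdivrMr// mul1r ltrDl.
by move: (d ^+ 2 / _) (b w w / _) q0 q1 => x y; nra.
Qed.

End riesz_representation.

(** * Test functions on a bounded open set *)

Section test_functions.
Variables (R : realType) (d : nat) (Omega : set 'rV[R]_d).
Hypotheses (oO : open Omega) (bO : bounded_set Omega).
Let mu := lebesgue_rV R d.
Implicit Types (u v w f phi psi : 'rV[R]_d -> R) (G H : 'I_d -> 'rV[R]_d -> R).

Lemma mOmega : measurable Omega. Proof. exact: open_measurable_rV. Qed.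

Lemma Omega_lty : (mu Omega < +oo)%E.
Proof. exact: lebesgue_bounded_lty mOmega bO. Qed.

Lemma rint_cst (k : R) : rint mu Omega (fun=> k).
Proof.
apply: measurable_bounded_integrable => //; [exact: mOmega|exact: Omega_lty|].
by exists `|k|; split; rewrite ?num_real// => x kx y _ /=; exact: ltW.
Qed.

(** The bound [`|f| <= f ^+ 2 + 1] is integrable on a set of finite measure. *)
Lemma L2_rint f : L2 mu Omega f -> rint mu Omega f.
Proof.
move=> /(L2P _ mOmega)[mf fi].
apply: (rint_le mOmega (g := fun x => f x ^+ 2 + 1)) => //.
  by apply: rintD => //; [exact: mOmega|exact: rint_cst].
move=> x _; rewrite ler_norml; have := sqr_ge0 (f x - 1); have := sqr_ge0 (f x + 1).
by rewrite !expr2 => h1 h2; apply/andP; split; nra.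
Qed.

Lemma test_continuous phi : test_function Omega phi -> continuous phi.
Proof. by move=> [C _ _]; exact: Ck_continuous (C 0%N). Qed.

Lemma test_derivable phi (x e : 'rV[R]_d) : test_function Omega phi -> derivable phi x e.
Proof. by move=> [C _ _]; have [_ /(_ e)[]] := C 1%N. Qed.

Lemma test_pderiv_continuous phi i : test_function Omega phi -> continuous (pderiv i phi).
Proof. by move=> [C _ _]; have [_ /(_ (delta_mx ord0 i))[_]] := C 1%N. Qed.

Lemma pderiv_support phi i x : ~ closure [set y | phi y != 0] x -> pderiv i phi x = 0.
Proof.
move=> nx; rewrite /pderiv (_ : 0 = 'D_(delta_mx ord0 i) (cst 0) x); last by rewrite derive_cst.
apply: near_eq_derive.
have : nbhs x (~` closure [set y | phi y != 0]).
  by apply: open_nbhs_nbhs; split => //; exact/closed_openC/closed_closure.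
apply: filterS => y yc; apply/eqP; apply: contrapT => /negP fy.
by apply: yc; exact: subset_closure.
Qed.

Lemma test_support_bounded phi : test_function Omega phi -> exists M : R,
  forall x : 'rV[R]_d, closure [set y | phi y != 0] x -> forall j, `|x ord0 j| <= M.
Proof.
move=> [_ /compact_bounded[M [_ hM]] _]; exists (M + 1) => x xc j.
by apply: le_trans (le_coord_norm _ _) _; apply: hM => //; rewrite ltrDl.
Qed.

Lemma test_notin phi x : test_function Omega phi -> ~ Omega x -> phi x = 0.
Proof.
move=> [_ _ s] xO; apply/eqP; apply: contrapT => /negP px; apply: xO.
by apply: s; exact: subset_closure.
Qed.

Lemma rint_supported f : rint mu setT f -> rint mu Omega f.
Proof. by move=> fi; apply: integrableS fi => //; exact: mOmega. Qed.

Lemma L2_bounded_support (g : 'rV[R]_d -> R) (M : R) : continuous g ->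
  (forall x : 'rV[R]_d, g x != 0 -> forall j, `|x ord0 j| <= M) -> L2 mu Omega g.
Proof.
move=> cg sg; apply/(L2P _ mOmega); split.
  by apply: measurable_funTS; exact: continuous_measurable_rV.
apply: rint_supported; apply: (rint_bounded_support (M := M)).
  have -> : (fun x => g x ^+ 2) = g \* g by apply/funext => x; rewrite expr2.
  by move=> x; apply: continuousM; exact: cg.
by move=> x; rewrite sqrf_eq0; exact: sg.
Qed.

Lemma test_L2 phi : test_function Omega phi -> L2 mu Omega phi.
Proof.
move=> tp; have [M hM] := test_support_bounded tp.
apply: (L2_bounded_support (M := M)); first exact: test_continuous.
by move=> x px; apply: hM; exact: subset_closure.
Qed.

Lemma test_pderiv_L2 phi i : test_function Omega phi -> L2 mu Omega (pderiv i phi).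
Proof.
move=> tp; have [M hM] := test_support_bounded tp.
apply: (L2_bounded_support (M := M)); first exact: test_pderiv_continuous.
move=> x px; apply: hM; apply: contrapT => /(pderiv_support i) p0.
by rewrite p0 eqxx in px.
Qed.

Lemma test_linear a phi psi : test_function Omega phi -> test_function Omega psi ->
  test_function Omega (a *: phi + psi).
Proof.
move=> [C1 K1 S1] [C2 K2 S2].
have sub : closure [set x | (a *: phi + psi) x != 0] `<=`
    closure [set x | phi x != 0] `|` closure [set x | psi x != 0].
  rewrite -closureU; apply: closure_subset => x /=; rewrite !fctE => h.
  have [p0|] := eqVneq (phi x) 0; last by left.
  by right; move: h; rewrite p0 scaler0 add0r.
split.
- by move=> k; apply: CkD => //; exact: CkZ.
- apply: subclosed_compact sub; [exact: closed_closure|exact: compactU].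
- by apply: subset_trans sub _ => x [/S1|/S2].
Qed.

Lemma pderiv_linear a phi psi i : test_function Omega phi -> test_function Omega psi ->
  pderiv i (a *: phi + psi) = a *: pderiv i phi + pderiv i psi.
Proof.
move=> t1 t2; apply/funext => x; rewrite /pderiv deriveD; last 2 first.
- by apply: derivableZ; exact: test_derivable.
- exact: test_derivable.
by rewrite deriveZ//; exact: test_derivable.
Qed.

(** The product of two test functions has compact support, so the integral of
its partial derivatives is zero. *)
Lemma integral_by_parts phi psi i : test_function Omega phi -> test_function Omega psi ->
  dotL2 Omega phi (pderiv i psi) = - dotL2 Omega (pderiv i phi) psi.
Proof.
move=> t1 t2; apply/eqP; rewrite -addr_eq0; apply/eqP.
have sub := L2_subspace mu Omega; rewrite /dotL2.
rewrite -RintegralD; [|exact: mOmega|by apply: L2_rint_mul; [exact: mOmega|exact: test_L2|exact: test_pderiv_L2]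
  |by apply: L2_rint_mul; [exact: mOmega|exact: test_pderiv_L2|exact: test_L2]].
rewrite Rintegral_mkcond.
have pd x : pderiv i (phi * psi) x = phi x * pderiv i psi x + pderiv i phi x * psi x.
  rewrite /pderiv deriveM; [|exact: test_derivable..].
  by rewrite /GRing.scale/= [X in _ + X]mulrC.
have -> : (fun x => phi x * pderiv i psi x + pderiv i phi x * psi x) \_ Omega =
    pderiv i (phi * psi).
  apply/funext => x; rewrite pd patchE; case: ifPn => // /negP xO.
  have xO' : ~ Omega x by move=> /mem_set.
  by rewrite (test_notin t1 xO') (test_notin t2 xO') mul0r mulr0 addr0.
have [M hM] := test_support_bounded t1.
rewrite /Rintegral (@integral_pderiv0 _ _ _ _ M)//.
- by move=> x; apply: derivableM; exact: test_derivable.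
- rewrite (_ : pderiv i _ = (phi \* pderiv i psi) + (pderiv i phi \* psi)); last exact/funext.
  move=> x; apply: continuousD; apply: continuousM.
  + exact: test_continuous.
  + exact: test_pderiv_continuous.
  + exact: test_pderiv_continuous.
  + exact: test_continuous.
- move=> x px; apply: hM; apply: subset_closure => /=.
  by apply: contraNN px => /eqP p0; rewrite /= !fctE p0 mul0r.
Qed.

(** Density of the test functions in L^2, in dual form. The bump functions of a
box in [Omega] show that [w] has integral zero over the box, and countably many
boxes cover [Omega]. *)
Lemma fundamental_lemma w : L2 mu Omega w ->
  (forall phi, test_function Omega phi -> dotL2 Omega w phi = 0) ->
  {ae mu, forall x, Omega x -> w x = 0}.
Proof.
move=> Lw w0; have mO := mOmega.
have wi := L2_rint Lw; have mw := L2_measurable mO Lw.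
have boxw a b : cbox a b `<=` Omega ->
    \int[mu]_(x in Omega) (\1_(box a b) x * w x) = 0.
  move=> abO.
  have [|x _|||_ cv] := rint_dominated_cvg mO
      (f_ := fun m x => box_bump a b m x * w x) (f := fun x => \1_(box a b) x * w x)
      (g := fun x => `|w x|) (mu := mu).
  - move=> m; apply: measurable_funM => //; apply: measurable_funTS.
    by apply: continuous_measurable_rV; exact: Ck_continuous (Ck_box_bump _ _ 0 m).
  - by apply: cvgM; [exact: box_bump_cvg|exact: cvg_cst].
  - exact: integrable_norm.
  - move=> m x _; rewrite normrM ger0_norm ?box_bump_ge0//.
    by rewrite ler_piMl// box_bump_le1.
  apply: (cvg_unique _ cv) => //.
  rewrite (_ : (fun m => _) = fun=> 0); first exact: cvg_cst.
  apply/funext => m; rewrite -[RHS](w0 _ (box_bump_test m abO)).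
  by apply: eq_Rintegral => x _; rewrite mulrC.
have [a [b [_ [P [OE POmega]]]]] := open_bigcup_box oO.
have wk k : P k -> {ae mu, forall x, \1_(box (a k) (b k)) x * (w \_ Omega) x = 0}.
  move=> Pk; have mB := measurable_box (a k) (b k).
  have wOi : rint mu setT (w \_ Omega).
    rewrite /rint; have /(integrable_mkcond _ mO) := wi.
    by apply: eq_integrable => // x _ /=; rewrite !patchE; case: ifP.
  have box_int B : measurable B -> \int[mu]_x (\1_B x * (w \_ Omega) x) =
      \int[mu]_(x in Omega) (\1_B x * w x).
    move=> mB'; rewrite [RHS]Rintegral_mkcond; apply: eq_Rintegral => x _.
    by rewrite !patchE; case: ifP; rewrite ?mulr0.
  apply: boxes_integral0.
  - apply: (rint_le _ (g := fun x => `|(w \_ Omega) x|)) => //.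
    + apply: measurable_funM; first exact: measurable_indic.
      exact: rint_measurable wOi.
    + exact: integrable_norm.
    + move=> x _; rewrite normrM indicE; case: (x \in _); rewrite ?normr1 ?mul1r//.
      by rewrite normr0 mul0r.
  - move=> a' b'; under eq_Rintegral do rewrite mulrA.
    have -> : (fun x => \1_(box a' b') x * \1_(box (a k) (b k)) x * (w \_ Omega) x) =
       (fun x => \1_(box a' b' `&` box (a k) (b k)) x * (w \_ Omega) x).
      by apply/funext => x; rewrite !indicE in_setI -natrM mulnb.
    rewrite box_int; last by apply: measurableI => //; exact: measurable_box.
    rewrite boxI; apply: boxw; apply: subset_trans (POmega k Pk) => x h i.
    have := h i; rewrite ge_max le_min => /andP[/andP[_ h1] /andP[_ h2]].
    by rewrite h1 h2.
  - by rewrite box_int//; apply: boxw; exact: POmega.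
have : {ae mu, forall x, forall k, P k -> \1_(box (a k) (b k)) x * (w \_ Omega) x = 0}.
  apply: ae_foralln => k; have [Pk|nPk] := pselect (P k).
    by apply: filterS (wk k Pk).
  by apply: aeW => x /nPk.
apply: filterS => x h Ox; move: (Ox); rewrite OE => -[k Pk xk].
by have := h k Pk; rewrite indicE mem_set// mul1r patchE mem_set.
Qed.

End test_functions.

(** * The space H^1_0 *)

Section psd_convergence.
Variables (R : realType) (E : lmodType R) (S : set E) (b : E -> E -> R).
Hypotheses (hS : subspace S) (hb : psd_form S b).
Implicit Types (u v w : E) (x : nat -> E).

Definition converges x u := forall e, 0 < e -> exists N, forall n, (N <= n)%N ->
  b (x n - u) (x n - u) <= e.

Lemma psd_sqrD u v : S u -> S v -> b (u + v) (u + v) <= 2 * b u u + 2 * b v v.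
Proof.
move=> Su Sv; have Suv := subspaceD hS Su Sv.
have := psd_ge0 hb (subspaceB hS Su Sv).
rewrite (psdBl hb)// ?(psdBr hS hb)//; last exact: subspaceB.
rewrite (psdDl hb)// !(psdDr hS hb)// (psd_sym hb Sv Su).
by move=> h; lra.
Qed.

Lemma converges_linear a x u y v : (forall n, S (x n)) -> (forall n, S (y n)) ->
  S u -> S v -> converges x u -> converges y v ->
  converges (fun n => a *: x n + y n) (a *: u + v).
Proof.
move=> Sx Sy Su Sv xu yv e e0.
have p : 0 < 2 * a ^+ 2 + 2 :> R by have := sqr_ge0 a; lra.
have ep : 0 < e / (2 * a ^+ 2 + 2) by rewrite divr_gt0.
have [N hN] := xu _ ep; have [M hM] := yv _ ep.
exists (maxn N M) => n; rewrite geq_max => /andP[Nn Mn].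
have Sxu := subspaceB hS (Sx n) Su; have Syv := subspaceB hS (Sy n) Sv.
have -> : a *: x n + y n - (a *: u + v) = a *: (x n - u) + (y n - v).
  by rewrite scalerBr opprD addrACA.
apply: le_trans (psd_sqrD _ _) _ => //; first exact: subspaceZ.
rewrite (psdZl hS hb)//; last exact: subspaceZ.
rewrite (psdZr hS hb)//.
have := hN n Nn; have := hM n Mn; rewrite !ler_pdivlMr//.
have := psd_ge0 hb Sxu; have := psd_ge0 hb Syv; have := sqr_ge0 a.
by move: (b (x n - u) _) (b (y n - v) _) => p1 p2; rewrite expr2; nra.
Qed.

Lemma converges_form x u w : (forall n, S (x n)) -> S u -> S w -> converges x u ->
  b (x n) w @[n --> \oo] --> b u w.
Proof.
move=> Sx Su Sw xu; apply/cvgrPdist_le => e e0.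
have w0 := psd_ge0 hb Sw.
have ep : 0 < e ^+ 2 / (b w w + 1).
  by rewrite divr_gt0 ?exprn_gt0//; lra.
have [N hN] := xu _ ep; exists N => // n /= Nn.
have Sxu := subspaceB hS (Sx n) Su.
rewrite distrC -(psdBl hb)// -(@ler_pXn2r _ 2)// ?nnegrE ?normr_ge0 ?(ltW e0)//.
rewrite real_normK ?num_real//. apply: le_trans (psd_cauchy_schwarz hS hb Sxu Sw) _.
have := hN n Nn; rewrite ler_pdivlMr; last by lra.
by have := psd_ge0 hb Sxu; nra.
Qed.

Lemma converges_cst u : S u -> converges (fun=> u) u.
Proof.
move=> Su e e0; exists 0%N => n _; rewrite subrr (psd0l hS hb)//; first exact: ltW.
exact: subspace0 hS.
Qed.

End psd_convergence.

Section H10_space.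
Variables (R : realType) (d : nat) (Omega : set 'rV[R]_d).
Hypotheses (oO : open Omega) (bO : bounded_set Omega).
Let mu := lebesgue_rV R d.
Implicit Types (u v w f phi psi kappa : 'rV[R]_d -> R) (G H : 'I_d -> 'rV[R]_d -> R).

Let mO : measurable Omega. Proof. exact: mOmega. Qed.
Let sL2 : subspace (L2 mu Omega). Proof. exact: L2_subspace. Qed.

Lemma dotL2_form : psd_form (L2 mu Omega) (dotL2 Omega).
Proof. exact: L2_form. Qed.

Let fL2 := dotL2_form.

Lemma cvgL2P (f_ : nat -> 'rV[R]_d -> R) f :
  (forall n, L2 mu Omega (f_ n)) -> L2 mu Omega f ->
  cvgL2 Omega f_ f <-> converges (dotL2 Omega) f_ f.
Proof.
move=> Lf_ Lf.
have E n : (\int[mu]_(x in Omega) ((f_ n x - f x) ^+ 2)%:E =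
    (dotL2 Omega (f_ n - f) (f_ n - f))%:E)%E.
  rewrite /dotL2 (EFin_Rintegral mO); last by apply: L2_rint_mul => //; exact: subspaceB.
  by apply: eq_integral => x _; rewrite expr2.
have D0 n : 0 <= dotL2 Omega (f_ n - f) (f_ n - f).
  by apply: (psd_ge0 fL2); exact: subspaceB.
rewrite /cvgL2; split.
  under eq_fun do rewrite E.
  move=> /fine_cvgP[_ /cvgr0Pnorm_le] h e e0.
  have [N _ hN] := h e e0; exists N => n Nn.
  by have := hN n Nn; rewrite /= ger0_norm.
move=> h; under eq_fun do rewrite E.
apply: cvg_EFin; first exact: nearW.
apply/cvgr0Pnorm_le => e e0; have [N hN] := h e e0.
by exists N => // n /= Nn; rewrite ger0_norm// hN.
Qed.

Lemma H10_gradient_linear a u v G H : L2 mu Omega u -> L2 mu Omega v ->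
  H10_gradient Omega u G -> H10_gradient Omega v H ->
  H10_gradient Omega (a *: u + v) (fun i => a *: G i + H i).
Proof.
move=> Lu Lv [LG wG [phi [tphi phiu phiG]]] [LH wH [psi [tpsi psiv psiH]]].
have tl n : test_function Omega (a *: phi n + psi n) by exact: test_linear.
split.
- by move=> i; exact: sL2.2.
- move=> i rho trho.
  have L1 := test_pderiv_L2 oO i trho; have L0 := test_L2 oO trho.
  rewrite (psd_linear fL2)// (psd_linear fL2)// wG// wH//.
  by rewrite mulrN opprD.
- exists (fun n => a *: phi n + psi n); split => //.
  + apply/cvgL2P; [by move=> n; exact: test_L2|exact: sL2.2|].
    apply: (converges_linear sL2 fL2) => //; try by move=> n; exact: test_L2.
      by apply/cvgL2P => // n; exact: test_L2.
    by apply/cvgL2P => // n; exact: test_L2.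
  + move=> i; have -> : (fun n => pderiv i (a *: phi n + psi n)) =
        (fun n => a *: pderiv i (phi n) + pderiv i (psi n)).
      by apply/funext => n; rewrite (pderiv_linear _ _ (tphi n) (tpsi n)).
    apply/cvgL2P; [by move=> n; apply: sL2.2; exact: test_pderiv_L2|exact: sL2.2|].
    apply: (converges_linear sL2 fL2) => //; try by move=> n; exact: test_pderiv_L2.
      by apply/cvgL2P => // n; exact: test_pderiv_L2.
    by apply/cvgL2P => // n; exact: test_pderiv_L2.
Qed.

Lemma H10_grad u : H10 Omega u -> H10_gradient Omega u (grad Omega u).
Proof. by move=> [_ [G hG]]; rewrite /grad; exact: (xgetI _ hG). Qed.

Lemma H10_L2 u : H10 Omega u -> L2 mu Omega u. Proof. by case. Qed.

Lemma grad_L2 u i : H10 Omega u -> L2 mu Omega (grad Omega u i).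
Proof. by move=> /H10_grad[]. Qed.

(** A weak gradient is determined by its integrals against test functions. *)
Lemma gradient_unique u v G H : L2 mu Omega u -> L2 mu Omega v ->
  H10_gradient Omega u G -> H10_gradient Omega v H ->
  (forall phi, L2 mu Omega phi -> dotL2 Omega u phi = dotL2 Omega v phi) ->
  forall i, {ae mu, forall x, Omega x -> G i x = H i x}.
Proof.
move=> Lu Lv [LG wG _] [LH wH _] uv i.
have := fundamental_lemma oO bO (subspaceB sL2 (LG i) (LH i)).
move=> /(_ _)/wrap[].
  move=> phi tphi; have L0 := test_L2 oO tphi.
  have L1 := test_pderiv_L2 oO i tphi.
  rewrite (psdBl fL2)//; have := wG i _ tphi; have := wH i _ tphi.
  rewrite uv// => -> /eqP; rewrite eqr_opp => /eqP ->.
  by rewrite subrr.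
apply: filterS => x h Ox; apply/eqP; rewrite -subr_eq0; apply/eqP; exact: h.
Qed.

Lemma H10_subspace : subspace (H10 Omega).
Proof.
split; last first.
  move=> a u v [Lu [G hG]] [Lv [H hH]]; split; first exact: sL2.2.
  by eexists; exact: H10_gradient_linear hG hH.
have L0 := subspace0 sL2; split => //; exists (fun=> 0); split => //.
- by move=> i phi tphi; rewrite !(psd0l sL2 fL2) ?oppr0//; [exact: test_L2|exact: test_pderiv_L2].
- have t0 : test_function Omega (0 : 'rV[R]_d -> R).
    have e0 : [set x : 'rV[R]_d | (0 : 'rV[R]_d -> R) x != 0] = set0.
      by apply/seteqP; split => x //=; rewrite eqxx.
    by split; rewrite ?e0 ?closure0//; [move=> k; exact: Ck_cst|exact: compact0].
  exists (fun=> 0); split => //.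
    by apply/cvgL2P => //; exact: (converges_cst sL2 fL2).
  move=> i; apply/cvgL2P => //; first by move=> n; exact: test_pderiv_L2.
  have -> : pderiv i (0 : 'rV[R]_d -> R) = 0 by apply/funext => x; exact: derive_cst.
  exact: (converges_cst sL2 fL2).
Qed.

Lemma test_H10 phi : test_function Omega phi -> H10 Omega phi.
Proof.
move=> tphi; have L0 := test_L2 oO tphi.
split=> //; exists (fun i => pderiv i phi); split.
- by move=> i; exact: test_pderiv_L2.
- by move=> i psi tpsi; exact: integral_by_parts.
- exists (fun=> phi); split => //.
    by apply/cvgL2P => //; exact: (converges_cst sL2 fL2).
  move=> i; have L1 := test_pderiv_L2 oO i tphi.
  by apply/cvgL2P => //; exact: (converges_cst sL2 fL2).
Qed.

(** H^1_0 is dense in L^2, since it contains the test functions. This is how a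
function of L^2 with zero dual norm is seen to vanish. *)
Lemma L2_orthogonal_H10 w : L2 mu Omega w ->
  (forall v, H10 Omega v -> dotL2 Omega w v = 0) ->
  {ae mu, forall x, Omega x -> w x = 0}.
Proof.
by move=> Lw w0; apply: fundamental_lemma => // phi tphi; apply: w0; exact: test_H10.
Qed.

Section gradient_forms.
Variables (kappa : 'rV[R]_d -> R) (M : R).
Hypotheses (mk : measurable_fun Omega kappa) (k0 : forall x, 0 <= kappa x)
  (kM : {ae mu, forall x, Omega x -> kappa x <= M}).

(** Both the Dirichlet form, for [kappa = 1], and the form of the wave
operator, for [kappa = c^2], are of this type. *)
Definition gradient_form u v : R :=
  \int[mu]_(x in Omega) (kappa x * dotgrad Omega u v x).

(** Truncating [kappa] at an essential bound changes it on a null set only. *)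
Lemma rint_weight f : rint mu Omega f -> rint mu Omega (fun x => kappa x * f x).
Proof.
move=> fi; have mf := rint_measurable fi.
apply: (ae_rint mO (f := fun x => Num.min (kappa x) `|M| * f x)).
- by apply: measurable_funM => //; exact: measurable_minr.
- exact: measurable_funM.
- apply: filterS kM => x h Ox; rewrite min_l//.
  by apply: le_trans (h Ox) _; exact: ler_norm.
- apply: (rint_le mO (g := fun x => `|M| * `|f x|)).
  + by apply: measurable_funM => //; exact: measurable_minr.
  + by apply: rintZ => //; exact: integrable_norm.
  + move=> x _; rewrite normrM ler_wpM2r// ger0_norm ?ge_min ?lexx ?orbT//.
    by rewrite le_min k0/=.
Qed.

Lemma gradient_formE u v G H : H10 Omega u -> H10 Omega v ->
  H10_gradient Omega u G -> H10_gradient Omega v H ->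
  gradient_form u v = \sum_i \int[mu]_(x in Omega) (kappa x * (G i x * H i x)).
Proof.
move=> Hu Hv uG vH.
have LG i : L2 mu Omega (G i) by case: uG.
have LH i : L2 mu Omega (H i) by case: vH.
have rGH i : rint mu Omega (fun x => kappa x * (G i x * H i x)).
  by apply: rint_weight; exact: L2_rint_mul.
have rgg i : rint mu Omega (fun x => kappa x * (grad Omega u i x * grad Omega v i x)).
  by apply: rint_weight; apply: L2_rint_mul => //; exact: grad_L2.
rewrite /gradient_form.
rewrite (_ : (fun x => _) = fun x => \sum_i kappa x * (grad Omega u i x * grad Omega v i x)); last first.
  by apply/funext => x; rewrite /dotgrad mulr_sumr.
rewrite Rintegral_sum//; apply: eq_bigr => i _.
apply: (ae_eq_Rintegral mO); [exact: rint_measurable (rgg i)|exact: rint_measurable (rGH i)|].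
have := gradient_unique (H10_L2 Hu) (H10_L2 Hu) (H10_grad Hu) uG (fun _ _ => erefl) i.
have := gradient_unique (H10_L2 Hv) (H10_L2 Hv) (H10_grad Hv) vH (fun _ _ => erefl) i.
by apply: filterS2 => x h1 h2 Ox; rewrite h1// h2.
Qed.

Lemma gradient_form_psd : psd_form (H10 Omega) gradient_form.
Proof.
split.
- move=> a u v w Hu Hv Hw.
  have Huv : H10 Omega (a *: u + v) by exact: H10_subspace.2.
  have gu := H10_grad Hu; have gv := H10_grad Hv; have gw := H10_grad Hw.
  have guv := H10_gradient_linear a (H10_L2 Hu) (H10_L2 Hv) gu gv.
  rewrite (gradient_formE Huv Hw guv gw) (gradient_formE Hu Hw gu gw).
  rewrite (gradient_formE Hv Hw gv gw) mulr_sumr -big_split/=.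
  apply: eq_bigr => i _.
  have r1 : rint mu Omega (fun x => kappa x * (grad Omega u i x * grad Omega w i x)).
    by apply: rint_weight; apply: L2_rint_mul => //; exact: grad_L2.
  have r2 : rint mu Omega (fun x => kappa x * (grad Omega v i x * grad Omega w i x)).
    by apply: rint_weight; apply: L2_rint_mul => //; exact: grad_L2.
  rewrite -RintegralZl// -RintegralD//; last exact: rintZ.
  by apply: eq_Rintegral => x _; rewrite /= !fctE /GRing.scale/=; ring.
- move=> u v Hu Hv; apply: eq_Rintegral => x _; congr (_ * _).
  by apply: eq_bigr => i _; rewrite mulrC.
- move=> u Hu; apply: Rintegral_ge0 => x _; rewrite mulr_ge0//.
  by apply: sumr_ge0 => i _; exact: sqr_ge0.
Qed.

(** A function that vanishes almost everywhere shares its weak gradient with the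
function zero. *)
Lemma gradient_form_null u : H10 Omega u -> dotL2 Omega u u = 0 -> gradient_form u u = 0.
Proof.
move=> Hu u0; have S0 := subspace0 H10_subspace.
have g0 : forall i, {ae mu, forall x, Omega x -> grad Omega u i x = grad Omega 0 i x}.
  apply: (gradient_unique (H10_L2 Hu) (H10_L2 S0) (H10_grad Hu) (H10_grad S0)).
  move=> phi Lphi; rewrite (psd0l sL2 fL2)//.
  exact: (psd_null sL2 fL2 (H10_L2 Hu)).
have : gradient_form 0 u = 0 by apply: (psd0l H10_subspace gradient_form_psd).
move=> <-; rewrite (gradient_formE Hu Hu (H10_grad Hu) (H10_grad Hu)).
rewrite (gradient_formE S0 Hu (H10_grad S0) (H10_grad Hu)).
have LO i := grad_L2 i S0; have Lu i := grad_L2 i Hu.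
apply: eq_bigr => i _; apply: (ae_eq_Rintegral mO).
- by apply: rint_measurable; apply: rint_weight; exact: L2_rint_mul.
- by apply: rint_measurable; apply: rint_weight; exact: L2_rint_mul.
- by apply: filterS (g0 i) => x h Ox; rewrite h.
Qed.

End gradient_forms.

End H10_space.

(** * The form of the wave operator and the Newton potential *)

Section wave_speed.
Variables (R : realType) (d : nat) (Omega : set 'rV[R]_d).
Hypotheses (oO : open Omega) (bO : bounded_set Omega).
Variables (c : 'rV[R]_d -> R) (c0 C_Omega : R).
Let mu := lebesgue_rV R d.
Hypotheses (hc : Linfty Omega c) (c0_gt0 : 0 < c0)
  (c_ge : {ae mu, forall x, Omega x -> c0 <= c x})
  (C_gt0 : 0 < C_Omega) (hC : poincare_constant Omega C_Omega).
Implicit Types (u v w : 'rV[R]_d -> R) (G H : 'I_d -> 'rV[R]_d -> R).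

Let mO : measurable Omega. Proof. exact: mOmega. Qed.
Let sL2 : subspace (L2 mu Omega). Proof. exact: L2_subspace. Qed.
Let fL2 : psd_form (L2 mu Omega) (dotL2 Omega). Proof. exact: dotL2_form. Qed.
Let sH : subspace (H10 Omega). Proof. exact: H10_subspace. Qed.

Lemma c_measurable : measurable_fun Omega c.
Proof.
have hL : c \_ Omega \in Lfun mu +oo%E by exact: hc.
move: hL; rewrite inE => /andP[/[!inE]/= mc _].
exact/(measurable_restrictT c mO).
Qed.

Lemma c_bounded : exists M : R, 0 < M /\ {ae mu, forall x, Omega x -> c x ^+ 2 <= M}.
Proof.
have hL : c \_ Omega \in Lfun mu +oo%E by exact: hc.
move: hL; rewrite inE => /andP[/[!inE]/= mc].
rewrite /finite_norm unlock /Lnorm.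
case: ifPn => [mu0 Moo|]; last first.
  (* On a space of measure zero the L^oo norm is zero by convention, and any bound
  holds almost everywhere. *)
  rewrite -leNgt => muT _; exists 1; split => //.
  have muT0 : mu setT = 0%E by apply/eqP; rewrite eq_le muT measure_ge0.
  by exists setT; split.
have := ess_sup_ge mu (abse \o (EFin \o (c \_ Omega))).
move: Moo; set s := ess_sup _ _ => soo hs.
exists ((fine s) ^+ 2 + 1); split; first by have := sqr_ge0 (fine s); lra.
apply: filterS hs => x; rewrite /= patchE => h Ox; rewrite mem_set// in h.
have sfin : s \is a fin_num.
  by rewrite ge0_fin_numE//; apply: le_trans h.
rewrite -(fineK sfin) lee_fin in h.
have : c x ^+ 2 <= fine s ^+ 2.
  by rewrite -[leLHS]real_normK ?num_real// ler_pXn2r// ?nnegrE// (le_trans _ h).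
by lra.
Qed.

Let m1 : measurable_fun Omega (fun _ : 'rV[R]_d => 1 : R).
Proof. exact: measurable_cst. Qed.
Let k10 (x : 'rV[R]_d) : 0 <= (fun=> 1 : R) x. Proof. exact: ler01. Qed.
Let k1M : {ae mu, forall x, Omega x -> (fun=> 1 : R) x <= 1}.
Proof. by apply: aeW => x _. Qed.
Let mc2 : measurable_fun Omega (fun x => c x ^+ 2).
Proof. by apply: measurable_funX; exact: c_measurable. Qed.
Let c20 (x : 'rV[R]_d) : 0 <= c x ^+ 2. Proof. exact: sqr_ge0. Qed.

Lemma dotgrad_integralE u v : \int[mu]_(x in Omega) dotgrad Omega u v x =
  gradient_form Omega (fun=> 1) u v.
Proof. by apply: eq_Rintegral => x _; rewrite mul1r. Qed.

Lemma c2grad_form : psd_form (H10 Omega) (c2grad Omega c).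
Proof. by have [M [_ cM]] := c_bounded; exact: gradient_form_psd mc2 c20 cM. Qed.

Lemma dirichlet_form : psd_form (H10 Omega) (gradient_form Omega (fun=> 1)).
Proof. exact: gradient_form_psd m1 k10 k1M. Qed.

Lemma H10_dotE u v : hdot (H10_space Omega) u v =
  dotL2 Omega u v + gradient_form Omega (fun=> 1) u v.
Proof. by rewrite -dotgrad_integralE. Qed.

Lemma H10_form : psd_form (H10 Omega) (hdot (H10_space Omega)).
Proof.
have -> : hdot (H10_space Omega) =
    (fun u v => dotL2 Omega u v + gradient_form Omega (fun=> 1) u v).
  by apply/funext => u; apply/funext => v; exact: H10_dotE.
apply: psd_form_add dirichlet_form; apply: psd_form_sub fL2.
exact: H10_L2.
Qed.

Lemma rint_weighted_dotgrad (kappa : 'rV[R]_d -> R) (M : R) u v :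
  measurable_fun Omega kappa -> (forall x, 0 <= kappa x) ->
  {ae mu, forall x, Omega x -> kappa x <= M} ->
  H10 Omega u -> H10 Omega v ->
  rint mu Omega (fun x => kappa x * dotgrad Omega u v x).
Proof.
move=> mk k0 kM Hu Hv; apply: (rint_weight oO mk k0 kM).
apply: rint_sum => // i; apply: L2_rint_mul => //; exact: grad_L2.
Qed.

Lemma c2grad_ge v : H10 Omega v ->
  c0 ^+ 2 * gradient_form Omega (fun=> 1) v v <= c2grad Omega c v v.
Proof.
move=> Hv; have [M [_ cM]] := c_bounded.
have r1 := rint_weighted_dotgrad m1 k10 k1M Hv Hv.
rewrite /gradient_form -RintegralZl//.
apply: (ae_le_Rintegral mO); [exact: rintZ|exact: (rint_weighted_dotgrad mc2 c20 cM Hv Hv)|].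
apply: filterS c_ge => x h Ox; rewrite mul1r ler_wpM2r//.
  by apply: sumr_ge0 => i _; exact: sqr_ge0.
by rewrite ler_pXn2r ?nnegrE ?h ?ltW// (lt_le_trans c0_gt0)// h.
Qed.

Lemma c2grad_le : exists M : R, 0 < M /\ forall v, H10 Omega v ->
  c2grad Omega c v v <= M * gradient_form Omega (fun=> 1) v v.
Proof.
have [M [M0 cM]] := c_bounded; exists M; split => // v Hv.
have r1 := rint_weighted_dotgrad m1 k10 k1M Hv Hv.
rewrite /gradient_form -RintegralZl//.
apply: (ae_le_Rintegral mO); [exact: (rint_weighted_dotgrad mc2 c20 cM Hv Hv)|exact: rintZ|].
apply: filterS cM => x h Ox; rewrite mul1r ler_wpM2r ?h//.
by apply: sumr_ge0 => i _; exact: sqr_ge0.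
Qed.

Lemma poincare_dirichlet v : H10 Omega v ->
  dotL2 Omega v v <= C_Omega ^+ 2 * gradient_form Omega (fun=> 1) v v.
Proof.
move=> Hv; have := hC Hv; rewrite dotgrad_integralE => h.
have g0 := psd_ge0 dirichlet_form Hv.
have d0 := psd_ge0 fL2 (H10_L2 Hv).
rewrite -(sqr_sqrtr d0) -(sqr_sqrtr g0) -exprMn.
by rewrite ler_pXn2r// ?nnegrE ?sqrtr_ge0// mulr_ge0 ?sqrtr_ge0// ltW.
Qed.

Lemma poincare_c2grad v : H10 Omega v ->
  dotL2 Omega v v <= C_Omega ^+ 2 / c0 ^+ 2 * c2grad Omega c v v.
Proof.
move=> Hv; apply: le_trans (poincare_dirichlet Hv) _.
have c2 : 0 < c0 ^+ 2 by rewrite exprn_gt0.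
rewrite -mulrA ler_wpM2l ?sqr_ge0// mulrC ler_pdivlMr// mulrC.
exact: c2grad_ge.
Qed.

(** With [c2grad_le_H10]: the form of the wave operator is equivalent to the
inner product of H^1_0, by the inequality of Poincare and the bounds on [c]. *)
Lemma H10_norm_le : exists A : R, 0 <= A /\ forall v, H10 Omega v ->
  hdot (H10_space Omega) v v <= A * c2grad Omega c v v.
Proof.
have c2 : 0 < c0 ^+ 2 by rewrite exprn_gt0.
exists (C_Omega ^+ 2 / c0 ^+ 2 + (c0 ^+ 2)^-1); split.
  by rewrite addr_ge0 ?invr_ge0 ?divr_ge0 ?sqr_ge0.
move=> v Hv; rewrite H10_dotE mulrDl lerD//; first exact: poincare_c2grad.
by rewrite mulrC ler_pdivlMr// mulrC; exact: c2grad_ge.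
Qed.

Lemma c2grad_le_H10 : exists M : R, 0 <= M /\ forall v, H10 Omega v ->
  c2grad Omega c v v <= M * hdot (H10_space Omega) v v.
Proof.
have [M [M0 h]] := c2grad_le; exists M; split; first exact: ltW.
move=> v Hv; apply: le_trans (h v Hv) _; rewrite ler_pM2l// H10_dotE lerDr.
by apply: (psd_ge0 fL2); exact: H10_L2.
Qed.

Lemma dotL2_le_H10 v : H10 Omega v -> dotL2 Omega v v <= hdot (H10_space Omega) v v.
Proof. by move=> Hv; rewrite H10_dotE lerDl (psd_ge0 dirichlet_form). Qed.

Lemma converges_perturb (x y : nat -> 'rV[R]_d -> R) u :
  (forall n, L2 mu Omega (x n)) -> (forall n, L2 mu Omega (y n)) -> L2 mu Omega u ->
  converges (dotL2 Omega) x u ->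
  (forall n, dotL2 Omega (y n - x n) (y n - x n) <= n.+1%:R^-1) ->
  converges (dotL2 Omega) y u.
Proof.
move=> Lx Ly Lu xu yx e e0.
have [N1 hN1] := xu (e / 4) ltac:(by rewrite divr_gt0).
have [N2] := ltr_add_invr (y := 0) (x := e / 4) ltac:(by rewrite divr_gt0).
rewrite add0r => hN2; exists (maxn N1 N2) => n; rewrite geq_max => /andP[n1 n2].
have -> : y n - u = (y n - x n) + (x n - u) by rewrite addrA subrK.
apply: le_trans (psd_sqrD sL2 fL2 _ _) _; [exact: subspaceB|exact: subspaceB|].
have h1 := hN1 n n1.
have h2 : dotL2 Omega (y n - x n) (y n - x n) <= e / 4.
  apply: le_trans (yx n) _; apply: le_trans (ltW hN2).
  by rewrite lef_pV2 ?posrE// ler_nat.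
by lra.
Qed.

(** The limits of the functions and of their gradients in L^2, given by the
Riesz-Fischer theorem, form a function of H^1_0 and its gradient. *)
Lemma H10_complete (v : nat -> 'rV[R]_d -> R) : (forall n, H10 Omega (v n)) ->
  (forall e, 0 < e -> exists N, forall n m, (N <= n)%N -> (N <= m)%N ->
     c2grad Omega c (v n - v m) (v n - v m) <= e) ->
  exists u, H10 Omega u /\ converges (c2grad Omega c) v u.
Proof.
move=> Hv cv.
have c2 : 0 < c0 ^+ 2 by rewrite exprn_gt0.
pose g n i := grad Omega (v n) i.
have Lg n i : L2 mu Omega (g n i) by exact: grad_L2.
have Lv n : L2 mu Omega (v n) by exact: H10_L2.
have gd n u G : L2 mu Omega u -> H10_gradient Omega u G ->
    H10_gradient Omega (v n - u) (fun i => g n i - G i).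
  move=> Lu hG; have := H10_gradient_linear oO (-1) Lu (Lv n) hG (H10_grad (Hv n)).
  have -> : -1 *: u + v n = v n - u by rewrite scaleN1r addrC.
  have -> // : (fun i => -1 *: G i + g n i) = (fun i => g n i - G i).
  by apply/funext => i; rewrite scaleN1r addrC.
have formE n u G (Hu : H10 Omega u) (hG : H10_gradient Omega u G) :
    gradient_form Omega (fun=> 1) (v n - u) (v n - u) =
    \sum_i dotL2 Omega (g n i - G i) (g n i - G i).
  have Hd := subspaceB sH (Hv n) Hu; have gG := gd n u G (H10_L2 Hu) hG.
  rewrite (gradient_formE oO bO m1 k10 k1M Hd Hd gG gG).
  by apply: eq_bigr => i _; apply: eq_Rintegral => x _; rewrite mul1r.
have [u [Lu vu]] : exists u, L2 mu Omega u /\ converges (dotL2 Omega) v u.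
  apply: riesz_fischer => // e e0.
  have k0 : 0 < C_Omega ^+ 2 / c0 ^+ 2 by rewrite divr_gt0// exprn_gt0.
  have [N hN] := cv (e / (C_Omega ^+ 2 / c0 ^+ 2)) ltac:(by rewrite divr_gt0).
  exists N => n m Nn Nm; apply: le_trans (poincare_c2grad _) _; first exact: subspaceB.
  by rewrite mulrC -ler_pdivlMr//; exact: hN.
have /choice[G hG] : forall i : 'I_d, exists Gi : 'rV[R]_d -> R, L2 mu Omega Gi /\
    converges (dotL2 Omega) (fun n => g n i) Gi.
  move=> i; apply: riesz_fischer => // e e0.
  have [N hN] := cv (e * c0 ^+ 2) ltac:(by rewrite mulr_gt0).
  exists N => n m Nn Nm.
  have h : gradient_form Omega (fun=> 1) (v n - v m) (v n - v m) <= e.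
    have := le_trans (c2grad_ge (subspaceB sH (Hv n) (Hv m))) (hN n m Nn Nm).
    by rewrite mulrC ler_pM2r.
  apply: le_trans h; rewrite (formE n (v m) (g m) (Hv m) (H10_grad (Hv m))).
  rewrite (bigD1 i)//= lerDl; apply: sumr_ge0 => j _.
  by apply: (psd_ge0 fL2); exact: subspaceB.
have LG i : L2 mu Omega (G i) by have [] := hG i.
have gG i : converges (dotL2 Omega) (fun n => g n i) (G i) by have [] := hG i.
have uG : H10_gradient Omega u G.
  split => //.
    move=> i phi tphi; have L0 := test_L2 oO tphi.
    have L1 := test_pderiv_L2 oO i tphi.
    have c1 := converges_form sL2 fL2 Lv Lu L1 vu.
    have c3 := converges_form sL2 fL2 (fun n => Lg n i) (LG i) L0 (gG i).
    have c4 : - dotL2 Omega (g n i) phi @[n --> \oo] --> - dotL2 Omega (G i) phi.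
      exact: cvgN.
    apply: (cvg_unique _ _ c4) => //; apply: cvg_trans c1; apply: near_eq_cvg.
    apply: nearW => n /=; have [_ wg _] := H10_grad (Hv n).
    by rewrite wg.
  (* Diagonal choice of test functions: the [n]-th one is close to [v n]. *)
  have /choice[phi hphi] : forall n : nat, exists phi : 'rV[R]_d -> R, [/\ test_function Omega phi,
      dotL2 Omega (phi - v n) (phi - v n) <= n.+1%:R^-1 &
      forall i, dotL2 Omega (pderiv i phi - g n i) (pderiv i phi - g n i) <= n.+1%:R^-1].
    move=> n; have n0 : 0 < n.+1%:R^-1 :> R by rewrite invr_gt0.
    have [_ _ [phi [tphi phiv phig]]] := H10_grad (Hv n).
    have Lphi m : L2 mu Omega (phi m) by exact: test_L2.
    have Ldphi i m : L2 mu Omega (pderiv i (phi m)) by exact: test_pderiv_L2.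
    move/(cvgL2P oO Lphi (Lv n)) : phiv => /(_ _ n0)[N hN].
    have /choice[K hK] : forall i, exists K, forall m, (K <= m)%N ->
        dotL2 Omega (pderiv i (phi m) - g n i) (pderiv i (phi m) - g n i) <= n.+1%:R^-1.
      by move=> i; move/(cvgL2P oO (Ldphi i) (Lg n i)) : (phig i) => /(_ _ n0).
    exists (phi (N + \sum_i K i)%N); split => //; first by apply: hN; exact: leq_addr.
    by move=> i; apply: hK; rewrite (bigD1 i)//= addnCA leq_addr.
  have tphi n : test_function Omega (phi n) by case: (hphi n).
  have Lphi n : L2 mu Omega (phi n) by exact: test_L2.
  have Ldphi i n : L2 mu Omega (pderiv i (phi n)) by exact: test_pderiv_L2.
  exists phi; split => //.
    apply/(cvgL2P oO Lphi Lu); apply: converges_perturb vu _ => // n.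
    by case: (hphi n).
  move=> i; apply/(cvgL2P oO (Ldphi i) (LG i)).
  by apply: (converges_perturb (fun n => Lg n i)) (gG i) _ => // n; case: (hphi n).
have Hu : H10 Omega u by split => //; exists G.
exists u; split => // e e0.
have [M [M0 hM]] := c2grad_le.
have ep : 0 < e / M / d.+1%:R by rewrite !divr_gt0.
have /choice[K hK] : forall i, exists K, forall n, (K <= n)%N ->
    dotL2 Omega (g n i - G i) (g n i - G i) <= e / M / d.+1%:R.
  by move=> i; exact: gG.
exists (\sum_i K i)%N => n Kn.
apply: le_trans (hM _ (subspaceB sH (Hv n) Hu)) _.
rewrite (formE n u G Hu uG) mulrC -ler_pdivlMr//.
apply: (@le_trans _ _ (\sum_(i < d) e / M / d.+1%:R)).
  apply: ler_sum => i _; apply: hK; apply: leq_trans Kn.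
  by rewrite (bigD1 i)//= leq_addr.
rewrite sumr_const card_ord -[leLHS]mulr_natr mulrAC.
by rewrite ler_pdivrMr// ler_wpM2l ?ler_nat// divr_ge0// ltW.
Qed.

(** The inequality of Poincare makes the functional [dotL2 Omega w] bounded for
the form of the wave operator, so the Riesz representation provides the potential
that [newton] chooses. *)
Lemma newton_spec w : L2 mu Omega w ->
  H10 Omega (newton Omega c (L2_to_dual Omega w)) /\
  forall v, H10 Omega v ->
    c2grad Omega c (newton Omega c (L2_to_dual Omega w)) v = dotL2 Omega w v.
Proof.
move=> Lw.
have [|||u Hu uw] := @riesz_representation R _ (H10 Omega) (c2grad Omega c) sH c2grad_form
  (dotL2 Omega w) (Num.sqrt (dotL2 Omega w w) * (C_Omega / c0)).
- move=> a u v Hu Hv; have Lu := H10_L2 Hu; have Lv := H10_L2 Hv.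
  by rewrite (psdDr sL2 fL2) ?(psdZr sL2 fL2)//; exact: subspaceZ.
- move=> v Hv; have Lv := H10_L2 Hv.
  apply: le_trans (psd_cauchy_schwarz_sqrt sL2 fL2 Lw Lv) _.
  rewrite -mulrA ler_wpM2l ?sqrtr_ge0//.
  have h := ler_wsqrtr (poincare_c2grad Hv).
  apply: le_trans h _; rewrite sqrtrM ?divr_ge0 ?sqr_ge0//.
  by rewrite -expr_div_n sqrtr_sqr ger0_norm// divr_ge0// ltW.
- exact: H10_complete.
have := @xgetI _ (fun=> 0) [set z | H10 Omega z /\
  forall v, H10 Omega v -> c2grad Omega c z v = L2_to_dual Omega w v] u (conj Hu uw).
by case.
Qed.

Lemma c2grad_null v : H10 Omega v -> dotL2 Omega v v = 0 -> c2grad Omega c v v = 0.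
Proof.
by have [M [_ cM]] := c_bounded; exact: gradient_form_null oO bO _ _ mc2 c20 cM v.
Qed.

Lemma sum_cgradE u : \int[mu]_(x in Omega) \sum_i (c x * grad Omega u i x) ^+ 2 =
  c2grad Omega c u u.
Proof.
apply: eq_Rintegral => x _; rewrite /dotgrad mulr_sumr.
by apply: eq_bigr => i _; rewrite exprMn -expr2.
Qed.

End wave_speed.

(** * Square-integrable functions with values in a Hilbert space *)

Section null_sequences.
Variable R : realType.

Lemma cvg0_le (f g : nat -> R) : (forall n, 0 <= f n <= g n) ->
  g @ \oo --> (0 : R) -> f @ \oo --> (0 : R).
Proof.
move=> fg g0; apply: (squeeze_cvgr _ (@cvg_cst _ (0 : R) _ _ _) g0).
exact: nearW.
Qed.

Lemma cvg_dist_le (f g : nat -> R) (l : R) : (forall n, `|f n - l| <= g n) ->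
  g @ \oo --> (0 : R) -> f @ \oo --> l.
Proof.
move=> fg g0; apply/subr_cvg0; apply/norm_cvg0P; apply: cvg0_le g0 => n.
by rewrite normr_ge0/=.
Qed.

Lemma cvg0Ml (k : R) (f : nat -> R) : f @ \oo --> (0 : R) ->
  k * f n @[n --> \oo] --> (0 : R).
Proof.
move=> f0; have -> : nbhs (0 : R) = nbhs (k * 0 : R) by rewrite mulr0.
by apply: cvgM => //; exact: cvg_cst.
Qed.

Lemma cvg0D (f g : nat -> R) : f @ \oo --> (0 : R) -> g @ \oo --> (0 : R) ->
  f n + g n @[n --> \oo] --> (0 : R).
Proof.
move=> f0 g0; have -> : nbhs (0 : R) = nbhs (0 + 0 : R) by rewrite addr0.
exact: cvgD.
Qed.

End null_sequences.

Section bochner.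
Variables (R : realType) (E : lmodType R) (X : hilbert_data E).
Hypotheses (hX : subspace (hset X)) (fX : psd_form (hset X) (hdot X)).
Implicit Types (u v : R -> E) (s r : simple_data X) (x y w : E).
Let leb := @lebesgue_measure R.

Lemma hnorm_ge0 x : 0 <= hnorm X x. Proof. exact: sqrtr_ge0. Qed.

Lemma hnorm_sqr x : hset X x -> hnorm X x ^+ 2 = hdot X x x.
Proof. by move=> Sx; rewrite sqr_sqrtr// (psd_ge0 fX). Qed.

Lemma hnormD x y : hset X x -> hset X y -> hnorm X (x + y) <= hnorm X x + hnorm X y.
Proof. exact: psd_triangle. Qed.

Lemma hnorm_distC x y : hset X x -> hset X y -> hnorm X (x - y) = hnorm X (y - x).
Proof.
move=> Sx Sy; have Sd := subspaceB hX Sx Sy; congr Num.sqrt.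
have -> : y - x = (-1) *: (x - y) by rewrite scaleN1r opprB.
rewrite (psdZl hX fX)//; last exact: subspaceZ.
by rewrite (psdZr hX fX)// !mulN1r opprK.
Qed.

Lemma hnormB x y : hset X x -> hset X y -> hnorm X (x - y) <= hnorm X x + hnorm X y.
Proof.
move=> Sx Sy; have S0 := subspace0 hX.
have -> : x - y = x + (0 - y) by rewrite sub0r.
apply: le_trans (hnormD Sx (subspaceB hX S0 Sy)) _.
by rewrite hnorm_distC// subr0.
Qed.

Lemma simple_fun_in s t : hset X (simple_fun s t).
Proof.
by apply: subspace_sum => // i; apply: subspaceZ => //; exact: simple_in.
Qed.

Lemma simple_integral_in D s : hset X (simple_integral D s).
Proof.
by apply: subspace_sum => // i; apply: subspaceZ => //; exact: simple_in.
Qed.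

Definition simple_lin (a : R) s r : simple_data X :=
  @SimpleData R E X (simple_size s + simple_size r)
    (fun k => match fintype.split k with inl i => simple_set i | inr j => simple_set j end)
    (fun k => match fintype.split k with
      | inl i => a *: simple_val i | inr j => simple_val j end)
    (fun k => match fintype.split k as z return measurable
        (match z with inl i => simple_set i | inr j => simple_set j end) with
      | inl i => simple_measurable i | inr j => simple_measurable j end)
    (fun k => match fintype.split k as z return hset X
        (match z with inl i => a *: simple_val i | inr j => simple_val j end) with
      | inl i => subspaceZ hX a (simple_in i) | inr j => simple_in j end).

Lemma simple_linE a s r t :
  simple_fun (simple_lin a s r) t = a *: simple_fun s t + simple_fun r t.
Proof.
rewrite /simple_fun big_split_ord/= scaler_sumr; congr (_ + _).
  apply: eq_bigr => i _; case: splitP => [j /= /ord_inj <-|k /= ik].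
    by rewrite !scalerA mulrC.
  by have := ltn_ord i; rewrite ik ltnNge leq_addr.
apply: eq_bigr => j _; case: splitP => [i /= ij|k /= /addnI/ord_inj <- //].
by have := ltn_ord i; rewrite -ij ltnNge leq_addr.
Qed.

Definition simple_restr (A : set (measurableTypeR R)) (mA : measurable A) s :
    simple_data X :=
  @SimpleData R E X (simple_size s)
    (fun i => A `&` simple_set i) (@simple_val _ _ _ s)
    (fun i => measurableI _ _ mA (simple_measurable i)) (@simple_in _ _ _ s).

Lemma simple_restrE A (mA : measurable A) s t :
  simple_fun (simple_restr mA s) t = \1_A t *: simple_fun s t.
Proof.
rewrite /simple_fun /= scaler_sumr; apply: eq_bigr => i _.
by rewrite scalerA !indicE in_setI -natrM mulnb.
Qed.

Variable D : set R.
Hypothesis mD : measurable (D : set (measurableTypeR R)).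

Lemma strongly_measurable_simple s : strongly_measurable X D (simple_fun s).
Proof.
exists (fun=> s) => t _; rewrite subrr /hnorm (psd0l hX fX) ?sqrtr0; last exact: subspace0 hX.
exact: cvg_cst.
Qed.

Lemma strongly_measurable_lin a u v :
  (forall t, D t -> hset X (u t)) -> (forall t, D t -> hset X (v t)) ->
  strongly_measurable X D u -> strongly_measurable X D v ->
  strongly_measurable X D (fun t => a *: u t + v t).
Proof.
move=> Su Sv [s su] [r rv]; exists (fun n => simple_lin a (s n) (r n)) => t Dt.
have Hu n := subspaceB hX (Su t Dt) (simple_fun_in (s n) t).
have Hv n := subspaceB hX (Sv t Dt) (simple_fun_in (r n) t).
apply: cvg0_le (cvg0D (cvg0Ml `|a| (su t Dt)) (rv t Dt)) => n.
rewrite hnorm_ge0/= simple_linE.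
have -> : a *: u t + v t - (a *: simple_fun (s n) t + simple_fun (r n) t) =
    a *: (u t - simple_fun (s n) t) + (v t - simple_fun (r n) t).
  by rewrite scalerBr opprD addrACA.
apply: le_trans (hnormD _ _) _ => //; first exact: subspaceZ.
rewrite lerD2r /hnorm (psdZl hX fX)//; last exact: subspaceZ.
by rewrite (psdZr hX fX)// mulrA -expr2 sqrtrM ?sqr_ge0// sqrtr_sqr.
Qed.

Section bounded_form.
Variables (b : E -> E -> R) (M : R).
Hypotheses (fb : psd_form (hset X) b) (M0 : 0 <= M)
  (bM : forall x, hset X x -> b x x <= M * hdot X x x).

Lemma bounded_form_le x y : hset X x -> hset X y ->
  `|b x y| <= M * (hnorm X x * hnorm X y).
Proof.
move=> Sx Sy; apply: le_trans (psd_cauchy_schwarz_sqrt hX fb Sx Sy) _.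
have q z : hset X z -> Num.sqrt (b z z) <= Num.sqrt M * hnorm X z.
  by move=> Sz; rewrite /hnorm -sqrtrM// ler_wsqrtr// bM.
apply: le_trans (ler_pM (sqrtr_ge0 _) (sqrtr_ge0 _) (q x Sx) (q y Sy)) _.
by rewrite mulrACA -expr2 sqr_sqrtr.
Qed.

Lemma bounded_form_cvg (x_ y_ : nat -> E) x y :
  (forall n, hset X (x_ n)) -> (forall n, hset X (y_ n)) -> hset X x -> hset X y ->
  hnorm X (x - x_ n) @[n --> \oo] --> (0 : R) ->
  hnorm X (y - y_ n) @[n --> \oo] --> (0 : R) ->
  b (x_ n) (y_ n) @[n --> \oo] --> b x y.
Proof.
move=> Sx_ Sy_ Sx Sy cx cy.
have Hx n := subspaceB hX Sx (Sx_ n); have Hy n := subspaceB hX Sy (Sy_ n).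
pose p n := hnorm X (x - x_ n); pose q n := hnorm X (y - y_ n).
apply: (@cvg_dist_le _ _ (fun n => M * hnorm X y * p n + M * hnorm X x * q n + M * (p n * q n))).
  move=> n; rewrite distrC.
  have -> : b x y - b (x_ n) (y_ n) = b (x - x_ n) y + b x (y - y_ n) - b (x - x_ n) (y - y_ n).
    by rewrite !(psdBl fb)// !(psdBr hX fb)//; ring.
  have h1 := bounded_form_le (Hx n) Sy; have h2 := bounded_form_le Sx (Hy n).
  have h3 := bounded_form_le (Hx n) (Hy n).
  apply: le_trans (ler_normB _ _) _; apply: lerD.
    apply: le_trans (ler_normD _ _) _; apply: lerD.
      by apply: le_trans h1 _; rewrite /p -mulrA [hnorm X y * _]mulrC.
    by apply: le_trans h2 _; rewrite mulrA.
  by [].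
apply: cvg0D; first by apply: cvg0D; exact: cvg0Ml.
apply: cvg0Ml; have -> : nbhs (0 : R) = nbhs (0 * 0 : R) by rewrite mulr0.
exact: cvgM.
Qed.

Lemma measurable_simple_form s r :
  measurable_fun D (fun t => b (simple_fun s t) (simple_fun r t)).
Proof.
rewrite (_ : (fun t => _) = fun t => \sum_(i < simple_size s) \sum_(j < simple_size r)
    (\1_(simple_set i) t * \1_(simple_set j) t * b (simple_val i) (simple_val j))).
  apply: measurable_sum => i; apply: measurable_sum => j.
  apply: measurable_funM; last exact: measurable_cst.
  by apply: measurable_funM; apply: measurable_indic; exact: simple_measurable.
apply/funext => t; rewrite /simple_fun (psd_suml hX fb); last 2 first.
- by move=> i; apply: subspaceZ => //; exact: simple_in.
- exact: simple_fun_in.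
apply: eq_bigr => i _; have Si := simple_in i.
rewrite (psd_sumr hX fb); last 2 first.
- by move=> j; apply: subspaceZ => //; exact: simple_in.
- exact: subspaceZ.
apply: eq_bigr => j _; have Sj := simple_in j.
rewrite (psdZl hX fb)//; last exact: subspaceZ.
by rewrite (psdZr hX fb)// mulrA.
Qed.

(** Pointwise limit of the forms of simple functions. *)
Lemma measurable_form u v :
  (forall t, D t -> hset X (u t)) -> (forall t, D t -> hset X (v t)) ->
  strongly_measurable X D u -> strongly_measurable X D v ->
  measurable_fun D (fun t => b (u t) (v t)).
Proof.
move=> Su Sv [s su] [r rv].
apply: (measurable_fun_cvg (h := fun n t => b (simple_fun (s n) t) (simple_fun (r n) t))).
  by move=> n; exact: measurable_simple_form.
move=> t Dt; apply: bounded_form_cvg; try by [exact: Su|exact: Sv|exact: su|exact: rv].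
- by move=> n; exact: simple_fun_in.
- by move=> n; exact: simple_fun_in.
Qed.

End bounded_form.

Let hdot1 x : hset X x -> hdot X x x <= 1 * hdot X x x. Proof. by rewrite mul1r. Qed.

Lemma measurable_hdot u v :
  (forall t, D t -> hset X (u t)) -> (forall t, D t -> hset X (v t)) ->
  strongly_measurable X D u -> strongly_measurable X D v ->
  measurable_fun D (fun t => hdot X (u t) (v t)).
Proof. exact: measurable_form fX ler01 hdot1 u v. Qed.

Lemma measurable_hnorm u : (forall t, D t -> hset X (u t)) ->
  strongly_measurable X D u -> measurable_fun D (fun t => hnorm X (u t)).
Proof.
move=> Su mu; apply: (measurable_comp (F := setT)) => //.
  by apply: continuous_measurable_fun; exact: sqrt_continuous.
exact: measurable_hdot.
Qed.

Lemma L2B_in u t : L2B X D u -> D t -> hset X (u t). Proof. by case=> h _ _; exact: h. Qed.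

Lemma L2B_measurable u : L2B X D u -> strongly_measurable X D u. Proof. by case. Qed.

Lemma L2B_rint u : L2B X D u -> rint leb D (fun t => hdot X (u t) (u t)).
Proof.
move=> [Su mu uoo]; apply: rint_lty => //.
- exact: measurable_hdot.
- by move=> t Dt; apply: (psd_ge0 fX); exact: Su.
- apply: le_lt_trans uoo; rewrite le_eqVlt; apply/orP; left; apply/eqP.
  by apply: eq_integral => t /set_mem Dt; rewrite hnorm_sqr//; exact: Su.
Qed.

Lemma L2BP u : (forall t, D t -> hset X (u t)) -> strongly_measurable X D u ->
  rint leb D (fun t => hdot X (u t) (u t)) -> L2B X D u.
Proof.
move=> Su mu /integrableP[_ uoo]; split => //.
apply: le_lt_trans uoo; rewrite le_eqVlt; apply/orP; left; apply/eqP.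
apply: eq_integral => t /set_mem Dt; rewrite hnorm_sqr//=; last exact: Su.
by rewrite ger0_norm// (psd_ge0 fX)//; exact: Su.
Qed.

Lemma L2B_lin a u v : L2B X D u -> L2B X D v -> L2B X D (fun t => a *: u t + v t).
Proof.
move=> Lu Lv; have iu := L2B_rint Lu; have iv := L2B_rint Lv.
move: Lu Lv => [Su mu _] [Sv mv _].
have S t : D t -> hset X (a *: u t + v t).
  by move=> Dt; apply: subspaceD => //; [apply: subspaceZ => //; exact: Su|exact: Sv].
have m : strongly_measurable X D (fun t => a *: u t + v t) by exact: strongly_measurable_lin.
apply: L2BP => //.
apply: (rint_le mD (g := fun t => 2 * a ^+ 2 * hdot X (u t) (u t) + 2 * hdot X (v t) (v t))).
- exact: measurable_hdot.
- by apply: rintD => //; exact: rintZ.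
- move=> t Dt; have Sau := subspaceZ hX a (Su t Dt).
  rewrite ger0_norm ?(psd_ge0 fX)//; last exact: S.
  apply: le_trans (psd_sqrD hX fX Sau (Sv t Dt)) _.
  by rewrite (psdZl hX fX) ?(psdZr hX fX)//; [rewrite expr2 !mulrA|exact: Su..].
Qed.

Section rint_form.
Variables (b : E -> E -> R) (M : R).
Hypotheses (fb : psd_form (hset X) b) (M0 : 0 <= M)
  (bM : forall x, hset X x -> b x x <= M * hdot X x x).

Lemma rint_form u v : L2B X D u -> L2B X D v -> rint leb D (fun t => b (u t) (v t)).
Proof.
move=> Lu Lv; have iu := L2B_rint Lu; have iv := L2B_rint Lv.
move: Lu Lv => [Su mu _] [Sv mv _].
apply: (rint_le mD (g := fun t => M * (hdot X (u t) (u t) + hdot X (v t) (v t)))).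
- exact: measurable_form fb M0 bM _ _ Su Sv mu mv.
- by apply: rintZ => //; exact: rintD.
- move=> t Dt; apply: le_trans (bounded_form_le fb M0 bM (Su t Dt) (Sv t Dt)) _.
  rewrite ler_wpM2l// -(hnorm_sqr (Su t Dt)) -(hnorm_sqr (Sv t Dt)).
  have := sqr_ge0 (hnorm X (u t) - hnorm X (v t)).
  by have := sqr_ge0 (hnorm X (u t)); have := sqr_ge0 (hnorm X (v t)); rewrite !expr2; nra.
Qed.

End rint_form.

(** Cutting the simple approximations off where they exceed twice the limit
makes them dominated. *)
Lemma dominated_simple u : L2B X D u -> exists s : nat -> simple_data X,
  (forall n t, D t -> hdot X (simple_fun (s n) t) (simple_fun (s n) t) <=
     4 * hdot X (u t) (u t)) /\
  (forall t, D t -> hnorm X (u t - simple_fun (s n) t) @[n --> \oo] --> (0 : R)).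
Proof.
move=> Lu; have [Su [s su] _] := Lu; have mu := L2B_measurable Lu.
pose G n := D `&` [set t | hdot X (simple_fun (s n) t) (simple_fun (s n) t) <=
   4 * hdot X (u t) (u t)].
have mG n : measurable (G n : set (measurableTypeR R)).
  apply: measurable_fun_le => //.
    apply: measurable_hdot; try exact: strongly_measurable_simple.
      by move=> t _; exact: simple_fun_in.
    by move=> t _; exact: simple_fun_in.
  by apply: measurable_funM => //; exact: measurable_hdot.
exists (fun n => simple_restr (mG n) (s n)); split => [n t Dt|t Dt].
  rewrite simple_restrE indicE; have u0 := psd_ge0 fX (Su t Dt).
  case: (boolP (t \in G n)) => [/set_mem[_ /=]|_]; first by rewrite scale1r.
  by rewrite scale0r (psd0l hX fX) ?mulr_ge0//; exact: subspace0 hX.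
have Hu n := subspaceB hX (Su t Dt) (simple_fun_in (s n) t).
have [u0|u0] := eqVneq (hnorm X (u t)) 0.
  apply: cvg0_le (su t Dt) => n; rewrite hnorm_ge0/= simple_restrE indicE.
  case: (t \in G n); first by rewrite scale1r.
  by rewrite scale0r subr0 u0 hnorm_ge0.
apply: cvg_trans (su t Dt); apply: near_eq_cvg.
have up : 0 < hnorm X (u t) by rewrite lt_neqAle eq_sym u0 hnorm_ge0.
have /cvgrPdist_lt/(_ _ up)[N _ hN] := su t Dt.
exists N => // n /= Nn; rewrite simple_restrE indicE mem_set ?scale1r//; split => //=.
have := hN n Nn; rewrite sub0r normrN ger0_norm ?hnorm_ge0// => h.
have Ss := simple_fun_in (s n) t.
rewrite -(hnorm_sqr Ss) -(hnorm_sqr (Su t Dt)).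
have le2 : hnorm X (simple_fun (s n) t) <= 2 * hnorm X (u t).
  have := hnormB (Su t Dt) (Hu n); rewrite opprB addrC subrK.
  by move=> h'; lra.
have -> : 4 * hnorm X (u t) ^+ 2 = (2 * hnorm X (u t)) ^+ 2 by ring.
by rewrite ler_pXn2r// nnegrE ?hnorm_ge0// mulr_ge0// hnorm_ge0.
Qed.

End bochner.

(** * Bochner integrals and bounded forms *)

Section bochner_map.
Variables (R : realType) (E : lmodType R) (X Y : hilbert_data E).
Hypotheses (hX : subspace (hset X)) (fX : psd_form (hset X) (hdot X)).
Hypotheses (hY : subspace (hset Y)) (fY : psd_form (hset Y) (hdot Y)).
Variable D : set R.
Hypothesis mD : measurable (D : set (measurableTypeR R)).
Variables (N : E -> E) (K : R).
Hypothesis NY : forall x, hset X x -> hset Y (N x).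
(** [N] is only linear and bounded up to elements of zero norm, hence the
bound on the distance to combinations of images. *)
Hypothesis N_bound : forall x n (a : 'I_n -> R) (v : 'I_n -> E),
  hset X x -> (forall i, hset X (v i)) ->
  hnorm Y (N x - \sum_i a i *: N (v i)) <= K * hnorm X (x - \sum_i a i *: v i).

Definition simple_map (s : simple_data X) : simple_data Y :=
  @SimpleData R E Y (simple_size s) (@simple_set _ _ _ s) (fun i => N (simple_val i))
    (@simple_measurable _ _ _ s) (fun i => NY (@simple_in _ _ _ s i)).

Lemma L2B_map u : L2B X D u -> L2B Y D (fun t => N (u t)).
Proof.
move=> Lu; have [Su [s su] _] := Lu.
have S t : D t -> hset Y (N (u t)) by move=> Dt; apply: NY; exact: Su.
have m : strongly_measurable Y D (fun t => N (u t)).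
  exists (fun n => simple_map (s n)) => t Dt.
  apply: cvg0_le (cvg0Ml K (su t Dt)) => n.
  rewrite hnorm_ge0/=; apply: N_bound; first exact: Su.
  by move=> i; exact: simple_in.
apply: (L2BP fY) => //.
apply: (rint_le mD (g := fun t => K ^+ 2 * hdot X (u t) (u t))).
- exact: (measurable_hdot hY fY S S m m).
- by apply: rintZ => //; exact: (L2B_rint hX fX Lu).
- move=> t Dt; rewrite ger0_norm ?(psd_ge0 fY)//; last exact: S.
  have := @N_bound (u t) 0%N (fun=> 0) (fun=> 0) (Su t Dt) (fun i => subspace0 hX).
  rewrite !big_ord0 !subr0 => h.
  rewrite -(hnorm_sqr fX (Su t Dt)) -(hnorm_sqr fY (S t Dt)) -exprMn.
  by rewrite ler_pXn2r// nnegrE ?hnorm_ge0// (le_trans _ h)// hnorm_ge0.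
Qed.

End bochner_map.

Section bochner_integral.
Variables (R : realType) (E : lmodType R) (X : hilbert_data E).
Hypotheses (hX : subspace (hset X)) (fX : psd_form (hset X) (hdot X)).
Let leb := @lebesgue_measure R.
Variable D : set R.
Hypothesis mD : measurable (D : set (measurableTypeR R)).
Hypothesis Doo : (leb D < +oo)%E.
Variables (b : E -> E -> R) (M : R).
Hypotheses (fb : psd_form (hset X) b) (M0 : 0 <= M)
  (bM : forall x, hset X x -> b x x <= M * hdot X x x).
Variables (w : E) (Sw : hset X w).

Lemma ecvg0P (f : nat -> \bar R) : (forall n, 0 <= f n)%E ->
  f @ \oo --> 0%E -> forall e, 0 < e -> exists N, forall n, (N <= n)%N -> (f n <= e%:E)%E.
Proof.
move=> f0 /fine_cvgP[[N1 _ h1] /cvgr0Pnorm_le h2] e e0.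
have [N2 _ h3] := h2 e e0; exists (maxn N1 N2) => n; rewrite geq_max => /andP[n1 n2].
rewrite -(fineK (h1 n n1)) lee_fin; apply: le_trans (h3 n n2).
exact: ler_norm.
Qed.

Lemma rint_simple_form (s : simple_data X) : rint leb D (fun t => b (simple_fun s t) w).
Proof.
apply: (rint_ext mD (f := fun t => \sum_(i < simple_size s)
    b (simple_val i) w * \1_(simple_set i) t)) => //.
  move=> t _; rewrite /simple_fun (psd_suml hX fb)//; last first.
    by move=> i; apply: subspaceZ => //; exact: simple_in.
  apply: eq_bigr => i _; rewrite (psdZl hX fb)//; last exact: simple_in.
  by rewrite mulrC.
apply: rint_sum => // i; apply: rintZ => //; rewrite /rint.
apply: measurable_bounded_integrable => //.
  by apply: measurable_indic; exact: simple_measurable.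
exists 1; split; rewrite ?num_real// => r r1 t Dt /=; rewrite indicE.
by case: (_ \in _); rewrite ?normr1 ?normr0 ltW// (lt_trans ltr01).
Qed.

Lemma Rintegral_simple_form (s : simple_data X) :
  \int[leb]_(t in D) b (simple_fun s t) w = b (simple_integral D s) w.
Proof.
have Sv (i : 'I_(simple_size s)) := simple_in i.
have ii (i : 'I_(simple_size s)) : rint leb D (\1_(simple_set i) : R -> R).
  apply: measurable_bounded_integrable => //.
    by apply: measurable_indic; exact: simple_measurable.
  exists 1; split; rewrite ?num_real// => r r1 t Dt /=; rewrite indicE.
  by case: (_ \in _); rewrite ?normr1 ?normr0 ltW// (lt_trans ltr01).
rewrite /simple_integral (psd_suml hX fb)//; last by move=> i; exact: subspaceZ.
rewrite (@eq_Rintegral _ _ _ leb D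
  (fun t => \sum_(i < simple_size s) b (simple_val i) w * \1_(simple_set i) t)); last first.
  move=> t _; rewrite /simple_fun (psd_suml hX fb)//; last by move=> i; exact: subspaceZ.
  by apply: eq_bigr => i _; rewrite (psdZl hX fb)// mulrC.
rewrite Rintegral_sum//; last by move=> i; exact: rintZ.
apply: eq_bigr => i _; rewrite RintegralZl//; last exact: ii.
rewrite (psdZl hX fb)// mulrC; congr (_ * _).
by rewrite /Rintegral integral_indic//; exact: simple_measurable.
Qed.

(** Both sides are limits of the values for simple approximations, where the
identity is linearity. *)
Lemma bochner_integral_form (u : R -> E) (I : E) :
  (forall t, D t -> hset X (u t)) -> is_bochner_integral X D u I ->
  rint leb D (fun t => b (u t) w) /\ \int[leb]_(t in D) b (u t) w = b I w.
Proof.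
move=> Su [SI mu [s [su sI]]].
have mus n : strongly_measurable X D (fun t => u t - simple_fun (s n) t).
  have -> : (fun t => u t - simple_fun (s n) t) = (fun t => (-1) *: simple_fun (s n) t + u t).
    by apply/funext => t; rewrite scaleN1r addrC.
  apply: strongly_measurable_lin => //; first by move=> t _; exact: simple_fun_in.
  exact: strongly_measurable_simple.
have Sus n t : D t -> hset X (u t - simple_fun (s n) t).
  by move=> Dt; apply: subspaceB => //; [exact: Su|exact: simple_fun_in].
pose d n t := hnorm X (u t - simple_fun (s n) t).
have md n : measurable_fun D (d n) by exact: (measurable_hnorm hX fX (Sus n) (mus n)).
have d0 n t : 0 <= d n t by exact: hnorm_ge0.
have i0 n : (0 <= \int[leb]_(t in D) (d n t)%:E)%E.
  by apply: integral_ge0 => t _; rewrite lee_fin.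
have small := ecvg0P i0 su.
have [N hN] := small 1 ltr01.
have di n : (N <= n)%N -> rint leb D (d n).
  move=> Nn; have noo := le_lt_trans (hN n Nn) (ltry 1).
  by apply: rint_lty; [exact: md|move=> *; exact: d0|exact: noo].
have mb : measurable_fun D (fun t => b (u t) w).
  apply: (measurable_form hX fb M0 bM Su (fun _ _ => Sw) mu).
  exists (fun=> @SimpleData R E X 1 (fun=> setT) (fun=> w) (fun=> measurableT) (fun=> Sw)) => t _.
  rewrite /simple_fun big_ord_recl big_ord0 addr0 indicT scale1r subrr /hnorm.
  rewrite (psd0l hX fX) ?sqrtr0; last exact: subspace0 hX.
  exact: cvg_cst.
have bd n t : D t -> `|b (u t) w - b (simple_fun (s n) t) w| <= M * hnorm X w * d n t.
  move=> Dt; rewrite -(psdBl fb)//; [|exact: Su|exact: simple_fun_in].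
  apply: le_trans (bounded_form_le hX fb M0 bM (Sus n t Dt) Sw) _.
  by rewrite mulrAC -mulrA.
have bi : rint leb D (fun t => b (u t) w).
  have e t : D t -> (b (u t) w - b (simple_fun (s N) t) w) + b (simple_fun (s N) t) w = b (u t) w.
    by rewrite subrK.
  apply: (rint_ext mD e).
  apply: rintD => //; last exact: rint_simple_form.
  apply: (rint_le mD (g := fun t => M * hnorm X w * d N t)) => //.
  - by apply: measurable_funB => //; apply: rint_measurable; exact: rint_simple_form.
  - by apply: rintZ => //; exact: di.
  - by move=> t Dt; exact: bd.
have c1 : b (simple_integral D (s n)) w @[n --> \oo] --> \int[leb]_(t in D) b (u t) w.
  apply/cvgrPdist_le => e e0.
  have Mw : 0 <= M * hnorm X w by rewrite mulr_ge0// hnorm_ge0.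
  have [N2 hN2] := small (e / (M * hnorm X w + 1)) ltac:(by rewrite divr_gt0// ltr_wpDl).
  exists (maxn N N2) => // n /=; rewrite geq_max => /andP[n1 n2].
  rewrite -Rintegral_simple_form -RintegralB//; last exact: rint_simple_form.
  have rB : rint leb D (fun t => b (u t) w - b (simple_fun (s n) t) w).
    by apply: rintB => //; exact: rint_simple_form.
  apply: le_trans (le_normr_Rintegral mD rB) _.
  apply: (@le_trans _ _ (\int[leb]_(t in D) (M * hnorm X w * d n t))).
    apply: le_Rintegral => //; [exact: integrable_norm|by apply: rintZ => //; exact: di|exact: bd].
  rewrite RintegralZl//; last exact: di.
  have h : \int[leb]_(t in D) d n t <= e / (M * hnorm X w + 1).
    by rewrite -lee_fin EFin_Rintegral//; [exact: hN2|exact: di].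
  apply: le_trans (ler_wpM2l Mw h) _.
  rewrite mulrA ler_pdivrMr ?ltr_wpDl// [leRHS]mulrC ler_wpM2r ?ltW// ltrDl//.
have c2 : b (simple_integral D (s n)) w @[n --> \oo] --> b I w.
  apply: (bounded_form_cvg hX fb M0 bM) => //.
  - by move=> n; exact: simple_integral_in.
  - rewrite subrr /hnorm (psd0l hX fX) ?sqrtr0; last exact: subspace0 hX.
    exact: cvg_cst.
by split => //; exact: (cvg_unique _ c1 c2).
Qed.

End bochner_integral.

Section weak_derivative_form.
Variables (R : realType) (E : lmodType R) (X : hilbert_data E).
Hypotheses (hX : subspace (hset X)) (fX : psd_form (hset X) (hdot X)).
Let leb := @lebesgue_measure R.
Variable D : set R.
Hypothesis mD : measurable (D : set (measurableTypeR R)).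
Hypothesis Doo : (leb D < +oo)%E.
Variables (b : E -> E -> R) (M : R).
Hypotheses (fb : psd_form (hset X) b) (M0 : 0 <= M)
  (bM : forall x, hset X x -> b x x <= M * hdot X x x).

(** Pairing with a fixed vector [w] turns the weak derivative of a vector-valued
function into that of a real-valued one. *)
Lemma weak_derivative_form (u u' : R -> E) (w : E) (phi : R -> R) : hset X w ->
  (forall t, D t -> hset X (u t)) -> (forall t, D t -> hset X (u' t)) ->
  weak_time_derivative X D u u' -> test_function D phi ->
  \int[leb]_(t in D) (derive1 phi t * b (u t) w) =
  - \int[leb]_(t in D) (phi t * b (u' t) w).
Proof.
move=> Sw Su Su' wd tphi; have [I [I1 I2]] := wd phi tphi.
have S1 t : D t -> hset X (derive1 phi t *: u t).
  by move=> Dt; apply: subspaceZ => //; exact: Su.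
have S2 t : D t -> hset X (- (phi t *: u' t)).
  by move=> Dt; rewrite -scaleN1r; apply: subspaceZ => //; apply: subspaceZ => //; exact: Su'.
have [_ E1] := bochner_integral_form hX fX mD Doo fb M0 bM Sw S1 I1.
have [r2 E2] := bochner_integral_form hX fX mD Doo fb M0 bM Sw S2 I2.
transitivity (b I w).
  rewrite -E1; apply: eq_Rintegral => t /set_mem Dt.
  by rewrite (psdZl hX fb)//; exact: Su.
have H t : D t -> b (- (phi t *: u' t)) w = - (phi t * b (u' t) w).
  move=> Dt; rewrite -scaleN1r (psdZl hX fb)//; last by apply: subspaceZ => //; exact: Su'.
  by rewrite (psdZl hX fb)//; [rewrite mulN1r|exact: Su'].
have r3 : rint leb D (fun t => phi t * b (u' t) w).
  have e t : D t -> -1 * b (- (phi t *: u' t)) w = phi t * b (u' t) w.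
    by move=> Dt; rewrite H// mulN1r opprK.
  apply: (rint_ext mD e).
  exact: rintZ.
rewrite -E2 -mulN1r -RintegralZl//; apply: eq_Rintegral => t /set_mem Dt.
by rewrite H// mulN1r.
Qed.

End weak_derivative_form.

(** * Weak derivatives of real functions of time *)

Section ramp.
Variable R : realType.

Lemma CkV (V : normedModType R) k (f : V -> R) : (forall x, f x != 0) ->
  Ck k f -> Ck k (fun x => (f x)^-1).
Proof.
move=> f0; elim: k => [|k IH] /=.
  by move=> cf x; apply: cvgV; [exact: f0|exact: cf].
move=> Cf; have [cf Df] := Cf; split.
  by move=> x; apply: cvgV; [exact: f0|exact: cf].
move=> v; have [df CD] := Df v; split=> [x|].
  by apply: derivableV.
have -> : 'D_v (fun x => (f x)^-1) = fun x => -1 * ((f x)^-1 * (f x)^-1 * 'D_v f x).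
  apply/funext => x; rewrite deriveV// /GRing.scale/= -mulrA mulN1r mulrA.
  by rewrite -invfM -expr2 mulNr.
have CV : Ck k (fun x => (f x)^-1) by apply: IH; exact: CkS.
by apply: CkZ; apply: CkM => //; exact: CkM.
Qed.

Let e (x : R) : R := expinv 1 x.

Let e_gt0 x : 0 < x -> 0 < e x.
Proof. by move=> x0; rewrite /e /expinv x0 hornerE mul1r expR_gt0. Qed.

Let e_ge0 x : 0 <= e x.
Proof. by rewrite /e /expinv; case: ifP => // _; rewrite hornerE mul1r expR_ge0. Qed.

Let e_eq0 x : x <= 0 -> e x = 0.
Proof. by move=> x0; rewrite /e /expinv ltNge x0. Qed.

Let den_gt0 x : 0 < e x + e (1 - x).
Proof.
have [x0|x0] := ltP 0 x; first by rewrite ltr_pwDl ?e_gt0.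
by rewrite ltr_wpDl// e_gt0//; lra.
Qed.

(** A smooth transition from [0] to [1] on the unit interval. *)
Definition ramp (x : R) : R := e x / (e x + e (1 - x)).

Lemma ramp0 x : x <= 0 -> ramp x = 0.
Proof. by move=> x0; rewrite /ramp e_eq0// mul0r. Qed.

Lemma ramp1 x : 1 <= x -> ramp x = 1.
Proof.
move=> x1; have d := den_gt0 x; rewrite /ramp (@e_eq0 (1 - x)) ?addr0 ?subr_le0// in d *.
by rewrite divff// gt_eqF.
Qed.

Lemma ramp_ge0 x : 0 <= ramp x.
Proof. by rewrite divr_ge0// ltW. Qed.

Lemma ramp_le1 x : ramp x <= 1.
Proof. by rewrite ler_pdivrMr// mul1r lerDl. Qed.

Lemma Ck_ramp k : Ck k ramp.
Proof.
apply: CkM; first exact: Ck_expinv.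
apply: CkV; first by move=> x; rewrite gt_eqF.
apply: CkD; first exact: Ck_expinv.
apply: (@Ck_comp_affine _ _ _ _ (fun y : R => 1 - y) (fun y : R => - y)); last exact: Ck_expinv.
  by move=> x; apply: cvgB; [exact: cvg_cst|exact: cvg_id].
by move=> h v x; rewrite /GRing.scale/=; ring.
Qed.

Definition dramp : R -> R := 'D_1 ramp.

Lemma is_derive_ramp (x : R) : is_derive x 1 ramp (dramp x).
Proof. by apply: DeriveDef => //; have [_ /(_ 1)[]] := Ck_ramp 1. Qed.

Lemma Ck_dramp k : Ck k dramp.
Proof. by have [_ /(_ 1)[]] := Ck_ramp k.+1. Qed.

Lemma dramp_out x : ~~ (0 <= x <= 1) -> dramp x = 0.
Proof.
rewrite negb_and -!ltNge => /orP[x0|x1].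
  rewrite /dramp (@near_eq_derive _ _ _ _ (cst (0 : R))) ?derive_cst//.
  by near=> y; rewrite ramp0//; apply: ltW; near: y; exact: lt_nbhsl.
rewrite /dramp (@near_eq_derive _ _ _ _ (cst (1 : R))) ?derive_cst//.
by near=> y; rewrite ramp1//; apply: ltW; near: y; exact: lt_nbhsr.
Unshelve. all: by end_near. Qed.

Lemma dramp_bounded : exists C, 0 < C /\ forall x, `|dramp x| <= C.
Proof.
have cd : {within `[(0 : R), 1], continuous dramp}.
  by apply: continuous_subspaceT; exact: Ck_continuous (Ck_dramp 0).
have /compact_bounded[M [_ hM]] := continuous_compact cd (@segment_compact R 0 1).
exists (`|M| + 1); split; first by rewrite ltr_wpDl.
move=> x; have [x01|x01] := boolP (0 <= x <= 1).
  by apply: hM; [rewrite (le_lt_trans (ler_norm M))// ltrDl|exists x => //=; rewrite in_itv].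
by rewrite dramp_out// normr0 addr_ge0.
Qed.

Definition scaled_ramp (s delta x : R) : R := ramp (delta^-1 * (x - s)).
Definition scaled_dramp (s delta x : R) : R := delta^-1 * dramp (delta^-1 * (x - s)).

Lemma Ck_scaled (f : R -> R) k (s delta : R) : Ck k f -> Ck k (fun x => f (delta^-1 * (x - s))).
Proof.
apply: (@Ck_comp_affine _ _ _ _ (fun y : R => delta^-1 * (y - s)) (fun y : R => delta^-1 * y) f).
  move=> x; apply: cvgM; first exact: cvg_cst.
  by apply: cvgB; [exact: cvg_id|exact: cvg_cst].
by move=> h v x; rewrite /GRing.scale/=; ring.
Qed.

Lemma is_derive_scaled_ramp s delta (x : R) :
  is_derive x 1 (scaled_ramp s delta) (scaled_dramp s delta x).
Proof.
have da : is_derive x 1 (fun y : R => delta^-1 * (y - s)) delta^-1.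
  have h : is_derive x 1 (fun y : R => delta^-1 *: (y - s)) (delta^-1 *: (1 - 0)).
    by apply: is_deriveZ.
  by move: h; rewrite subr0 /GRing.scale/= mulr1.
have := @is_derive1_comp _ ramp (fun y : R => delta^-1 * (y - s)) x _ _
  (is_derive_ramp (delta^-1 * (x - s))) da.
by rewrite /scaled_dramp mulrC.
Qed.

Lemma scaled_dramp_continuous s delta : continuous (scaled_dramp s delta).
Proof. by apply: Ck_continuous (CkZ (k := 0) _ _); apply: Ck_scaled; exact: Ck_dramp. Qed.

Lemma scaled_dramp_out s delta x : 0 < delta -> ~~ (s <= x <= s + delta) ->
  scaled_dramp s delta x = 0.
Proof.
move=> d0 h; rewrite /scaled_dramp dramp_out ?mulr0//; apply: contra h.
rewrite pmulr_rge0 ?invr_gt0// subr_ge0 => /andP[-> /=].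
by rewrite mulrC ler_pdivrMr// mul1r lerBlDl.
Qed.

Lemma integral_scaled_dramp s delta : 0 < delta ->
  \int[@lebesgue_measure R]_(x in `[s, s + delta]) scaled_dramp s delta x = 1.
Proof.
move=> d0; rewrite /Rintegral (continuous_FTC2 (F := scaled_ramp s delta)).
- have -> : scaled_ramp s delta (s + delta) = 1.
    have -> : s + delta = delta + s by rewrite addrC.
    by rewrite /scaled_ramp addrK mulVf ?gt_eqF// ramp1.
  by rewrite /scaled_ramp subrr mulr0 ramp0//= subr0.
- by rewrite ltrDl.
- by apply: continuous_subspaceT; exact: scaled_dramp_continuous.
- have c : continuous (scaled_ramp s delta).
    by apply: is_derive1_continuous; exact: is_derive_scaled_ramp.
  split; [|exact/cvg_at_right_filter/c|exact/cvg_at_left_filter/c].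
  by move=> x _; case: (is_derive_scaled_ramp s delta x).
- by move=> x _; rewrite derive1E; case: (is_derive_scaled_ramp s delta x).
Qed.

End ramp.

Section weak_ftc.
Variables (R : realType) (T : R).
Hypothesis T0 : 0 < T.
Let leb := @lebesgue_measure R.
Let D : set R := `]0, T[%classic.
Let mD : measurable (D : set (measurableTypeR R)). Proof. exact: measurable_itv. Qed.

Variable g : R -> R.
Hypothesis cg : {within `[0, T], continuous g}.

Lemma cg_rint_itv : rint leb `[0, T]%classic g.
Proof. by apply: continuous_compact_integrable => //; exact: segment_compact. Qed.

Lemma rint_subitv (f : R -> R) (A B : set (measurableTypeR R)) :
  measurable A -> measurable B -> B `<=` A -> rint leb A f -> rint leb B f.
Proof. by move=> mA mB BA; exact: integrableS. Qed.

Lemma cg_rint : rint leb D g.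
Proof.
apply: rint_subitv cg_rint_itv; [exact: measurable_itv|exact: mD|].
by apply: subset_itv; rewrite bnd_simp.
Qed.

Lemma rint_scaled_dramp (s delta : R) : rint leb D (fun x => scaled_dramp s delta x * g x).
Proof.
have [C [C0 hC]] := dramp_bounded R.
have mg := rint_measurable cg_rint.
apply: (rint_le mD (g := fun x => `|delta^-1| * C * `|g x|)).
- apply: measurable_funM => //; apply: measurable_funTS.
  by apply: continuous_measurable_fun; exact: scaled_dramp_continuous.
- by apply: rintZ => //; exact: integrable_norm cg_rint.
- move=> x _; rewrite normrM ler_wpM2r// /scaled_dramp normrM ler_wpM2l//; exact: hC.
Qed.

(** Testing against the derivative of a ramp averages [g] near the point. *)
Lemma ramp_average (s : R) (delta : nat -> R) : 0 < s < T ->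
  (forall n, 0 < delta n) -> delta @ \oo --> (0 : R) ->
  \int[leb]_(x in D) (scaled_dramp s (delta n) x * g x) @[n --> \oo] --> g s.
Proof.
move=> /andP[s0 sT] d0 dl.
have [C [C0 hC]] := dramp_bounded R.
apply/cvgrPdist_le => e ep.
have eC : 0 < e / C by rewrite divr_gt0.
have [r r0 hr] : exists2 r, 0 < r & forall x, `|s - x| < r -> s <= x -> x <= T -> `|g x - g s| <= e / C.
  have /subspace_continuousP/(_ s) := cg.
  move=> /(_ _)/wrap[]; first by rewrite /= in_itv/= !ltW.
  move=> /cvgrPdist_le/(_ _ eC); rewrite near_withinE => -[r /= r0 hr].
  exists r => // x xr sx xT; rewrite distrC; apply: hr => //=.
  by rewrite in_itv/= xT (le_trans (ltW s0) sx).
have [N1 _ hN1] : \forall n \near \oo, delta n < r.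
  by move/cvgrPdist_lt: dl => /(_ r r0); apply: filterS => n; rewrite sub0r normrN; apply: le_lt_trans; exact: ler_norm.
have Ts : 0 < T - s by rewrite subr_gt0.
have [N2 _ hN2] : \forall n \near \oo, delta n < T - s.
  by move/cvgrPdist_lt: dl => /(_ _ Ts); apply: filterS => n; rewrite sub0r normrN; apply: le_lt_trans; exact: ler_norm.
exists (maxn N1 N2) => // n /=; rewrite geq_max => /andP[/hN1 n1 /hN2 n2].
set dn := delta n in n1 n2 *; have dn0 : 0 < dn by exact: d0.
pose I := `[s, s + dn]%classic : set (measurableTypeR R).
have mI : measurable I by exact: measurable_itv.
have ID : I `<=` D.
  move=> x; rewrite /I /D /= !in_itv/= => /andP[h1 h2].
  by apply/andP; split; lra.
have rD := rint_scaled_dramp s dn.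
have rI : rint leb I (fun x => scaled_dramp s dn x * g x) by exact: rint_subitv ID rD.
have rK : rint leb I (scaled_dramp s dn).
  apply: continuous_compact_integrable; first exact: segment_compact.
  by apply: continuous_subspaceT; exact: scaled_dramp_continuous.
have -> : \int[leb]_(x in D) (scaled_dramp s dn x * g x) =
    \int[leb]_(x in I) (scaled_dramp s dn x * g x).
  rewrite [LHS]Rintegral_mkcond [RHS]Rintegral_mkcond; apply: eq_Rintegral => x _.
  rewrite !patchE; have [xI|xI] := boolP (x \in I).
    by rewrite (mem_set (ID _ (set_mem xI))).
  case: ifP => // _; rewrite scaled_dramp_out ?mul0r//.
  by apply: contra xI => h; apply: mem_set; rewrite /I /= in_itv.
have -> : g s = \int[leb]_(x in I) (scaled_dramp s dn x * g s).
  by rewrite RintegralZr// integral_scaled_dramp// mul1r.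
rewrite -RintegralB//; last first.
  apply: (rint_ext mI (f := fun x => g s * scaled_dramp s dn x)).
    by move=> x _; rewrite mulrC.
  exact: rintZ.
have rB : rint leb I (fun x => scaled_dramp s dn x * g s - scaled_dramp s dn x * g x).
  apply: rintB => //; apply: (rint_ext mI (f := fun x => g s * scaled_dramp s dn x)).
    by move=> x _; rewrite mulrC.
  exact: rintZ.
apply: le_trans (le_normr_Rintegral mI rB) _.
have Ioo : fine (leb I) = dn.
  rewrite /leb /I lebesgue_measure_itv/= lte_fin ltrDl dn0 -EFinB/=.
  by ring.
have Ifin : (leb I < +oo)%E.
  by rewrite /leb /I lebesgue_measure_itv/= lte_fin ltrDl dn0 -EFinB ltry.
apply: (@le_trans _ _ (\int[leb]_(x in I) (dn^-1 * C * (e / C)))); last first.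
  rewrite Rintegral_cst// Ioo le_eqVlt; apply/orP; left; apply/eqP.
  by field; rewrite !gt_eqF.
apply: le_Rintegral => //.
- exact: integrable_norm.
- apply: measurable_bounded_integrable => //.
  by exists `|dn^-1 * C * (e / C)|; split; rewrite ?num_real// => x kx y _ /=; exact: ltW.
move=> x; rewrite /I /= in_itv/= => /andP[h1 h2].
rewrite -mulrBr normrM ler_pM//.
  by rewrite /scaled_dramp normrM (gtr0_norm (_ : 0 < dn^-1)) ?invr_gt0// ler_wpM2l ?invr_ge0 ?(ltW dn0).
rewrite distrC; apply: hr => //; last by lra.
by rewrite distrC ger0_norm ?subr_ge0//; lra.
Qed.

Variable h : R -> R.
Hypothesis rh : rint leb D h.
Hypothesis wd : forall phi : R -> R, test_function D phi ->
  \int[leb]_(x in D) (derive1 phi x * g x) = - \int[leb]_(x in D) (phi x * h x).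

(** The test function is a difference of two ramps: it rises from [0] to [1]
just after [s] and falls back just after [t]. As the ramps steepen, it tends to
the indicator of `]s, t]`, and its derivative evaluates [g] at [s] and [t]. *)
Lemma weak_ftc_interior (s t : R) : 0 < s -> s < t -> t < T ->
  g t - g s = \int[leb]_(x in `]s, t]) h x.
Proof.
move=> s0 st tT.
(* Widths that keep the supports inside `]0, T[`. *)
pose delta (n : nat) : R := (T - t) / 2 * harmonic n.
have c0 : 0 < (T - t) / 2 by rewrite divr_gt0// subr_gt0.
have d0 n : 0 < delta n by rewrite mulr_gt0// harmonic_gt0.
have dl : delta @ \oo --> (0 : R).
  have -> : nbhs (0 : R) = nbhs ((T - t) / 2 * 0 : R) by rewrite mulr0.
  by apply: cvgM; [exact: cvg_cst|exact: cvg_harmonic].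
have dT n : delta n <= (T - t) / 2.
  rewrite ger_pMr// /harmonic /= invf_le1//.
  by rewrite ler1n.
pose phi n x : R := scaled_ramp s (delta n) x - scaled_ramp t (delta n) x.
have phiE n x : phi n x = scaled_ramp s (delta n) x + -1 * scaled_ramp t (delta n) x.
  by rewrite mulN1r.
have dphi n (x : R) : is_derive x 1 (phi n) (scaled_dramp s (delta n) x - scaled_dramp t (delta n) x).
  by apply: is_deriveB; exact: is_derive_scaled_ramp.
have phi0 n x : phi n x != 0 -> s <= x <= t + delta n.
  apply: contraNT; rewrite negb_and -!ltNge => /orP[xs|xt]; apply/eqP.
    rewrite /phi /scaled_ramp !ramp0 ?subrr//.
      by rewrite pmulr_rle0 ?invr_gt0// subr_le0 ltW// (lt_trans xs).
    by rewrite pmulr_rle0 ?invr_gt0// subr_le0 ltW.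
  have big y : y <= t -> 1 <= (delta n)^-1 * (x - y).
    move=> yt; rewrite mulrC ler_pdivlMr// mul1r lerBrDl.
    by apply: le_trans (ltW xt); rewrite lerD2r.
  by rewrite /phi /scaled_ramp !ramp1 ?subrr// big// ltW.
have tphi n : test_function D (phi n).
  have sub : closure [set x | phi n x != 0] `<=` `[s, t + delta n]%classic.
    rewrite [X in _ `<=` X](_ : _ = closure `[s, t + delta n]%classic); last first.
      by rewrite -closure_id//; exact: itv_closed.
    by apply: closure_subset => x /= /phi0; rewrite in_itv.
  split.
  - move=> k; have -> : phi n = fun x => scaled_ramp s (delta n) x + -1 * scaled_ramp t (delta n) x.
      by apply/funext => x; exact: phiE.
    by apply: CkD; [|apply: CkZ]; apply: Ck_scaled; exact: Ck_ramp.
  - by apply: subclosed_compact sub; [exact: closed_closure|exact: segment_compact].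
  - apply: subset_trans sub _ => x; rewrite /D /= !in_itv/= => /andP[h1 h2].
    by have dn := dT n; apply/andP; split; lra.
have E n : \int[leb]_(x in D) (scaled_dramp s (delta n) x * g x) -
    \int[leb]_(x in D) (scaled_dramp t (delta n) x * g x) =
    - \int[leb]_(x in D) (phi n x * h x).
  rewrite -RintegralB//; [|exact: rint_scaled_dramp..].
  rewrite -(wd (tphi n)); apply: eq_Rintegral => x _.
  by rewrite derive1E; have [_ ->] := dphi n x; rewrite mulrBl.
have L1 : \int[leb]_(x in D) (scaled_dramp s (delta n) x * g x) -
    \int[leb]_(x in D) (scaled_dramp t (delta n) x * g x) @[n --> \oo] --> g s - g t.
  by apply: cvgB; apply: ramp_average => //; apply/andP; split; lra.
have lim_ramp y x : scaled_ramp y (delta n) x @[n --> \oo] --> ((y < x)%R%:R : R).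
  have [yx|xy] := ltP y x; last first.
    rewrite (_ : (fun n => _) = fun=> 0); first exact: cvg_cst.
    by apply/funext => n; rewrite /scaled_ramp ramp0// pmulr_rle0 ?invr_gt0// subr_le0.
  apply: cvg_near_cst; have xy0 : 0 < x - y by rewrite subr_gt0.
  move/cvgrPdist_le : dl => /(_ _ xy0); apply: filterS => n; rewrite sub0r normrN.
  rewrite (ger0_norm (ltW (d0 n))) => dn; rewrite /scaled_ramp ramp1//.
  by rewrite mulrC ler_pdivlMr// mul1r.
have [||||_ L2] := rint_dominated_cvg mD (f_ := fun n x => phi n x * h x)
    (f := fun x => (s < x <= t)%R%:R * h x) (g := fun x => 2 * `|h x|) (mu := leb).
- move=> n; apply: measurable_funM; last exact: rint_measurable rh.
  apply: measurable_funTS; apply: continuous_measurable_fun.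
  exact: is_derive1_continuous (dphi n).
- move=> x _; apply: cvgM; last exact: cvg_cst.
  have -> : ((s < x <= t)%R%:R : R) = (s < x)%R%:R - (t < x)%R%:R.
    have [xt|tx] := leP x t; first by rewrite andbT subr0.
    by rewrite andbF (lt_trans st tx) subrr.
  by apply: cvgB; exact: lim_ramp.
- by apply: rintZ => //; exact: integrable_norm rh.
- move=> n x _; rewrite normrM ler_wpM2r//.
  apply: le_trans (ler_normB _ _) _; rewrite !ger0_norm ?ramp_ge0//.
  by have := ramp_le1 (((delta n)^-1 * (x - s))); have := ramp_le1 (((delta n)^-1 * (x - t))); rewrite /scaled_ramp; lra.
have L3 : (- \int[leb]_(x in D) (phi n x * h x)) @[n --> \oo] -->
    - \int[leb]_(x in D) ((s < x <= t)%R%:R * h x) by exact: cvgN.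
have L4 : g s - g t = - \int[leb]_(x in D) ((s < x <= t)%R%:R * h x).
  apply: (cvg_unique _ _ L3) => //; apply: cvg_trans L1; apply: near_eq_cvg.
  by apply: nearW => n /=; rewrite E.
rewrite -opprB L4 opprK [RHS]Rintegral_mkcond [LHS]Rintegral_mkcond.
apply: eq_Rintegral => x _; rewrite !patchE.
have [xI|xI] := boolP (x \in (`]s, t]%classic : set R)).
  have := set_mem xI; rewrite /= in_itv/= => /andP[h1 h2]; rewrite h1 h2 mul1r mem_set//.
  by rewrite /D /= in_itv/=; apply/andP; split; lra.
have hx : (s < x <= t)%R = false.
  by apply/negP => hx; move/negP: xI; apply; apply: mem_set; rewrite /= in_itv.
by case: ifP => // _; rewrite hx mul0r.
Qed.

End weak_ftc.

(** * The weighted energy inequality *)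

Section energy_inequality.
Variables (R : realType) (E : lmodType R) (X : hilbert_data E).
Hypotheses (hX : subspace (hset X)) (fX : psd_form (hset X) (hdot X)).
Variables (b : E -> E -> R) (M : R).
Hypotheses (fb : psd_form (hset X) b) (M0 : 0 <= M)
  (bM : forall x, hset X x -> b x x <= M * hdot X x x).
Variable T : R.
Hypothesis T0 : 0 < T.
Let leb := @lebesgue_measure R.
Let D : set R := `]0, T[%classic.
Let mD : measurable (D : set (measurableTypeR R)). Proof. exact: measurable_itv. Qed.
Let Doo : (leb D < +oo)%E.
Proof. by rewrite /leb /D lebesgue_measure_itv/= lte_fin T0 -EFinB ltry. Qed.

Lemma L2B_cst (y : E) : hset X y -> L2B X D (fun=> y).
Proof.
move=> Sy; apply: (L2BP fX) => //.
  exists (fun=> @SimpleData R E X 1 (fun=> setT) (fun=> y) (fun=> measurableT) (fun=> Sy)) => t _.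
  rewrite /simple_fun big_ord_recl big_ord0 addr0 indicT scale1r subrr /hnorm.
  rewrite (psd0l hX fX) ?sqrtr0; last exact: subspace0 hX.
  exact: cvg_cst.
apply: measurable_bounded_integrable => //.
by exists `|hdot X y y|; split; rewrite ?num_real// => x kx z _ /=; exact: ltW.
Qed.

Lemma hnormZ (a : R) x : hset X x -> hnorm X (a *: x) = `|a| * hnorm X x.
Proof.
move=> Sx; rewrite /hnorm (psdZl hX fX)//; last exact: subspaceZ.
by rewrite (psdZr hX fX)// mulrA -expr2 sqrtrM ?sqr_ge0// sqrtr_sqr.
Qed.

(** Heine's theorem for the seminorm of a Hilbert space. *)
Lemma uniformly_continuous_hnorm (f : R -> E) :
  (forall t, 0 <= t <= T -> hset X (f t)) ->
  (forall t, 0 <= t <= T ->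
     hnorm X (f s - f t) @[s --> within `[0, T]%classic (nbhs t)] --> (0 : R)) ->
  forall e, 0 < e -> exists2 delta, 0 < delta & forall s t, 0 <= s <= T -> 0 <= t <= T ->
    `|s - t| < delta -> hnorm X (f s - f t) <= e.
Proof.
move=> Sf cf e e0; have e2 : 0 < e / 2 by rewrite divr_gt0.
pose P (delta s : R) := forall t, 0 <= s <= T -> 0 <= t <= T ->
    `|s - t| < delta -> hnorm X (f s - f t) <= e.
suff hd : \forall delta \near (0 : R)^'+, `[0, T]%classic `<=` P delta.
  have [delta [/= d0 h]] := filter_ex (filterI (nbhs_right_gt (0 : R)) hd).
  by exists delta => // s t sT tT; apply: h.
have /compact_near_coveringP cov := @segment_compact R 0 T.
apply: cov => x; rewrite /= in_itv/= => xT.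
have /cvgr0Pnorm_le/(_ _ e2) := cf x xT; rewrite near_withinE => -[r /= r0 hr].
have r2 : 0 < r / 2 by rewrite divr_gt0.
exists (ball x (r / 2), [set delta | delta < r / 2]).
  split => /=; first exact: nbhsx_ballx.
  exact: nbhs_right_lt.
move=> [s delta] /= [xs dr] t sT tT st.
have near y : 0 <= y <= T -> `|x - y| < r -> hnorm X (f y - f x) <= e / 2.
  move=> yT xy; have := hr y xy; rewrite /= in_itv/= => /(_ yT).
  by rewrite ger0_norm// hnorm_ge0.
have Ss := Sf s sT; have St := Sf t tT; have Sx := Sf x xT.
have -> : f s - f t = (f s - f x) + (f x - f t) by rewrite addrA subrK.
apply: le_trans (hnormD hX fX (subspaceB hX Ss Sx) (subspaceB hX Sx St)) _.
rewrite (hnorm_distC hX fX Sx St) [leRHS]splitr; apply: lerD; apply: near => //.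
  by apply: lt_trans xs _; rewrite ltr_pdivrMr// ltr_pMr// ltr1n.
have -> : x - t = (x - s) + (s - t) by rewrite addrA subrK.
apply: le_lt_trans (ler_normD _ _) _; rewrite [ltRHS]splitr ltrD//.
exact: lt_trans dr.
Qed.

Variables (u u' u0 : R -> E).
Hypotheses (Lu : L2B X D u) (Lu' : L2B X D u') (wd : weak_time_derivative X D u u').
Hypotheses (Su0 : forall t, 0 <= t <= T -> hset X (u0 t))
  (cu0 : forall t, 0 <= t <= T ->
     hnorm X (u0 s - u0 t) @[s --> within `[0, T]%classic (nbhs t)] --> (0 : R))
  (u0u : {ae @lebesgue_measure R, forall t, 0 < t < T -> hnorm X (u0 t - u t) = 0})
  (u00 : hnorm X (u0 0) = 0).

Let D_in t : D t -> 0 <= t <= T.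
Proof. by rewrite /D /= in_itv/= => /andP[h1 h2]; rewrite !ltW. Qed.

Let Su t : D t -> hset X (u t). Proof. exact: L2B_in Lu. Qed.

(** The square of [omega] is the weight [exp(-t/T)] and the derivative of
[omega *: u] is [omega *: v]. Hence the difference of the two sides of the energy
inequality is half the increment of the energy of [omega *: u] over the time
interval. *)
Let omega (t : R) : R := expR (- (t / (2 * T))).
Let v (t : R) : E := (- (2 * T)^-1) *: u t + u' t.

Let Lv : L2B X D v. Proof. exact: (L2B_lin hX fX mD). Qed.

Let omega_gt0 t : 0 < omega t. Proof. exact: expR_gt0. Qed.

Let omega_le1 t : 0 <= t -> omega t <= 1.
Proof.
move=> t0; rewrite -[leRHS](@expR0 R) ler_expR oppr_le0.
by rewrite divr_ge0// mulr_ge0// ltW.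
Qed.

Let domega (t : R) : is_derive t 1 omega (- (2 * T)^-1 * omega t).
Proof.
have dl : is_derive t 1 (fun s : R => - (s / (2 * T))) (- (2 * T)^-1).
  have h : is_derive t 1 (fun s : R => (- (2 * T)^-1) *: s) ((- (2 * T)^-1) *: 1).
    exact: is_deriveZ.
  move: h; rewrite /GRing.scale/= mulr1.
  by under eq_fun do rewrite mulNr mulrC.
have := @is_derive1_comp _ expR (fun s : R => - (s / (2 * T))) t _ _
  (is_derive_expR (- (t / (2 * T)))) dl.
by rewrite [X in is_derive _ _ _ X]mulrC.
Qed.

Let Ck_omega k : Ck k omega.
Proof.
apply: (@Ck_comp_affine _ _ _ _ (fun s : R => - (s / (2 * T))) (fun s : R => - (s / (2 * T)))
  (@expR R)); last exact: Ck_expR.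
  by move=> x; apply: cvgN; apply: cvgM; [exact: cvg_id|exact: cvg_cst].
by move=> h y x; rewrite /GRing.scale/=; ring.
Qed.

Let f (t : R) : E := omega t *: u0 t.

Let Sf t : 0 <= t <= T -> hset X (f t).
Proof. by move=> tT; apply: subspaceZ => //; exact: Su0. Qed.

Let cvg0_within (t k : R) (h q : R -> R) :
  (forall s, 0 <= s <= T -> `|h s| <= k * q s) ->
  q s @[s --> within `[0, T]%classic (nbhs t)] --> (0 : R) ->
  h s @[s --> within `[0, T]%classic (nbhs t)] --> (0 : R).
Proof.
move=> hq q0.
have kq : k * q s @[s --> within `[0, T]%classic (nbhs t)] --> (0 : R).
  have -> : nbhs (0 : R) = nbhs (k * 0 : R) by rewrite mulr0.
  by apply: cvgM => //; exact: cvg_cst.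
apply/cvgr0Pnorm_le => e e0.
have /cvgr0Pnorm_le/(_ _ e0) := kq.
rewrite !near_withinE; apply: filterS => s hs sT.
apply: le_trans (hq s _) (le_trans (ler_norm _) (hs sT)).
by move: sT; rewrite /= in_itv.
Qed.

Let cf t : 0 <= t <= T ->
  hnorm X (f s - f t) @[s --> within `[0, T]%classic (nbhs t)] --> (0 : R).
Proof.
move=> tT; have St := Su0 tT.
apply: (@cvg0_within _ 1 _
  (fun s => hnorm X (u0 s - u0 t) + `|omega s - omega t| * hnorm X (u0 t))) => [s sT|].
  have Ss := Su0 sT; have Sst := subspaceB hX Ss St.
  rewrite ger0_norm ?hnorm_ge0// mul1r.
  have -> : f s - f t = omega s *: (u0 s - u0 t) + (omega s - omega t) *: u0 t.
    by rewrite /f scalerBr scalerBl addrA subrK.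
  apply: le_trans (hnormD hX fX (subspaceZ hX _ Sst) (subspaceZ hX _ St)) _.
  rewrite !hnormZ// lerD2r (ger0_norm (ltW (omega_gt0 s))) ler_piMl ?hnorm_ge0//.
  by apply: omega_le1; case/andP: sT.
have -> : nbhs (0 : R) = nbhs (0 + 0 * hnorm X (u0 t) : R) by rewrite mul0r addr0.
apply: cvgD; first exact: cu0.
apply: cvgM; last exact: cvg_cst.
have co : omega @ t --> omega t by exact: (Ck_continuous (Ck_omega 0)).
have co0 : `|omega s - omega t| @[s --> t] --> (0 : R).
  by apply/norm_cvg0P/subr_cvg0.
exact: cvg_within_filter co0.
Qed.

Let within_form y : hset X y -> {within `[0, T], continuous (fun t => b (f t) y)}.
Proof.
move=> Sy; apply/subspace_continuousP => t; rewrite /= in_itv/= => tT.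
have St := Sf tT; apply/subr_cvg0.
apply: (@cvg0_within _ (M * hnorm X y) _ (fun s => hnorm X (f s - f t))); last exact: cf.
move=> s sT; have Ss := Sf sT.
rewrite -(psdBl fb)// -mulrA [hnorm X y * _]mulrC.
exact: (bounded_form_le hX fb M0 bM (subspaceB hX Ss St) Sy).
Qed.

Let rint_continuous_mul (phi h : R -> R) : continuous phi -> rint leb D h ->
  rint leb D (fun t => phi t * h t).
Proof.
move=> cphi rh.
have [B [_ hB]] := @compact_bounded _ _ _ (continuous_compact
  (continuous_subspaceT cphi) (@segment_compact R 0 T)).
have {}hB t : D t -> `|phi t| <= `|B| + 1.
  move=> Dt; apply: (hB (`|B| + 1)); first by rewrite ltr_pwDr// ler_norm.
  by exists t => //=; rewrite in_itv/=; exact: D_in.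
apply: (rint_le mD (g := fun t => (`|B| + 1) * `|h t|)).
- apply: measurable_funM; last exact: rint_measurable rh.
  by apply: measurable_funTS; exact: continuous_measurable_fun.
- by apply: rintZ => //; rewrite /rint; exact: integrable_abse rh.
- by move=> t Dt; rewrite normrM ler_wpM2r// hB.
Qed.

Let omega_continuous : continuous omega. Proof. exact: Ck_continuous (Ck_omega 0). Qed.

Let rv_form y : hset X y -> rint leb D (fun r => b (v r) y).
Proof. by move=> Sy; exact: (rint_form hX fX mD fb M0 bM Lv (L2B_cst Sy)). Qed.

(** The derivative of [omega *: u] is [omega *: v], paired with [y]. *)
Let ftc_form s t y : 0 < s -> s < t -> t < T -> hset X y ->
  b (f t) y - b (f s) y = \int[leb]_(r in `]s, t]) (omega r * b (v r) y).
Proof.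
move=> s0 st tT Sy.
apply: (weak_ftc_interior (within_form Sy) _ _ s0 st tT).
  exact: rint_continuous_mul (rv_form Sy).
move=> phi tphi; have [Cphi _ _] := tphi.
have Cpsi k : Ck k (fun x => phi x * omega x) by exact: CkM.
have tpsi : test_function D (fun x => phi x * omega x).
  have sub : [set x | phi x * omega x != 0] `<=` [set x | phi x != 0].
    by move=> x /=; apply: contra => /eqP ->; rewrite mul0r.
  have csub := closure_subset sub.
  case: tphi => _ cphi sphi; split=> //.
    by apply: (subclosed_compact _ cphi csub); exact: closed_closure.
  exact: subset_trans csub sphi.
have dpsi x : derive1 (fun x => phi x * omega x) x =
    derive1 phi x * omega x + phi x * (- (2 * T)^-1 * omega x).
  have dp : is_derive x 1 phi (derive1 phi x).
    by rewrite derive1E; apply: DeriveDef => //; have [_ /(_ 1)[]] := Cphi 1%N.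
  have := @is_deriveM _ _ phi omega x 1 _ _ dp (domega x).
  by move=> [_ h]; rewrite derive1E -[LHS]/('D_1 (phi * omega) x) h /GRing.scale/=; ring.
have cphi := Ck_continuous (Cphi 0%N).
have cdphi : continuous (derive1 phi).
  rewrite (_ : derive1 phi = 'D_1 phi); last by apply/funext => x; rewrite derive1E.
  by have [_ /(_ 1)[_ h]] := Cphi 1%N.
have ru : rint leb D (fun r => omega r * b (u r) y).
  by apply: rint_continuous_mul => //; exact: (rint_form hX fX mD fb M0 bM Lu (L2B_cst Sy)).
have ru' : rint leb D (fun r => omega r * b (u' r) y).
  by apply: rint_continuous_mul => //; exact: (rint_form hX fX mD fb M0 bM Lu' (L2B_cst Sy)).
have rA := rint_continuous_mul cdphi ru.
have rB := rint_continuous_mul cphi ru.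
have rC := rint_continuous_mul cphi ru'.
have wdy := weak_derivative_form hX fX mD Doo fb M0 bM Sy Su
  (fun t Dt => L2B_in Lu' Dt) wd tpsi.
have main : \int[leb]_(x in D) (derive1 phi x * (omega x * b (u x) y)) =
    - \int[leb]_(x in D) (phi x * (omega x * b (v x) y)).
  have -> : \int[leb]_(x in D) (phi x * (omega x * b (v x) y)) =
      - (2 * T)^-1 * \int[leb]_(x in D) (phi x * (omega x * b (u x) y)) +
      \int[leb]_(x in D) (phi x * (omega x * b (u' x) y)).
    rewrite -RintegralZl// -RintegralD//; last exact: rintZ.
    apply: eq_Rintegral => x /set_mem Dx.
    have S1 := Su Dx; have S2 := L2B_in Lu' Dx.
    rewrite /v (psdDl fb)//; last exact: subspaceZ.
    by rewrite (psdZl hX fb)//; ring.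
  move: wdy.
  have -> : \int[leb]_(x in D) (phi x * omega x * b (u' x) y) =
      \int[leb]_(x in D) (phi x * (omega x * b (u' x) y)).
    by apply: eq_Rintegral => x _; rewrite mulrA.
  have -> : \int[leb]_(x in D) (derive1 (fun x => phi x * omega x) x * b (u x) y) =
      \int[leb]_(x in D) (derive1 phi x * (omega x * b (u x) y)) +
      - (2 * T)^-1 * \int[leb]_(x in D) (phi x * (omega x * b (u x) y)).
    rewrite -RintegralZl// -RintegralD//; last exact: rintZ.
    by apply: eq_Rintegral => x _; rewrite dpsi; ring.
  by move=> h; lra.
rewrite -main; apply: ae_eq_Rintegral => //.
- apply: measurable_funM; first by apply: measurable_funTS; exact: continuous_measurable_fun.
  exact: rint_measurable (cg_rint (within_form Sy)).
- exact: rint_measurable rA.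
- apply: ae_imply u0u => x h Dx; have S0 := Su0 (D_in Dx); have S1 := Su Dx.
  congr (_ * _); rewrite /f (psdZl hX fb)//; congr (_ * _).
  apply/eqP; rewrite -subr_eq0 -(psdBl fb)// -normr_le0.
  apply: le_trans (bounded_form_le hX fb M0 bM (subspaceB hX S0 S1) Sy) _.
  by rewrite h ?mul0r ?mulr0//; move: Dx; rewrite /D /= in_itv.
Qed.

Let k r := omega r ^+ 2 * b (v r) (u r).

Let rk : rint leb D k.
Proof.
have c2 : continuous (fun r => omega r ^+ 2).
  by move=> x; apply: (@cvgM _ _ _ _ omega omega); exact: omega_continuous.
by apply: rint_continuous_mul => //; exact: (rint_form hX fX mD fb M0 bM Lv Lu).
Qed.

Let rH : rint leb D (fun r => hnorm X (v r)).
Proof.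
have r1 : rint leb D (fun r => 1 + hdot X (v r) (v r)).
  apply: rintD => //; last exact: (L2B_rint hX fX Lv).
  apply: measurable_bounded_integrable => //.
  by exists 1; split; rewrite ?num_real// => x kx z _ /=; rewrite normr1 ltW.
have [Sv mv _] := Lv.
apply: rint_le r1 _ => //; first exact: (measurable_hnorm hX fX Sv mv).
move=> t Dt; rewrite ger0_norm ?hnorm_ge0// -(hnorm_sqr fX (Sv t Dt)).
by have := sqr_ge0 (hnorm X (v t) - 1); have := hnorm_ge0 X (v t); rewrite !expr2; nra.
Qed.

Let F t := b (f t) (f t).

Let sub_D s t : 0 < s -> t < T -> `]s, t]%classic `<=` D.
Proof.
move=> s0 tT r; rewrite /D /= !in_itv/= => /andP[sr rt].
by rewrite (lt_trans s0 sr) (le_lt_trans rt tT).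
Qed.

(** The convexity inequality [F t - F s <= 2 * b (f t - f s) (f t)] makes a
product rule unnecessary: the increments of [b (f _) y] are known for the fixed
vector [y = f t], and replacing [f t] by [f r] under the integral costs an error
controlled by the modulus of continuity. *)
Let energy_step e delta : 0 < e ->
  (forall s t, 0 <= s <= T -> 0 <= t <= T -> `|s - t| < delta -> hnorm X (f s - f t) <= e) ->
  forall s t, 0 < s -> s < t -> t < T -> t - s < delta ->
  F t - F s <= 2 * \int[leb]_(r in `]s, t]) (k r + M * e * hnorm X (v r)).
Proof.
move=> e0 he s t s0 st tT std; have sD := sub_D s0 tT.
have St : hset X (f t) by apply: Sf; rewrite !ltW// (lt_trans s0).
have Ss : hset X (f s) by apply: Sf; rewrite !ltW// (lt_trans st).
have rI h : rint leb D h -> rint leb `]s, t]%classic h.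
  by apply: rint_subitv => //; exact: measurable_itv.
have Fts : F t - F s <= 2 * (b (f t) (f t) - b (f s) (f t)).
  have := psd_ge0 fb (subspaceB hX St Ss); have Sts := subspaceB hX St Ss.
  rewrite (psdBl fb)// !(psdBr hX fb)// (psd_sym fb St Ss) /F; lra.
apply: le_trans Fts _; rewrite ler_pM2l// ftc_form//.
apply: ae_le_Rintegral.
- exact: measurable_itv.
- by apply: rI; apply: rint_continuous_mul => //; exact: rv_form.
- by apply: rI; apply: rintD => //; exact: rintZ.
apply: ae_imply u0u => r h rst; have Dr := sD r rst.
have rT := D_in Dr; have Sr := Sf rT; have Sur := Su Dr; have Su0r := Su0 rT.
have Sv := L2B_in Lv Dr; have St' := subspaceB hX St Sr.
have -> : b (v r) (f t) = b (v r) (f r) + b (v r) (f t - f r).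
  by rewrite -(psdDr hX fb)// addrC subrK.
have -> : b (v r) (f r) = omega r * b (v r) (u r).
  rewrite /f (psdZr hX fb)//; congr (_ * _); apply/eqP; rewrite -subr_eq0 -(psdBr hX fb)//.
  rewrite -normr_le0.
  apply: le_trans (bounded_form_le hX fb M0 bM Sv (subspaceB hX Su0r Sur)) _.
  by rewrite h ?mulr0//; move: Dr; rewrite /D /= in_itv.
rewrite mulrDr mulrA -expr2 lerD2l.
have w1 : omega r <= 1 by apply: omega_le1; case/andP: rT.
apply: le_trans (ler_norm _) _; rewrite normrM (ger0_norm (ltW (omega_gt0 r))).
apply: le_trans (ler_piMl (normr_ge0 _) w1) _.
apply: le_trans (bounded_form_le hX fb M0 bM Sv St') _.
rewrite -mulrA ler_wpM2l// mulrC ler_wpM2r ?hnorm_ge0//; apply: he => //.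
  by rewrite !ltW// (lt_trans s0).
move: rst; rewrite /= in_itv/= => /andP[sr rt].
by rewrite ger0_norm ?subr_ge0//; apply: le_lt_trans std; rewrite lerB// ltW.
Qed.

(** An interval is cut into pieces shorter than [delta]. *)
Let energy_telescope e delta : 0 < e -> 0 < delta ->
  (forall s t, 0 <= s <= T -> 0 <= t <= T -> `|s - t| < delta -> hnorm X (f s - f t) <= e) ->
  forall s t, 0 < s -> s < t -> t < T ->
  F t - F s <= 2 * \int[leb]_(r in `]s, t]) (k r + M * e * hnorm X (v r)).
Proof.
move=> e0 d0 he s t s0 st tT.
have [N tsN] : exists N : nat, t - s <= N%:R * (delta / 2).
  exists (Num.bound ((t - s) / (delta / 2))).
  rewrite -ler_pdivrMr ?divr_gt0//; apply/ltW/archi_boundP.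
  by rewrite divr_ge0 ?subr_ge0 ?ltW// divr_gt0.
elim: N t st tT tsN => [|N IH] t st tT.
  by rewrite mul0r => h; exfalso; lra.
have [std _|dts] := ltP (t - s) delta; first exact: energy_step std.
rewrite -natr1 mulrDl mul1r => tsN.
pose m := t - delta / 2.
have sm : s < m by rewrite /m; lra.
have mt : m < t by rewrite /m; lra.
have mT : m < T by exact: lt_trans tT.
have h1 : F m - F s <= 2 * \int[leb]_(r in `]s, m]) (k r + M * e * hnorm X (v r)).
  by apply: IH => //; move: tsN; rewrite /m; move: (_ * _) => z; lra.
have h2 : F t - F m <= 2 * \int[leb]_(r in `]m, t]) (k r + M * e * hnorm X (v r)).
  by apply: (energy_step e0 he) => //; [exact: lt_trans sm|rewrite /m; lra].
have rI : rint leb `]s, t]%classic (fun r => k r + M * e * hnorm X (v r)).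
  apply: (@rint_subitv _ _ D); [exact: mD|exact: measurable_itv|exact: sub_D|].
  by apply: rintD => //; exact: rintZ.
have := Rintegral_itvB rI (x := m).
rewrite !bnd_simp => /(_ (ltW sm) (ltW mt)) split.
have -> : F t - F s = (F m - F s) + (F t - F m) by ring.
apply: le_trans (lerD h1 h2) _.
by rewrite -mulrDr ler_pM2l// -lerBrDl split.
Qed.

Let energy_le s t : 0 < s -> s < t -> t < T ->
  F t - F s <= 2 * \int[leb]_(r in `]s, t]) k r.
Proof.
move=> s0 st tT; have sD := sub_D s0 tT.
have mI : measurable (`]s, t]%classic : set (measurableTypeR R)) by exact: measurable_itv.
have rI h : rint leb D h -> rint leb `]s, t]%classic h by exact: rint_subitv.
apply/ler_addgt0Pl => e e0.
pose H := \int[leb]_(r in `]s, t]) hnorm X (v r).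
have H0 : 0 <= H by apply: Rintegral_ge0 => // r _; exact: hnorm_ge0.
have MH : 0 < 2 * M * H + 1 by rewrite ltr_wpDl// !mulr_ge0.
have e'0 : 0 < e / (2 * M * H + 1) by rewrite divr_gt0.
have [delta d0 he] := uniformly_continuous_hnorm Sf cf e'0.
apply: le_trans (energy_telescope e'0 d0 he s0 st tT) _.
rewrite RintegralD//; [|exact: rI|by apply: rI; exact: rintZ].
rewrite RintegralZl//; last exact: rI.
rewrite mulrDr addrC lerD2r -/H.
have -> : 2 * (M * (e / (2 * M * H + 1)) * H) = e * (2 * M * H / (2 * M * H + 1)).
  by ring.
by rewrite ler_piMr ?ltW// ltr_pdivrMr// mul1r ltrDl.
Qed.

Let F_cvg0 (s : nat -> R) : (forall n, 0 < s n < T) -> s @ \oo --> (0 : R) ->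
  F (s n) @[n --> \oo] --> (0 : R).
Proof.
move=> sT s0.
have zT : 0 <= (0 : R) <= T by rewrite lexx ltW.
have cF : hnorm X (f (s n) - f 0) @[n --> \oo] --> (0 : R).
  apply: (@cvg_comp _ _ _ s (fun x => hnorm X (f x - f 0)) _ _ _ _ (cf zT)).
  move=> A /= /s0; rewrite /nbhs/=; apply: filterS => n /=; apply.
  by rewrite in_itv/=; have /andP[h1 h2] := sT n; rewrite !ltW.
have f0 : hnorm X (f 0) = 0.
  by rewrite hnormZ ?u00 ?mulr0//; exact: Su0.
have S0 := Sf zT; have Sn n : hset X (f (s n)).
  by apply: Sf; have /andP[h1 h2] := sT n; rewrite !ltW.
apply: (cvg0_le (g := fun n => M * (hnorm X (f (s n) - f 0) ^+ 2))) => [n|].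
  rewrite (psd_ge0 fb (Sn n))/=; apply: le_trans (bM (Sn n)) _; rewrite ler_wpM2l//.
  rewrite -(hnorm_sqr fX (Sn n)) ler_pXn2r ?nnegrE ?hnorm_ge0//.
  have := hnormD hX fX (subspaceB hX (Sn n) S0) S0.
  by rewrite subrK f0 addr0.
apply: cvg0Ml; have -> : nbhs (0 : R) = nbhs (0 * 0 : R) by rewrite mulr0.
exact: (cvgM cF cF).
Qed.

(** The formula for increments holds between interior times; the end points are
reached in the limit. *)
Let sn (n : nat) : R := T / n.+3%:R.

Let sn_bound n : 0 < sn n < T / 2.
Proof.
rewrite /sn divr_gt0//= ltr_pM2l// ltf_pV2 ?posrE//.
by rewrite (ltr_nat R 2).
Qed.

Let sn_cvg : sn @ \oo --> (0 : R).
Proof.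
apply: (cvg0_le (g := fun n => T * harmonic n)) => [n|].
  have /andP[h _] := sn_bound n; rewrite (ltW h)/= /sn ler_pM2l// lef_pV2 ?posrE// ler_nat.
  by rewrite ltnS (leq_trans (leqnSn n)).
exact: (@cvg0Ml _ T harmonic (@cvg_harmonic R)).
Qed.

Let integral_k_ge0 : 0 <= \int[leb]_(r in D) k r.
Proof.
pose I n : set R := `]sn n, T - sn n]%classic.
have ID n : I n `<=` D.
  by have /andP[h1 h2] := sn_bound n; apply: sub_D => //; rewrite ltrBlDr ltrDl.
have mI n : measurable (I n : set (measurableTypeR R)) by exact: measurable_itv.
have cI : \int[leb]_(r in I n) k r @[n --> \oo] --> \int[leb]_(r in D) k r.
  have -> : (fun n => \int[leb]_(r in I n) k r) =
      (fun n => \int[leb]_(r in D) (\1_(I n) r * k r)).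
    apply/funext => n; rewrite -[in LHS](setIidr (ID n)).
    rewrite Rintegral_mkcondr; apply: eq_Rintegral => r _.
    by rewrite patchE indicE; case: (r \in I n); rewrite ?mul1r ?mul0r.
  apply: (proj2 (rint_dominated_cvg (mu := leb) mD (f_ := fun n r => \1_(I n) r * k r) (f := k)
    (g := fun r => `|k r|) _ _ _ _)).
  - by move=> n; apply: measurable_funM; [exact: measurable_indic|exact: rint_measurable rk].
  - move=> r Dr; apply: (cvg_trans _ (@cvg_cst _ (k r) nat \oo _)); apply: near_eq_cvg.
    have r0 : 0 < Num.min r (T - r).
      by move: Dr; rewrite /D /= in_itv/= lt_min subr_gt0.
    move/cvgrPdist_lt: sn_cvg => /(_ _ r0); apply: filterS => n.
    have /andP[s0 _] := sn_bound n.
    rewrite sub0r normrN gtr0_norm// lt_min ltrBrDl -ltrBrDr => /andP[h1 h2].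
    by rewrite indicE mem_set ?mul1r// /I /= in_itv/= h1 ltW.
  - by rewrite /rint; exact: integrable_abse rk.
  - move=> n r _; rewrite normrM indicE.
    by case: (r \in I n); rewrite ?normr1 ?mul1r// normr0 mul0r.
have cF : F (sn n) @[n --> \oo] --> (0 : R).
  apply: F_cvg0 sn_cvg => n; have /andP[h1 h2] := sn_bound n.
  by rewrite h1 (lt_trans h2)// ltr_pdivrMr// ltr_pMr// ltr1n.
have c0 : - F (sn n) @[n --> \oo] --> (0 : R).
  have -> : nbhs (0 : R) = nbhs (- 0 : R) by rewrite oppr0.
  exact: cvgN.
have c2 : 2 * \int[leb]_(r in I n) k r @[n --> \oo] --> 2 * \int[leb]_(r in D) k r.
  by apply: cvgM => //; exact: cvg_cst.
rewrite -(@pmulr_rge0 _ 2)//.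
apply: (ler_cvg_to c0 c2); apply: nearW => n.
have /andP[h1 h2] := sn_bound n.
have := @energy_le (sn n) (T - sn n) h1.
have S0 : hset X (f (T - sn n)) by apply: Sf; lra.
have F0 : 0 <= F (T - sn n) := psd_ge0 fb S0.
have h3 : sn n < T - sn n by lra.
have h4 : T - sn n < T by lra.
by move=> /(_ h3 h4); apply: le_trans; rewrite lerDr.
Qed.

(** The energy of [omega *: u] is zero at the initial time and nonnegative
afterwards. *)
Lemma energy_inequality :
  (2 * T)^-1 * weighted_integral T (fun t => b (u t) (u t)) <=
  weighted_integral T (fun t => b (u t) (u' t)).
Proof.
have w2 t : expR (- (t / T)) = omega t ^+ 2.
  rewrite /omega expr2 -expRD; congr expR.
  by field; rewrite gt_eqF.
have c2 : continuous (fun r => omega r ^+ 2).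
  by move=> x; apply: (@cvgM _ _ _ _ omega omega); exact: omega_continuous.
have r1 := rint_continuous_mul c2 (rint_form hX fX mD fb M0 bM Lu Lu).
have r2 := rint_continuous_mul c2 (rint_form hX fX mD fb M0 bM Lu Lu').
have := integral_k_ge0.
have -> : \int[leb]_(r in D) k r =
    - (2 * T)^-1 * \int[leb]_(r in D) (omega r ^+ 2 * b (u r) (u r)) +
    \int[leb]_(r in D) (omega r ^+ 2 * b (u r) (u' r)).
  rewrite -RintegralZl// -RintegralD//; last exact: rintZ.
  apply: eq_Rintegral => x /set_mem Dx.
  have S1 := Su Dx; have S2 := L2B_in Lu' Dx.
  rewrite /k /v (psdDl fb)//; last exact: subspaceZ.
  by rewrite (psdZl hX fb)// (psd_sym fb S2 S1); ring.
rewrite mulNr addrC subr_ge0 /weighted_integral.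
under eq_Rintegral do rewrite -w2 mulrC.
by under [X in _ <= X -> _]eq_Rintegral do rewrite -w2 mulrC.
Qed.

End energy_inequality.

(** * Functions on the space-time cylinder *)

Section space_time.
Variables (R : realType) (d : nat) (Omega : set 'rV[R]_d) (T : R).
Hypotheses (oO : open Omega) (bO : bounded_set Omega).
Let mu := lebesgue_rV R d.
Let leb := @lebesgue_measure R.
Let D : set R := `]0, T[%classic.
Let mO : measurable Omega. Proof. exact: mOmega. Qed.
Let mD : measurable (D : set (measurableTypeR R)). Proof. exact: measurable_itv. Qed.
Local Notation XL := (L2_space Omega).

Lemma measurable_QT : measurable (QT Omega T).
Proof. exact: measurableX. Qed.

Lemma tonelli_QT (f : 'rV[R]_d * measurableTypeR R -> R) :
  measurable_fun (QT Omega T) f -> (forall z, QT Omega T z -> 0 <= f z) ->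
  (\int[mu \x leb]_(z in QT Omega T) (f z)%:E =
   \int[leb]_(t in D) \int[mu]_(x in Omega) (f (x, t))%:E)%E.
Proof.
move=> mf f0; pose g := (EFin \o f) \_ (QT Omega T).
have mg : measurable_fun setT g.
  by apply/(measurable_restrictT _ measurable_QT)/measurable_EFinP.
have g0 z : (0 <= g z)%E by rewrite /g patchE; case: ifPn => // /set_mem /f0 /=; rewrite lee_fin.
have E := @fubini_tonelli2 _ _ _ _ R (lebesgue_rV_sf R d) (@lebesgue_measure R) g mg g0.
rewrite [LHS]integral_mkcond; transitivity (\int[lebesgue_rV_sf R d \x @lebesgue_measure R]_z g z)%E; first exact: erefl.
rewrite E [RHS]integral_mkcond; apply: eq_integral => t _.
rewrite patchE /fubini_G; case: ifPn => Dt.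
  rewrite [RHS]integral_mkcond; apply: eq_integral => x _.
  rewrite /g !patchE /QT; congr (if _ then _ else _); apply/idP/idP => /set_mem.
    by move=> [/= Ox _]; exact/mem_set.
  by move=> Ox; apply/mem_set; split => //=; exact: set_mem.
apply: integral0_eq => x _; rewrite /g patchE ifN//.
apply: contra Dt => /set_mem[/= _ Dt]; exact/mem_set.
Qed.

(** Simple functions are jointly measurable in space and time; a general
square-integrable function of time with values in L^2 is so only up to the choice
of representatives. *)
Definition simple_QT (s : simple_data XL) (z : 'rV[R]_d * measurableTypeR R) : R :=
  simple_fun s z.2 z.1.

Lemma measurable_simple_QT (s : simple_data XL) :
  measurable_fun (QT Omega T) (simple_QT s).
Proof.
have -> : simple_QT s = (fun z => \sum_(i < simple_size s)
    (\1_(simple_set i) z.2 * (@simple_val _ _ _ s i) z.1)).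
  by apply/funext => z; rewrite /simple_QT /simple_fun fct_sumE.
apply: measurable_sum => i.
have mi := @simple_measurable _ _ _ s i.
have mv := L2_measurable mO (@simple_in _ _ _ s i).
apply: measurable_funM.
  apply: (@measurable_comp _ _ _ _ _ _ setT (\1_(simple_set i) : R -> R) _ snd) => //.
  by apply: measurable_funTS; exact: measurable_snd.
apply: (@measurable_comp _ _ _ _ _ _ Omega _ _ fst) => //; first by move=> x [z [Oz _] <-].
by apply: measurable_funTS; exact: measurable_fst.
Qed.

Lemma tonelli_simple_QT (s : simple_data XL) :
  (\int[mu \x leb]_(z in QT Omega T) (simple_QT s z ^+ 2)%:E =
   \int[leb]_(t in D) (dotL2 Omega (simple_fun s t) (simple_fun s t))%:E)%E.
Proof.
rewrite tonelli_QT; last 2 first.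
- by apply: measurable_funX; exact: measurable_simple_QT.
- by move=> z _; exact: sqr_ge0.
apply: eq_integral => t _; rewrite EFin_Rintegral//.
have sL2 : subspace (hset XL) by exact: L2_subspace.
by apply: L2_rint_mul => //; exact: (simple_fun_in sL2).
Qed.

Lemma simple_QT_L2 (s : simple_data XL) :
  rint leb D (fun t => dotL2 Omega (simple_fun s t) (simple_fun s t)) ->
  L2_QT Omega T (simple_QT s).
Proof.
move=> rs; apply/(L2P _ measurable_QT); split; first exact: measurable_simple_QT.
apply: rint_lty.
- by apply: measurable_funX; exact: measurable_simple_QT.
- by move=> z _; exact: sqr_ge0.
rewrite tonelli_simple_QT -(EFin_Rintegral mD rs); exact: ltry.
Qed.

Lemma simple_QT_ae0 (s : simple_data XL) :
  rint leb D (fun t => dotL2 Omega (simple_fun s t) (simple_fun s t)) ->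
  ae_zero_QT Omega T (simple_QT s) ->
  {ae @lebesgue_measure R, forall t, D t ->
    dotL2 Omega (simple_fun s t) (simple_fun s t) = 0}.
Proof.
move=> rs s0; have s2 := L2_rint_sqr measurable_QT (simple_QT_L2 rs).
apply: (Rintegral_eq0 mD rs) => [t Dt|].
  by apply: Rintegral_ge0 => x _; rewrite -expr2 sqr_ge0.
apply: EFin_inj; rewrite (EFin_Rintegral mD rs) -tonelli_simple_QT.
rewrite -(EFin_Rintegral measurable_QT s2); congr EFin.
apply: etrans (ae_eq_Rintegral measurable_QT (g := fun=> 0) _ _ _) _ => //.
- exact: rint_measurable s2.
- by apply: ae_imply s0 => z h Qz; rewrite h// expr0n.
- by rewrite Rintegral_cst ?mul0r//; exact: measurable_QT.
Qed.

End space_time.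

(** * Weighted integrals in time *)

Section weighted_integrals.
Variables (R : realType) (T : R).
Hypothesis T0 : 0 < T.
Let leb := @lebesgue_measure R.
Let D : set R := `]0, T[%classic.
Let mD : measurable (D : set (measurableTypeR R)). Proof. exact: measurable_itv. Qed.
Implicit Types f g h : R -> R.

Lemma rint_weighted h : rint leb D h -> rint leb D (fun s => h s * expR (- (s / T))).
Proof.
move=> rh; apply: (rint_le mD (g := fun s => `|h s|)).
- apply: measurable_funM; first exact: rint_measurable rh.
  apply: measurable_funTS; apply: continuous_measurable_fun => x.
  apply: continuous_comp; last exact: continuous_expR.
  by apply: cvgN; apply: cvgM; [exact: cvg_id|exact: cvg_cst].
- by rewrite /rint; exact: integrable_abse rh.
- move=> s Ds; rewrite normrM ler_piMr ?normr_ge0// ger0_norm ?expR_ge0//.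
  rewrite -[leRHS](@expR0 R) ler_expR oppr_le0 divr_ge0//; last exact: ltW.
  by move: Ds; rewrite /D /= in_itv/= => /andP[/ltW].
Qed.

Lemma weightedD f g : rint leb D f -> rint leb D g ->
  weighted_integral T (fun t => f t + g t) = weighted_integral T f + weighted_integral T g.
Proof.
move=> rf rg; rewrite /weighted_integral -RintegralD//; try exact: rint_weighted.
by apply: eq_Rintegral => t _; rewrite mulrDl.
Qed.

Lemma weightedZ k f : rint leb D f ->
  weighted_integral T (fun t => k * f t) = k * weighted_integral T f.
Proof.
move=> rf; rewrite /weighted_integral -RintegralZl//; try exact: rint_weighted.
by apply: eq_Rintegral => t _; rewrite mulrA.
Qed.

Lemma weighted_le f g : rint leb D f -> rint leb D g ->
  (forall t, D t -> f t <= g t) -> weighted_integral T f <= weighted_integral T g.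
Proof.
move=> rf rg fg; apply: le_Rintegral => //; try exact: rint_weighted.
by move=> t Dt; rewrite ler_wpM2r ?expR_ge0// fg.
Qed.

Lemma weighted_ge0 f : (forall t, D t -> 0 <= f t) -> 0 <= weighted_integral T f.
Proof. by move=> f0; apply: Rintegral_ge0 => t Dt; rewrite mulr_ge0 ?expR_ge0// f0. Qed.

Lemma weighted_eq0 f : rint leb D f -> (forall t, D t -> 0 <= f t) ->
  weighted_integral T f = 0 -> {ae @lebesgue_measure R, forall t, D t -> f t = 0}.
Proof.
move=> rf f0 fw.
have := Rintegral_eq0 mD (rint_weighted rf) _ fw.
move=> /(_ _)/wrap[t Dt|]; first by rewrite mulr_ge0 ?expR_ge0// f0.
apply: ae_imply => t h Dt; have /eqP := h Dt.
by rewrite mulf_eq0 (gt_eqF (expR_gt0 _)) orbF => /eqP.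
Qed.

Lemma weighted_ae0 f : rint leb D f ->
  {ae @lebesgue_measure R, forall t, D t -> f t = 0} -> weighted_integral T f = 0.
Proof.
move=> rf f0; apply: etrans (ae_eq_Rintegral mD (g := fun=> 0) _ _ _) _ => //.
- exact: rint_measurable (rint_weighted rf).
- by apply: ae_imply f0 => t h Dt; rewrite h// mul0r.
- by rewrite Rintegral_cst ?mul0r.
Qed.

Lemma weighted_cvg (f_ : nat -> R -> R) f g : (forall n, rint leb D (f_ n)) ->
  rint leb D g -> (forall n t, D t -> `|f_ n t| <= g t) ->
  (forall t, D t -> f_ n t @[n --> \oo] --> f t) ->
  weighted_integral T (f_ n) @[n --> \oo] --> weighted_integral T f.
Proof.
move=> rf rg fg cf.
apply: (proj2 (rint_dominated_cvg (mu := leb) mD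
  (f_ := fun n t => f_ n t * expR (- (t / T))) (f := fun t => f t * expR (- (t / T)))
  (g := fun t => g t * expR (- (t / T))) _ _ _ _)).
- by move=> n; exact: rint_measurable (rint_weighted (rf n)).
- by move=> t Dt; apply: cvgM; [exact: cf|exact: cvg_cst].
- exact: rint_weighted.
- by move=> n t Dt; rewrite normrM (ger0_norm (expR_ge0 _)) ler_wpM2r ?expR_ge0// fg.
Qed.

End weighted_integrals.

(** * The dual inner product *)

Section newton_potential.
Variables (R : realType) (d : nat) (Omega : set 'rV[R]_d).
Hypotheses (oO : open Omega) (bO : bounded_set Omega).
Variables (c : 'rV[R]_d -> R) (c0 C_Omega : R).
Let mu := lebesgue_rV R d.
Hypotheses (hc : Linfty Omega c) (c0_gt0 : 0 < c0)
  (c_ge : {ae mu, forall x, Omega x -> c0 <= c x})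
  (C_gt0 : 0 < C_Omega) (hC : poincare_constant Omega C_Omega).
Implicit Types u v w z y : 'rV[R]_d -> R.
Let mO : measurable Omega. Proof. exact: mOmega. Qed.
Let sL : subspace (L2 mu Omega). Proof. exact: L2_subspace. Qed.
Let fL : psd_form (L2 mu Omega) (dotL2 Omega). Proof. exact: dotL2_form. Qed.
Let sH : subspace (H10 Omega). Proof. exact: H10_subspace. Qed.
Let fH : psd_form (H10 Omega) (hdot (H10_space Omega)). Proof. exact: H10_form. Qed.
Let fc : psd_form (H10 Omega) (c2grad Omega c). Proof. exact: c2grad_form. Qed.
Local Notation a := (c2grad Omega c).
Local Notation K2 := (C_Omega ^+ 2 / c0 ^+ 2).
Local Notation N w := (newton Omega c (L2_to_dual Omega w)).
Local Notation XL := (L2_space Omega).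
Local Notation XH := (H10_space Omega).

Let nw w : L2 mu Omega w -> H10 Omega (N w) /\ forall v, H10 Omega v -> a (N w) v = dotL2 Omega w v.
Proof. exact: (newton_spec oO bO hc c0_gt0 c_ge C_gt0 hC). Qed.

Lemma newton_H10 w : L2 mu Omega w -> H10 Omega (N w).
Proof. by move=> /nw[]. Qed.

Lemma c2grad_newton w v : L2 mu Omega w -> H10 Omega v -> a (N w) v = dotL2 Omega w v.
Proof. by move=> /nw[_]; exact. Qed.

(** The element [z] is the potential of [y], so [a z z] is the pairing of [y]
with [z], which Cauchy-Schwarz and Poincare bound. *)
Lemma c2grad_le_dual z y : H10 Omega z -> L2 mu Omega y ->
  (forall v, H10 Omega v -> a z v = dotL2 Omega y v) -> a z z <= K2 * dotL2 Omega y y.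
Proof.
move=> Hz Ly zy; have Lz := H10_L2 Hz.
have k0 : 0 <= K2 by rewrite divr_ge0 ?sqr_ge0.
have := psd_cauchy_schwarz sL fL Ly Lz; rewrite -(zy z Hz).
have := poincare_c2grad oO bO hc c0_gt0 c_ge C_gt0 hC Hz.
have := psd_ge0 fc Hz; have := psd_ge0 fL Ly.
move: (a z z) (dotL2 Omega y y) (dotL2 Omega z z) => p q r q0 p0 rp cs.
have [->|pn0] := eqVneq p 0; first by rewrite mulr_ge0.
have pp : 0 < p by rewrite lt_neqAle eq_sym pn0.
rewrite -(ler_pM2l pp) -expr2; apply: le_trans cs _.
have -> : p * (K2 * q) = q * (K2 * p) by ring.
by rewrite ler_wpM2l.
Qed.

(** The inner product of the dual norm: the dual pairing of [w] with the
potential of [z]. *)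
Definition newton_form w z : R := a (N w) (N z).

Lemma newton_formE w z : L2 mu Omega w -> L2 mu Omega z -> newton_form w z = dotL2 Omega w (N z).
Proof. by move=> Lw Lz; apply: c2grad_newton => //; exact: newton_H10. Qed.

Lemma newton_form_psd : psd_form (L2 mu Omega) newton_form.
Proof.
split.
- move=> k u v w Lu Lv Lw; have Lku := subspaceZ sL k Lu.
  have LN := H10_L2 (newton_H10 Lw).
  rewrite !newton_formE//; last exact: subspaceD.
  by rewrite (psdDl fL)// (psdZl sL fL).
- by move=> u v Lu Lv; rewrite /newton_form (psd_sym fc)//; exact: newton_H10.
- by move=> u Lu; apply: (psd_ge0 fc); exact: newton_H10.
Qed.

Lemma newton_form_le w : L2 mu Omega w -> newton_form w w <= K2 * dotL2 Omega w w.
Proof.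
move=> Lw; apply: c2grad_le_dual => //; first exact: newton_H10.
by move=> v Hv; exact: c2grad_newton.
Qed.

Variable D : set R.
Hypothesis mD : measurable (D : set (measurableTypeR R)).

Lemma L2B_newton (u : R -> 'rV[R]_d -> R) : L2B XL D u -> L2B XH D (fun t => N (u t)).
Proof.
have [A [A0 hA]] := H10_norm_le oO bO hc c0_gt0 c_ge C_gt0 hC.
have k0 : 0 <= K2 by rewrite divr_ge0 ?sqr_ge0.
move=> Lu; refine (@L2B_map R _ XL XH sL fL sH fH D mD (fun w => N w) (Num.sqrt (A * K2))
  newton_H10 _ u Lu) => x n k v Lx Lv.
set z := _ - _; set y := (X in hnorm XL X).
have LS : L2 mu Omega (\sum_i k i *: v i).
  by apply: (subspace_sum sL) => i; apply: (subspaceZ sL); exact: Lv.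
have HN i : H10 Omega (N (v i)) by apply: newton_H10; exact: Lv.
have HS : H10 Omega (\sum_i k i *: N (v i)).
  by apply: (subspace_sum sH) => i; exact: (subspaceZ sH).
have Ly : L2 mu Omega y by exact: (subspaceB sL).
have Hz : H10 Omega z by apply: (subspaceB sH) => //; exact: newton_H10.
rewrite /hnorm -(sqrtrM _ (mulr_ge0 A0 k0)); apply: ler_wsqrtr.
apply: le_trans (hA z Hz) _; rewrite -mulrA ler_wpM2l//.
apply: c2grad_le_dual => // g Hg; have Lg := H10_L2 Hg.
rewrite /z /y (psdBl fc)//; last exact: newton_H10.
rewrite (psdBl fL)// c2grad_newton//; congr (_ - _).
rewrite (psd_suml sH fc) ?(psd_suml sL fL)//.
- by apply: eq_bigr => i _; rewrite (psdZl sH fc) ?(psdZl sL fL) ?c2grad_newton//; exact: Lv.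
- by move=> i; apply: (subspaceZ sL); exact: Lv.
- by move=> i; exact: (subspaceZ sH).
Qed.

Lemma L2B_inclusion (u : R -> 'rV[R]_d -> R) : L2B XH D u -> L2B XL D u.
Proof.
apply: (L2B_map (X := XH) (Y := XL) sH fH sL fL mD (N := id) (K := 1)) => [x|x n k v Hx Hv].
  exact: H10_L2.
rewrite mul1r; apply: ler_wsqrtr; apply: dotL2_le_H10 => //.
by apply: (subspaceB sH) => //; apply: (subspace_sum sH) => i; apply: (subspaceZ sH); exact: Hv.
Qed.

End newton_potential.

(** * Densities of the bilinear form and of the norms *)

Section densities.
Variables (R : realType) (E : lmodType R) (SL SH : set E) (dot a : E -> E -> R) (N : E -> E).
Hypotheses (sL : subspace SL) (sH : subspace SH) (HL : SH `<=` SL).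
Hypotheses (fL : psd_form SL dot) (fc : psd_form SH a).
Hypotheses (NH : forall w, SL w -> SH (N w))
  (aN : forall w v, SL w -> SH v -> a (N w) v = dot w v).
Let nf w z := a (N w) (N z).
Hypothesis fN0 : psd_form SL (fun w z => a (N w) (N z)).
Let fN : psd_form SL nf := fN0.
Variable K2 : R.
Hypotheses (poincare : forall z, SH z -> dot z z <= K2 * a z z)
  (dual_le : forall w, SL w -> nf w w <= K2 * dot w w).

Variables (T : R) (u u' v v' : E).
Hypotheses (Hu : SH u) (Hu' : SH u') (Lv : SL v) (Lv' : SL v').
Let lambda := (2 * T) *: u' + N v'.
Let chi := (2 * T) *: v' + (-1) *: u'.
Let HN : SH (N v') := NH Lv'.
Let Lu' : SL u' := HL Hu'.
Let LN : SL (N v') := HL HN.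
Let nfE w : SL w -> nf w v' = dot w (N v').
Proof. by move=> Lw; exact: aN. Qed.

(** The cross terms [dot u' v'] cancel, and Young's inequality bounds the
remaining ones, [a u (N v')] and [dot v u']. *)
Lemma form_density_ge :
  1 / 2 * (dot u' u' + nf v' v') + 2 * T * (a u u' + dot v v') + dot u' chi
  <= dot v' lambda + a u lambda + dot v chi + 1 / 2 * (a u u + dot v v).
Proof.
have e1 : dot v' lambda = 2 * T * dot u' v' + nf v' v'.
  rewrite /lambda (psdDr sL fL)//; last exact: (subspaceZ sL).
  by rewrite (psdZr sL fL)// -nfE// (psd_sym fL Lv' Lu').
have e2 : a u lambda = 2 * T * a u u' + a u (N v').
  rewrite /lambda (psdDr sH fc)//; last exact: (subspaceZ sH).
  by rewrite (psdZr sH fc).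
have echi w : SL w -> dot w chi = 2 * T * dot w v' - dot w u'.
  move=> Lw; rewrite /chi (psdDr sL fL)//; [|exact: (subspaceZ sL)..].
  by rewrite !(psdZr sL fL)// mulN1r.
rewrite e1 e2 !echi//.
have := psd_ge0 fc (subspaceD sH Hu HN); rewrite (psdDl fc)//; last exact: (subspaceD sH).
rewrite !(psdDr sH fc)// (psd_sym fc HN Hu) -/(nf v' v').
have := psd_ge0 fL (subspaceB sL Lv Lu'); rewrite (psdBl fL)//; last exact: (subspaceB sL).
rewrite !(psdBr sL fL)// (psd_sym fL Lu' Lv) => h1 h2.
by lra.
Qed.

(** The opposite signs in [lambda] and [chi] make the cross terms cancel, as
[nf u' v' = dot u' (N v')]. *)
Let norm_densityE : dot lambda lambda + nf chi chi =
  dot (N v') (N v') + nf u' u' + 4 * T ^+ 2 * (dot u' u' + nf v' v').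
Proof.
have -> : dot lambda lambda = (2 * T) ^+ 2 * dot u' u' + 2 * (2 * T) * dot u' (N v') +
    dot (N v') (N v').
  have L2T := subspaceZ sL (2 * T) Lu'.
  rewrite /lambda (psdDl fL)//; last exact: (subspaceD sL).
  rewrite !(psdDr sL fL)// !(psdZl sL fL)// !(psdZr sL fL)// (psd_sym fL LN Lu'); ring.
have -> : nf chi chi = (2 * T) ^+ 2 * nf v' v' - 2 * (2 * T) * dot u' (N v') + nf u' u'.
  have L2T := subspaceZ sL (2 * T) Lv'; have L1 := subspaceZ sL (-1) Lu'.
  rewrite /chi (psdDl fN)//; last exact: (subspaceD sL).
  rewrite !(psdDr sL fN)// !(psdZl sL fN)// !(psdZr sL fN)// (psd_sym fN Lv' Lu') (nfE Lu'); ring.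
by ring.
Qed.

Lemma norm_density_ge : 4 * T ^+ 2 * (dot u' u' + nf v' v') <= dot lambda lambda + nf chi chi.
Proof. by rewrite norm_densityE lerDr addr_ge0 ?(psd_ge0 fL LN) ?(psd_ge0 fN Lu'). Qed.

Lemma norm_density_le : dot lambda lambda + nf chi chi <=
  (K2 + 4 * T ^+ 2) * (dot u' u' + nf v' v').
Proof.
rewrite norm_densityE [leRHS]mulrDl lerD2r [leRHS]mulrDr [leLHS]addrC; apply: lerD.
  exact: dual_le.
exact: poincare.
Qed.

End densities.

(** * Weak time derivatives *)

Section time_dependence.
Variables (R : realType) (E : lmodType R) (X : hilbert_data E) (T : R).
Hypotheses (hX : subspace (hset X)) (fX : psd_form (hset X) (hdot X)) (T0 : 0 < T).
Let D : set R := `]0, T[%classic.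

Lemma H1_0dot_dt u : H1_0dot X T u ->
  [/\ L2B X D u, L2B X D (dt X D u) & weak_time_derivative X D u (dt X D u)].
Proof.
move=> [[Lu ex] _]; have [L w] : H1B_derivative X D u (dt X D u) by exact: xgetPex.
by split.
Qed.

Lemma H1_0dot_energy (b : E -> E -> R) (M : R) u :
  psd_form (hset X) b -> 0 <= M -> (forall x, hset X x -> b x x <= M * hdot X x x) ->
  H1_0dot X T u ->
  weighted_integral T (fun t => b (u t) (u t)) <=
  2 * T * weighted_integral T (fun t => b (u t) (dt X D u t)).
Proof.
move=> fb M0 bM Hu; have [Lu Lu' wd] := H1_0dot_dt Hu.
have [_ [u0 [S0 c0 u0u u00]]] := Hu.
have TT : 0 < 2 * T by rewrite mulr_gt0.
rewrite -ler_pdivrMl//.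
exact: (energy_inequality hX fX fb M0 bM T0 Lu Lu' wd S0 c0 u0u u00).
Qed.

End time_dependence.

(** * The inf-sup estimate with simple test functions *)

Section inf_sup.
Variables (R : realType) (E : lmodType R) (XH XL : hilbert_data E).
Variables (a : E -> E -> R) (N : E -> E) (T K2 M : R).
Let SH := hset XH.
Let SL := hset XL.
Let dot := hdot XL.
Let D : set R := `]0, T[%classic.
Let leb := @lebesgue_measure R.
Hypotheses (T0 : 0 < T) (K20 : 0 <= K2) (M0 : 0 <= M).
Hypotheses (sL : subspace SL) (sH : subspace SH) (HL : SH `<=` SL).
Hypotheses (fL : psd_form SL dot) (fH : psd_form SH (hdot XH)) (fc : psd_form SH a).
Hypotheses (NH : forall w, SL w -> SH (N w))
  (aN : forall w v, SL w -> SH v -> a (N w) v = dot w v).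
Let nf w z := a (N w) (N z).
Hypothesis fN0 : psd_form SL (fun w z => a (N w) (N z)).
Let fN : psd_form SL nf := fN0.
Hypotheses (aM : forall x, SH x -> a x x <= M * hdot XH x x)
  (poincare : forall z, SH z -> dot z z <= K2 * a z z)
  (dual_le : forall w, SL w -> nf w w <= K2 * dot w w)
  (a_null : forall z, SH z -> dot z z = 0 -> a z z = 0)
  (dense : forall w, SL w -> (forall v, SH v -> dot w v = 0) -> dot w w = 0).
Hypotheses (L2B_N : forall u : R -> E, L2B XL D u -> L2B XH D (fun t => N (u t)))
  (L2B_HL : forall u : R -> E, L2B XH D u -> L2B XL D u).
Variables U V : R -> E.
Hypotheses (HU : H1_0dot XH T U) (HV : H1_0dot XL T V).
Let mD : measurable (D : set (measurableTypeR R)). Proof. exact: measurable_itv. Qed.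
Let U' := dt XH D U.
Let V' := dt XL D V.
Local Notation wI := (weighted_integral T).

Let LU : L2B XH D U. Proof. by have [] := H1_0dot_dt HU. Qed.
Let LU' : L2B XH D U'. Proof. by have [] := H1_0dot_dt HU. Qed.
Let LV : L2B XL D V. Proof. by have [] := H1_0dot_dt HV. Qed.
Let LV' : L2B XL D V'. Proof. by have [] := H1_0dot_dt HV. Qed.

Let dot1 x : SL x -> dot x x <= 1 * hdot XL x x. Proof. by rewrite mul1r. Qed.

Let rdot u v : L2B XL D u -> L2B XL D v -> rint leb D (fun t => dot (u t) (v t)).
Proof. by move=> Lu Lv; exact: (rint_form sL fL mD fL ler01 dot1 Lu Lv). Qed.

Let rnf u v : L2B XL D u -> L2B XL D v -> rint leb D (fun t => nf (u t) (v t)).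
Proof. by move=> Lu Lv; exact: (rint_form sL fL mD fN K20 dual_le Lu Lv). Qed.

Let ra u v : L2B XH D u -> L2B XH D v -> rint leb D (fun t => a (u t) (v t)).
Proof. by move=> Lu Lv; exact: (rint_form sH fH mD fc M0 aM Lu Lv). Qed.

(** In the test pair, [N (V' t)] and [- U' t] produce the norms of the time
derivatives, while the multiples of [U' t] and [V' t] bring in the energy
inequality for [U] and [V]. *)
Definition test_lambda (t : R) : E := (2 * T) *: U' t + N (V' t).
Let chi (t : R) : E := (2 * T) *: V' t + (-1) *: U' t.

Lemma test_lambda_L2B : L2B XH D test_lambda.
Proof. exact: (L2B_lin sH fH mD (2 * T) LU' (L2B_N LV')). Qed.

Let Lchi : L2B XL D chi.
Proof.
apply: (L2B_lin sL fL mD (2 * T) LV').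
have -> : (fun t => (-1) *: U' t) = (fun t => (-1) *: U' t + 0).
  by apply/funext => t; rewrite addr0.
apply: (L2B_lin sL fL mD (-1) (L2B_HL LU')).
exact: (L2B_cst sL fL T0 (subspace0 sL)).
Qed.
Let Llam := test_lambda_L2B.
Let LlamL := L2B_HL Llam.
Let LU'L := L2B_HL LU'.

Let SU t : D t -> SH (U t). Proof. exact: L2B_in LU. Qed.
Let SU' t : D t -> SH (U' t). Proof. exact: L2B_in LU'. Qed.
Let SV t : D t -> SL (V t). Proof. exact: L2B_in LV. Qed.
Let SV' t : D t -> SL (V' t). Proof. exact: L2B_in LV'. Qed.

(** The squared norm of the pair [(U, V)] is the sum of [alpha], where the time
derivatives occur, and [beta]. *)
Let alpha := wI (fun t => dot (U' t) (U' t)) + wI (fun t => nf (V' t) (V' t)).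
Let beta := wI (fun t => a (U t) (U t)) + wI (fun t => dot (V t) (V t)).
Let A (x : R -> E) := wI (fun t => dot (V' t) (test_lambda t)) + wI (fun t => a (U t) (test_lambda t))
  - wI (fun t => dot (U' t) (x t)) + wI (fun t => dot (V t) (x t)).
Let W (x : R -> E) := wI (fun t => dot (test_lambda t) (test_lambda t)) + wI (fun t => nf (x t) (x t)).

Let energyU : wI (fun t => a (U t) (U t)) <= 2 * T * wI (fun t => a (U t) (U' t)).
Proof. exact: (H1_0dot_energy sH fH T0 fc M0 aM HU). Qed.

Let energyV : wI (fun t => dot (V t) (V t)) <= 2 * T * wI (fun t => dot (V t) (V' t)).
Proof. exact: (H1_0dot_energy sL fL T0 fL ler01 dot1 HV). Qed.

Let A_ge : 1 / 2 * (alpha + beta) <= A chi.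
Proof.
have r1 := rdot LU'L LU'L; have r2 := rnf LV' LV'; have r3 := ra LU LU'.
have r4 := rdot LV LV'; have r5 := rdot LU'L Lchi; have r6 := rdot LV' LlamL.
have r7 := ra LU Llam; have r8 := rdot LV Lchi; have r9 := ra LU LU; have r0 := rdot LV LV.
have rl1 := rintD mD r1 r2; have rl2 := rintD mD r3 r4.
have rl3 := rintD mD (rintZ mD (1 / 2) rl1) (rintZ mD (2 * T) rl2).
have rr1 := rintD mD r6 r7; have rr2 := rintD mD rr1 r8; have rr3 := rintD mD r9 r0.
have rr4 := rintZ mD (1 / 2) rr3.
have := weighted_le T0 (rintD mD rl3 r5) (rintD mD rr2 rr4) (fun t Dt =>
  form_density_ge sL sH HL fL fc NH aN T (SU Dt) (SU' Dt) (SV Dt) (SV' Dt)).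
rewrite (weightedD T0 rl3 r5) (weightedD T0 (rintZ mD (1 / 2) rl1) (rintZ mD (2 * T) rl2)).
rewrite (weightedZ T0 (1 / 2) rl1) (weightedZ T0 (2 * T) rl2).
rewrite (weightedD T0 r1 r2) (weightedD T0 r3 r4).
rewrite (weightedD T0 rr2 rr4) (weightedD T0 rr1 r8) (weightedD T0 r6 r7).
rewrite (weightedZ T0 (1 / 2) rr3) (weightedD T0 r9 r0).
have := energyU; have := energyV; rewrite /A /alpha /beta /test_lambda /chi.
set x1 := wI _; set x2 := wI _; set x3 := wI _; set x4 := wI _ => h1 h2 h3.
lra.
Qed.

Let W_ge : 4 * T ^+ 2 * alpha <= W chi.
Proof.
have r1 := rdot LU'L LU'L; have r2 := rnf LV' LV'.
have rl := rdot LlamL LlamL; have rc := rnf Lchi Lchi.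
have := weighted_le T0 (rintZ mD (4 * T ^+ 2) (rintD mD r1 r2)) (rintD mD rl rc)
  (fun t Dt => norm_density_ge sL HL fL NH aN fN0 T (SU' Dt) (SV' Dt)).
by rewrite (weightedZ T0 _ (rintD mD r1 r2)) (weightedD T0 r1 r2) (weightedD T0 rl rc).
Qed.

Let W_le : W chi <= (K2 + 4 * T ^+ 2) * alpha.
Proof.
have r1 := rdot LU'L LU'L; have r2 := rnf LV' LV'.
have rl := rdot LlamL LlamL; have rc := rnf Lchi Lchi.
have := weighted_le T0 (rintD mD rl rc) (rintZ mD (K2 + 4 * T ^+ 2) (rintD mD r1 r2))
  (fun t Dt => norm_density_le sL HL fL NH aN fN0 poincare dual_le T (SU' Dt) (SV' Dt)).
by rewrite (weightedZ T0 _ (rintD mD r1 r2)) (weightedD T0 r1 r2) (weightedD T0 rl rc).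
Qed.

Let alpha1_ge0 : 0 <= wI (fun t => dot (U' t) (U' t)).
Proof. by apply: weighted_ge0 => t Dt; apply: (psd_ge0 fL); apply: HL; exact: SU'. Qed.

Let alpha2_ge0 : 0 <= wI (fun t => nf (V' t) (V' t)).
Proof. by apply: weighted_ge0 => t Dt; apply: (psd_ge0 fN); exact: SV'. Qed.

(** If the time derivatives vanish, so does the right-hand side of the energy
inequality, which bounds [beta]. *)
Let alpha_gt0 : 0 < beta -> 0 < alpha.
Proof.
move=> b0; rewrite lt_neqAle addr_ge0// andbT; apply/negP => /eqP a0.
have z1 : wI (fun t => dot (U' t) (U' t)) = 0.
  by move: a0 alpha1_ge0 alpha2_ge0; rewrite /alpha; lra.
have z2 : wI (fun t => nf (V' t) (V' t)) = 0.
  by move: a0 alpha1_ge0 alpha2_ge0; rewrite /alpha; lra.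
have w1 : wI (fun t => a (U t) (U' t)) = 0.
  apply: (weighted_ae0 T0 (ra LU LU')).
  have := weighted_eq0 T0 (rdot LU'L LU'L) _ z1.
  move=> /(_ (fun t Dt => psd_ge0 fL (HL (SU' Dt)))); apply: ae_imply => t h Dt.
  rewrite (psd_sym fc (SU Dt) (SU' Dt)); apply: (psd_null sH fc (SU' Dt) (SU Dt)).
  exact: a_null (SU' Dt) (h Dt).
have w2 : wI (fun t => dot (V t) (V' t)) = 0.
  apply: (weighted_ae0 T0 (rdot LV LV')).
  have := weighted_eq0 T0 (rnf LV' LV') _ z2.
  move=> /(_ (fun t Dt => psd_ge0 fN (SV' Dt))); apply: ae_imply => t h Dt.
  rewrite (psd_sym fL (SV Dt) (SV' Dt)); apply: (psd_null sL fL (SV' Dt) (SV Dt)).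
  apply: dense (SV' Dt) _ => v Hv; rewrite -(aN (SV' Dt) Hv).
  exact: (psd_null sH fc (NH (SV' Dt)) Hv (h Dt)).
move: b0 energyU energyV; rewrite /beta w1 w2 !mulr0.
by move=> h h1 h2; lra.
Qed.

Let S := Num.sqrt (K2 + 4 * T ^+ 2).

Let psd_young b x y : psd_form SL b -> SL x -> SL y -> `|b x y| <= b x x + b y y.
Proof.
move=> fb Sx Sy.
have := psd_ge0 fb (subspaceD sL Sx Sy); rewrite (psdDl fb Sx Sy (subspaceD sL Sx Sy)).
rewrite (psdDr sL fb Sx Sy Sx) (psdDr sL fb Sx Sy Sy) (psd_sym fb Sy Sx).
have := psd_ge0 fb (subspaceB sL Sx Sy); rewrite (psdBl fb Sx Sy (subspaceB sL Sx Sy)).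
rewrite (psdBr sL fb Sx Sy Sx) (psdBr sL fb Sx Sy Sy) (psd_sym fb Sy Sx).
have := psd_ge0 fb Sx; have := psd_ge0 fb Sy.
by move=> h1 h2 h3 h4; rewrite ler_norml; apply/andP; split; lra.
Qed.

Section simple_approximation.
Variable s : nat -> simple_data XL.
Hypotheses (s_le : forall n t, D t ->
    dot (simple_fun (s n) t) (simple_fun (s n) t) <= 4 * dot (chi t) (chi t))
  (s_cvg : forall t, D t -> hnorm XL (chi t - simple_fun (s n) t) @[n --> \oo] --> (0 : R)).

Let Schi t : D t -> SL (chi t). Proof. exact: L2B_in Lchi. Qed.
Let Ss n t : SL (simple_fun (s n) t). Proof. exact: (simple_fun_in sL). Qed.

Let Ls n : L2B XL D (simple_fun (s n)).
Proof.
have ms := strongly_measurable_simple sL fL D (s n).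
apply: (L2BP fL) => //; first by move=> t _; exact: Ss.
apply: (rint_le mD (g := fun t => 4 * dot (chi t) (chi t))).
- by apply: (measurable_hdot sL fL _ _ ms ms) => t _; exact: Ss.
- by apply: rintZ => //; exact: rdot.
- by move=> t Dt; rewrite ger0_norm ?s_le//; exact: (psd_ge0 fL (Ss n t)).
Qed.

Let cvg_dot w : L2B XL D w ->
  wI (fun t => dot (w t) (simple_fun (s n) t)) @[n --> \oo] --> wI (fun t => dot (w t) (chi t)).
Proof.
move=> Lw; apply: (weighted_cvg T0
  (g := fun t => dot (w t) (w t) + 4 * dot (chi t) (chi t))).
- by move=> n; exact: (rdot Lw (Ls n)).
- by apply: rintD => //; [exact: rdot|apply: rintZ => //; exact: rdot].
- move=> n t Dt; have Sw := L2B_in Lw Dt; apply: le_trans (psd_young fL Sw (Ss n t)) _.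
  by rewrite lerD2l; exact: s_le.
- move=> t Dt; have Sw := L2B_in Lw Dt.
  have c0 : hnorm XL (w t - w t) @[n --> \oo] --> (0 : R).
    have d0 : hdot XL 0 0 = 0 := psd0l sL fL (subspace0 sL).
    by rewrite subrr /hnorm d0 sqrtr0; exact: cvg_cst.
  exact: (bounded_form_cvg sL fL ler01 dot1 (fun=> Sw) (fun n => Ss n t) Sw (Schi Dt) c0
    (s_cvg Dt)).
Qed.

Let cvg_nf : wI (fun t => nf (simple_fun (s n) t) (simple_fun (s n) t)) @[n --> \oo] -->
  wI (fun t => nf (chi t) (chi t)).
Proof.
apply: (weighted_cvg T0 (g := fun t => K2 * (4 * dot (chi t) (chi t)))).
- by move=> n; exact: (rnf (Ls n) (Ls n)).
- by apply: rintZ => //; apply: rintZ => //; exact: rdot.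
- move=> n t Dt; rewrite ger0_norm ?(psd_ge0 fN (Ss n t))//.
  by apply: le_trans (dual_le (Ss n t)) _; rewrite ler_wpM2l// s_le.
- move=> t Dt; exact: (bounded_form_cvg sL fN K20 dual_le (fun n => Ss n t) (fun n => Ss n t)
    (Schi Dt) (Schi Dt) (s_cvg Dt) (s_cvg Dt)).
Qed.

Let cvg_A : A (simple_fun (s n)) @[n --> \oo] --> A chi.
Proof.
rewrite /A; apply: cvgD; last exact: cvg_dot LV.
by apply: cvgB; [exact: cvg_cst|exact: cvg_dot LU'L].
Qed.

Let cvg_W : W (simple_fun (s n)) @[n --> \oo] --> W chi.
Proof. by rewrite /W; apply: cvgD; [exact: cvg_cst|exact: cvg_nf]. Qed.

(** For [chi] the estimate is strict: the norm of the test pair is bounded in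
terms of [alpha] alone, and [beta] is positive. A strict estimate persists for
simple functions close to [chi]. *)
Lemma eventually_inf_sup : 0 < beta -> exists n,
  0 < W (simple_fun (s n)) /\
  1 / (2 * S) * (Num.sqrt (alpha + beta) * Num.sqrt (W (simple_fun (s n)))) <= A (simple_fun (s n)).
Proof.
move=> b0; have a0 := alpha_gt0 b0.
have T2 : 0 < 4 * T ^+ 2 by rewrite mulr_gt0// exprn_gt0.
have KT : 0 < K2 + 4 * T ^+ 2 by rewrite ltr_wpDl.
have S0 : 0 < S by rewrite sqrtr_gt0.
have W0 : 0 < W chi by apply: lt_le_trans W_ge; rewrite mulr_gt0.
have strict : 1 / (2 * S) * (Num.sqrt (alpha + beta) * Num.sqrt (W chi)) < A chi.
  apply: lt_le_trans A_ge.
  have WS : Num.sqrt (W chi) <= S * Num.sqrt alpha.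
    by rewrite /S -sqrtrM ?(ltW KT)//; apply: ler_wsqrtr; exact: W_le.
  have ab : 0 < alpha + beta by exact: addr_gt0.
  have lta : Num.sqrt alpha < Num.sqrt (alpha + beta).
    by rewrite (ltr_sqrt _ ab) -[ltLHS]addr0 ltrD2l.
  have P0 : 0 < Num.sqrt (alpha + beta) by rewrite sqrtr_gt0 addr_gt0.
  rewrite -[alpha + beta in ltRHS](sqr_sqrtr (ltW ab)).
  move: (Num.sqrt (alpha + beta)) (Num.sqrt alpha) (Num.sqrt (W chi)) P0 lta WS => p q w P0 lta WS.
  rewrite mul1r mulrC ltr_pdivrMr ?mulr_gt0//.
  have -> : 1 / 2 * p ^+ 2 * (2 * S) = p * (S * p) by field.
  by rewrite ltr_pM2l// (le_lt_trans WS)// ltr_pM2l.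
pose g n := A (simple_fun (s n)) -
  1 / (2 * S) * (Num.sqrt (alpha + beta) * Num.sqrt (W (simple_fun (s n)))).
have cg : g n @[n --> \oo] --> A chi - 1 / (2 * S) * (Num.sqrt (alpha + beta) * Num.sqrt (W chi)).
  apply: cvgB; first exact: cvg_A.
  apply: cvgM; first exact: cvg_cst.
  apply: cvgM; first exact: cvg_cst.
  apply: (@cvg_comp _ _ _ _ Num.sqrt _ _ _ cvg_W); exact: sqrt_continuous.
have g0 : \forall n \near \oo, 0 < g n .
  by apply: (cvgr_gt _ cg); rewrite subr_gt0.
have Wn : \forall n \near \oo, 0 < W (simple_fun (s n)) .
  by apply: (cvgr_gt _ cvg_W).
have [n [gn wn]] := filter_ex (filterI g0 Wn).
by exists n; split=> //; move: gn; rewrite /g subr_gt0 => /ltW.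
Qed.

Lemma simple_approximation_L2B n : L2B XL D (simple_fun (s n)).
Proof. exact: Ls. Qed.

End simple_approximation.

Lemma simple_inf_sup : 0 < beta -> exists x : simple_data XL,
  [/\ L2B XL D (simple_fun x),
      0 < W (simple_fun x) &
      1 / (2 * S) * (Num.sqrt (alpha + beta) * Num.sqrt (W (simple_fun x))) <= A (simple_fun x)].
Proof.
move=> b0; have [s [s_le s_cvg]] := dominated_simple sL fL mD Lchi.
have [n [W0 h]] := eventually_inf_sup s_le s_cvg b0.
by exists (s n); split; [exact: simple_approximation_L2B|exact: W0|exact: h].
Qed.

End inf_sup.

(** * Norms of pairs and the inf-sup condition *)

Section squared_norms.
Variables (R : realType) (d : nat) (Omega : set 'rV[R]_d) (T : R) (c : 'rV[R]_d -> R).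

Lemma dotL2_ge0 (f : 'rV[R]_d -> R) : 0 <= dotL2 Omega f f.
Proof. by apply: Rintegral_ge0 => x _; rewrite -expr2 sqr_ge0. Qed.

Lemma sqr_normL2e (U : R -> 'rV[R]_d -> R) :
  normL2e Omega T U ^+ 2 = weighted_integral T (fun t => dotL2 Omega (U t) (U t)).
Proof. by rewrite sqr_sqrtr//; apply: weighted_ge0 => t _; exact: dotL2_ge0. Qed.

Lemma sqr_normcgrade (U : R -> 'rV[R]_d -> R) :
  normcgrade Omega T c U ^+ 2 = weighted_integral T (fun t => c2grad Omega c (U t) (U t)).
Proof.
rewrite sqr_sqrtr; first by apply: eq_Rintegral => t _; rewrite sum_cgradE.
apply: weighted_ge0 => t _; apply: Rintegral_ge0 => x _.
by apply: sumr_ge0 => i _; exact: sqr_ge0.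
Qed.

Lemma normVeE (U V : R -> 'rV[R]_d -> R) : normVe Omega T c U V =
  Num.sqrt (weighted_integral T (fun t =>
      dotL2 Omega (dtH10 Omega T U t) (dtH10 Omega T U t)) +
    weighted_integral T (fun t =>
      newton_form Omega c (dtL2 Omega T V t) (dtL2 Omega T V t)) +
    (weighted_integral T (fun t => c2grad Omega c (U t) (U t)) +
     weighted_integral T (fun t => dotL2 Omega (V t) (V t)))).
Proof.
rewrite /normVe -[in LHS]addrA; congr (Num.sqrt (_ + _ + (_ + _))).
- exact: sqr_normL2e.
- exact: (sqr_normcgrade (fun t => newton Omega c (L2_to_dual Omega (dtL2 Omega T V t)))).
- exact: sqr_normcgrade.
- exact: sqr_normL2e.
Qed.

Lemma normWeE (lambda chi : R -> 'rV[R]_d -> R) : normWe Omega T c lambda chi =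
  Num.sqrt (weighted_integral T (fun t => dotL2 Omega (lambda t) (lambda t)) +
    weighted_integral T (fun t => newton_form Omega c (chi t) (chi t))).
Proof.
congr (Num.sqrt (_ + _)); first exact: sqr_normL2e.
exact: (sqr_normcgrade (fun t => newton Omega c (L2_to_dual Omega (chi t)))).
Qed.

End squared_norms.

Section null_functions.
Variables (R : realType) (d : nat) (Omega : set 'rV[R]_d).
Hypothesis mO : measurable Omega.
Let mu := @lebesgue_rV R d.
Implicit Types f : 'rV[R]_d -> R.

Lemma dotL2_eq0 f : L2 mu Omega f -> dotL2 Omega f f = 0 ->
  {ae mu, forall x, Omega x -> f x = 0}.
Proof.
move=> Lf f0.
have := Rintegral_eq0 mO (L2_rint_mul mO Lf Lf) (fun x _ => sqr_ge0 (f x)) f0.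
apply: ae_imply => x h Ox; apply/eqP; have /eqP := h Ox.
by rewrite mulf_eq0 orbb.
Qed.

Lemma dotL2_ae0 f : L2 mu Omega f -> {ae mu, forall x, Omega x -> f x = 0} ->
  dotL2 Omega f f = 0.
Proof.
move=> Lf f0; apply: etrans (ae_eq_Rintegral mO (g := fun=> 0) _ _ _) _ => //.
- exact: rint_measurable (L2_rint_mul mO Lf Lf).
- by apply: ae_imply f0 => x h Ox; rewrite h// mul0r.
- by rewrite Rintegral_cst ?mul0r.
Qed.

End null_functions.

Theorem proposition3p3 (R : realType) (d : nat) (hd : (1 <= d <= 3)%N)
    (Omega : set 'rV[R]_d) (hOmega : lipschitz_polytopal_domain Omega)
    (T : R) (hT : 0 < T)
    (c : 'rV[R]_d -> R) (hc : Linfty Omega c)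
    (c0 : R) (hc0 : 0 < c0)
    (hcc0 : {ae @lebesgue_rV R d, forall x, Omega x -> c0 <= c x})
    (C_Omega : R) (hC0 : 0 < C_Omega) (hC : poincare_constant Omega C_Omega) :
  forall U V : R -> 'rV[R]_d -> R,
    H1_0dot (H10_space Omega) T U ->
    H1_0dot (L2_space Omega) T V ->
    ~ (ae_zero Omega T U /\ ae_zero Omega T V) ->
    exists (lambda : R -> 'rV[R]_d -> R)
           (chi : 'rV[R]_d * measurableTypeR R -> R),
      [/\ L2B (H10_space Omega) `]0, T[ lambda,
          L2_QT Omega T chi,
          ~ (ae_zero Omega T lambda /\ ae_zero_QT Omega T chi) &
          formA Omega T c U V lambda (slice chi)
            / (normVe Omega T c U V * normWe Omega T c lambda (slice chi))
          >= 1 / (2 * Num.sqrt (C_Omega ^+ 2 / c0 ^+ 2 + 4 * T ^+ 2))].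
Proof.
move=> U V HU HV UV0.
have [[oO _ _ bO] _] := hOmega.
have mO : measurable Omega := mOmega oO.
have mD : measurable (`]0, T[%classic : set (measurableTypeR R)) by exact: measurable_itv.
pose K2 := C_Omega ^+ 2 / c0 ^+ 2; pose mu := @lebesgue_rV R d.
pose N w := newton Omega c (L2_to_dual Omega w).
have K20 : 0 <= K2 by rewrite divr_ge0 ?sqr_ge0.
have [M [M0 aM]] := c2grad_le_H10 oO hc.
have sL : subspace (hset (L2_space Omega)) by exact: L2_subspace.
have sH : subspace (hset (H10_space Omega)) := H10_subspace oO.
have fL : psd_form (hset (L2_space Omega)) (hdot (L2_space Omega)) := dotL2_form oO.
have fH := H10_form oO bO.
have fc := c2grad_form oO bO hc.
have NH := newton_H10 oO bO hc hc0 hcc0 hC0 hC.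
have aN := c2grad_newton oO bO hc hc0 hcc0 hC0 hC.
have fN := newton_form_psd oO bO hc hc0 hcc0 hC0 hC.
have pc := poincare_c2grad oO bO hc hc0 hcc0 hC0 hC.
have dual_le := newton_form_le oO bO hc hc0 hcc0 hC0 hC.
have a_null v : H10 Omega v -> dotL2 Omega v v = 0 -> c2grad Omega c v v = 0.
  exact: (c2grad_null oO bO hc).
have dense w : L2 mu Omega w -> (forall v, H10 Omega v -> dotL2 Omega w v = 0) ->
    dotL2 Omega w w = 0.
  by move=> Lw w0; apply: (dotL2_ae0 mO Lw); exact: (L2_orthogonal_H10 oO bO Lw w0).
have LN (u : R -> 'rV[R]_d -> R) : L2B (L2_space Omega) `]0, T[ u ->
    L2B (H10_space Omega) `]0, T[ (fun t => N (u t)).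
  exact: (L2B_newton oO bO hc hc0 hcc0 hC0 hC mD).
have LH (u : R -> 'rV[R]_d -> R) : L2B (H10_space Omega) `]0, T[ u ->
    L2B (L2_space Omega) `]0, T[ u.
  exact: (L2B_inclusion oO bO mD).
have [LU _ _] := H1_0dot_dt HU; have [LV _ _] := H1_0dot_dt HV.
have one x : L2 mu Omega x -> dotL2 Omega x x <= 1 * dotL2 Omega x x by rewrite mul1r.
have bU0 : 0 <= weighted_integral T (fun t => c2grad Omega c (U t) (U t)).
  by apply: weighted_ge0 => t Dt; apply: (psd_ge0 fc); exact: L2B_in LU Dt.
have bV0 : 0 <= weighted_integral T (fun t => dotL2 Omega (V t) (V t)).
  by apply: weighted_ge0 => t Dt; exact: dotL2_ge0.
have beta_gt0 : 0 < weighted_integral T (fun t => c2grad Omega c (U t) (U t)) +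
    weighted_integral T (fun t => dotL2 Omega (V t) (V t)).
  rewrite lt_neqAle (addr_ge0 bU0 bV0) andbT; apply/negP => /eqP/esym/eqP.
  rewrite (paddr_eq0 bU0 bV0) => /andP[/eqP zU /eqP zV]; apply: UV0.
  split.
    have rU := rint_form sH fH mD fc M0 aM LU LU.
    have := weighted_eq0 hT rU (fun t Dt => psd_ge0 fc (L2B_in LU Dt)) zU.
    apply: ae_imply => t h Dt; have Ht : H10 Omega (U t).
      by apply: (L2B_in LU); rewrite /= in_itv.
    apply: (dotL2_eq0 mO (H10_L2 Ht)); apply/eqP; rewrite eq_le dotL2_ge0 andbT.
    apply: le_trans (pc _ Ht) _; rewrite h ?mulr0//= in_itv/=; exact: Dt.
  have rV := rint_form sL fL mD fL ler01 one LV LV.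
  have := weighted_eq0 hT rV (fun t Dt => dotL2_ge0 _ _) zV.
  apply: ae_imply => t h Dt; have Lt : L2 mu Omega (V t).
    by apply: (L2B_in LV); rewrite /= in_itv.
  by apply: (dotL2_eq0 mO Lt); apply: h; rewrite /= in_itv.
have [s [Ls W0 hs]] := simple_inf_sup hT K20 M0 sL sH (@H10_L2 _ _ Omega) fL fH fc NH aN fN
  aM pc dual_le a_null dense LN LH HU HV beta_gt0.
pose lambda := test_lambda (H10_space Omega) (L2_space Omega) N T U V.
have Llam : L2B (H10_space Omega) `]0, T[ lambda.
  exact: (test_lambda_L2B sH fH LN HU HV).
have LlamL := LH _ Llam.
have rs := rint_form sL fL mD fL ler01 one Ls Ls.
have rnf := rint_form sL fL mD fN K20 dual_le Ls Ls.
have Ss t : L2 mu Omega (simple_fun s t) by exact: (simple_fun_in sL).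
exists lambda, (simple_QT s); split=> //.
- exact: (simple_QT_L2 oO rs).
- move=> [l0 s0].
  (* A null test pair would have norm zero. *)
  move: W0; apply/negP; rewrite -leNgt.
  rewrite (weighted_ae0 hT (rint_form sL fL mD fL ler01 one LlamL LlamL)).
    rewrite add0r (weighted_ae0 hT rnf)//.
    have := simple_QT_ae0 oO rs s0; apply: ae_imply => t h Dt.
    apply/eqP; rewrite eq_le (psd_ge0 fN (Ss t)) andbT.
    by apply: le_trans (dual_le _ (Ss t)) _; rewrite h ?mulr0.
  apply: ae_imply l0 => t h Dt; have Lt : L2 mu Omega (lambda t) by exact: (L2B_in LlamL).
  by apply: (dotL2_ae0 mO Lt); apply: h; move: Dt; rewrite /= in_itv.
have a0 : 0 <= weighted_integral T (fun t => dotL2 Omega (dtH10 Omega T U t) (dtH10 Omega T U t)) +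
    weighted_integral T (fun t => newton_form Omega c (dtL2 Omega T V t) (dtL2 Omega T V t)).
  have [_ LV' _] := H1_0dot_dt HV.
  apply: addr_ge0; apply: weighted_ge0 => t Dt; first exact: dotL2_ge0.
  by apply: (psd_ge0 fN); exact: (L2B_in LV').
have P0 := ltr_wpDl a0 beta_gt0.
rewrite normVeE normWeE ler_pdivlMr; first exact: hs.
by apply: mulr_gt0; rewrite sqrtr_gt0; [exact: P0|exact: W0].
Qed.
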